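(* Let $K$ be a field of characteristic $0$ and $\alpha,\beta,\gamma\in K$ with $\beta\neq 0$, and let $A=A(\alpha,\beta,\gamma)$ be the corresponding down-up algebra. Then every finitely generated monolithic left $A$-module is artinian if and only if both roots of $X^2-\alpha X-\beta$ (in an algebraic closure of $K$) are roots of unity.
   Context: For $\alpha,\beta,\gamma\in K$, the down-up algebra $A(\alpha,\beta,\gamma)$ is the $K$-algebra generated by $d,u$ with relations $d^2u=\alpha dud+\beta ud^2+\gamma d$ and $du^2=\alpha udu+\beta u^2d+\gamma u$; it is noetherian if and only if $\beta\ne0$. A module $M$ is monolithic if the intersection of all nonzero submodules of $M$ is nonzero. *)

(* Defs.v *)
From HB Require Import structures.
From mathcomp Require Import all_boot all_order all_algebra.
Set Implicit Arguments. Unset Strict Implicit. Unset Printing Implicit Defensive.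
Import GRing.Theory.
Local Open Scope ring_scope.

(* A left module over the down-up algebra A(alpha,beta,gamma) over the field K:
   by the universal property of the algebra presented by generators d,u and the
   two defining relations, this is exactly a K-vector space M together with two
   K-linear endomorphisms D (action of d) and U (action of u) satisfying the
   relations d^2u = alpha dud + beta ud^2 + gamma d and
   du^2 = alpha udu + beta u^2d + gamma u. *)
Record DUModule (K : fieldType) (alpha beta gamma : K) := {
  dum_carrier :> lmodType K;
  dum_d : {linear dum_carrier -> dum_carrier};
  dum_u : {linear dum_carrier -> dum_carrier};
  dum_rel1 : forall m : dum_carrier,
    dum_d (dum_d (dum_u m)) =
      alpha *: dum_d (dum_u (dum_d m)) + beta *: dum_u (dum_d (dum_d m))
      + gamma *: dum_d m;
  dum_rel2 : forall m : dum_carrier,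
    dum_d (dum_u (dum_u m)) =
      alpha *: dum_u (dum_d (dum_u m)) + beta *: dum_u (dum_u (dum_d m))
      + gamma *: dum_u m
}.

Section DUDefs.
Variables (K : fieldType) (alpha beta gamma : K).
Variable M : DUModule alpha beta gamma.

Definition is_submodule (S : M -> Prop) : Prop :=
  [/\ S 0,
      (forall x y, S x -> S y -> S (x + y)),
      (forall (k : K) x, S x -> S (k *: x)),
      (forall x, S x -> S (dum_d M x)) &
      (forall x, S x -> S (dum_u M x))].

Definition nonzero_sub (S : M -> Prop) : Prop := exists2 x, S x & x <> 0.

Definition fin_generated : Prop :=
  exists s : seq M, forall S, is_submodule S ->
    (forall x, x \in s -> S x) -> forall m, S m.

Definition monolithic : Prop :=
  exists2 m : M, m <> 0 &
    forall S, is_submodule S -> nonzero_sub S -> S m.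

Definition artinian : Prop :=
  forall C : nat -> M -> Prop,
    (forall n, is_submodule (C n)) ->
    (forall n x, C n.+1 x -> C n x) ->
    exists N, forall n, (N <= n)%N -> forall x, C n x <-> C N x.
End DUDefs.

Definition is_root_of_unity (L : fieldType) (z : L) : Prop :=
  exists2 n : nat, (0 < n)%N & z ^+ n = 1.

(* Main.v *)
Require Import Defs.
From HB Require Import structures.
From mathcomp Require Import all_boot all_order all_algebra all_field.
From mathcomp Require Import boolp ring zify.
From mathcomp Require classical_sets filter.
Set Implicit Arguments. Unset Strict Implicit. Unset Printing Implicit Defensive.
Import GRing.Theory.
Local Open Scope ring_scope.

(* Put x = ud and y = du.  These commute, d r = s(r) d and r u = u s(r) for every polynomial r in
   x, y, where s(x) = y and s(y) = alpha y + beta x + gamma.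

   Suppose q is a root of X^2 - alpha X - beta that is not a root of unity.  Then s has an eigenvector
   w = x - y + const of eigenvalue q, and the algebra acts on bilateral sequences by shifts d and
   weighted shifts u, w acting as the multiplication by a multiple of q^(-n).  The submodule W
   generated by the step function [n > 0] is monolithic: a polynomial in d with nonzero constant term
   turns any element into a nonzero finitely supported sequence, and w separates its coordinates.  The
   elements w^k [n > 0] tell apart the terms of an infinite descending chain of submodules of W.

   Suppose both roots are N-th roots of unity, and let M be finitely generated and monolithic.  If s
   has order N, then M is finite-dimensional: the powers and the coefficients that make x, y, d, u
   algebraic are central, and central operators are algebraic by a Nullstellensatz (generic flatness
   over K[Z]) and a Fitting argument.  Otherwise s(t) = t + 1 and s(c) = zeta c for suitable c and t,
   with c^N central; passing to the kernel of a normal operator one may assume that p(c) = 0 for a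
   separable p.  A filtration of M then grows linearly, whereas an infinite-codimensional step of a
   chain of submodules costs at least n dimensions in degree n, so almost all steps are
   finite-codimensional; and f(t), f(t + k) being coprime for large k, the submodules of finite
   codimension in a given submodule have bounded codimension.  Hence M is artinian. *)

(** * Subspaces and towers of subspaces *)

(** The algebra itself never appears: its elements are operators on the given vector space, left
    ideals become subspaces closed under operators, and degree filtrations become towers of sums of
    [T^i G]. These sums need not be direct, so leading coefficients are compared modulo lower terms
    and no PBW basis enters.

    Linear growth is forced by monolithicity: were the monomials [d^j t^i v] independent, the
    submodules spanned by powers of [d] and [u] on [t^n K[t] V] would be nonzero with zero
    intersection. So one monomial depends on lexicographically smaller ones, and rewriting by that
    relation leaves only linearly many monomials of bounded weight. Exchanging [d] and [u] and
    negating [t] covers the other half of the module.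

    A root [q] that is not a root of unity may lie outside [K], while submodules are only
    [K]-stable. An extension with [L = K + K q] suffices: both [w] and an operator acting as [q w]
    belong to the algebra, so a submodule containing [F] contains all [L]-multiples of [w F]. *)

Section Spans.
Variables (K : fieldType) (M : lmodType K).
Implicit Types (X Y : M -> Prop) (s e : seq M).

Definition subspace X : Prop :=
  [/\ X 0, forall x y, X x -> X y -> X (x + y) & forall (k : K) x, X x -> X (k *: x)].

Lemma subspace0 X : subspace X -> X 0. Proof. by case. Qed.
Lemma subspaceD X x y : subspace X -> X x -> X y -> X (x + y).
Proof. by case=> _ h _; apply: h. Qed.
Lemma subspaceZ X k x : subspace X -> X x -> X (k *: x).
Proof. by case=> _ _ h; apply: h. Qed.
Lemma subspaceN X x : subspace X -> X x -> X (- x).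
Proof. by move=> h hx; rewrite -scaleN1r; apply: subspaceZ. Qed.
Lemma subspaceB X x y : subspace X -> X x -> X y -> X (x - y).
Proof. by move=> h hx hy; apply: subspaceD => //; apply: subspaceN. Qed.
Lemma subspace_sum X (I : Type) (r : seq I) (P : pred I) (F : I -> M) :
  subspace X -> (forall i, P i -> X (F i)) -> X (\sum_(i <- r | P i) F i).
Proof.
by move=> h hF; apply: (big_ind X) => //; [exact: subspace0 | move=> x y; exact: subspaceD].
Qed.
Lemma subspace_subr X x y : subspace X -> X (x - y) -> X y -> X x.
Proof. by move=> h h1 h2; rewrite -(subrK y x); apply: subspaceD. Qed.
Lemma subspace_scaleK X k x : subspace X -> k != 0 -> X (k *: x) -> X x.
Proof. by move=> h k0 hx; rewrite -(scalerK k0 x); apply: subspaceZ. Qed.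

Definition span (P : M -> Prop) (w : M) : Prop :=
  forall Q, subspace Q -> (forall x, P x -> Q x) -> Q w.

Lemma span_subspace P : subspace (span P).
Proof.
split=> [|x y hx hy|k x hx] Q hQ hP; first exact: subspace0.
- by apply: subspaceD => //; [apply: hx | apply: hy].
- by apply: subspaceZ => //; apply: hx.
Qed.
Lemma span_in P x : P x -> span P x. Proof. by move=> hx Q _; apply. Qed.
Lemma span_min P Q : subspace Q -> (forall x, P x -> Q x) -> forall w, span P w -> Q w.
Proof. by move=> hQ hP w; apply. Qed.
Lemma span_mono P P' : (forall x, P x -> P' x) -> forall w, span P w -> span P' w.
Proof. by move=> h; apply: span_min => [|x /h]; [exact: span_subspace | exact: span_in]. Qed.

(** Membership in [X] plus the span of [e], encoded by successive subtraction so that inductions on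
    [e] need neither coordinates nor dimensions. *)
Fixpoint addspan X e (w : M) : Prop :=
  if e is v :: e' then exists k : K, addspan X e' (w - k *: v) else X w.

Lemma addspan_subspace X e : subspace X -> subspace (addspan X e).
Proof.
move=> hX; elim: e => [|v e IH] //=; split.
- by exists 0; rewrite scale0r subr0; case: IH.
- move=> x y [k hk] [l hl]; exists (k + l).
  by rewrite scalerDl opprD addrACA; apply: subspaceD.
- by move=> k x [l hl]; exists (k * l); rewrite -scalerA -scalerBr; apply: subspaceZ.
Qed.

Lemma addspan_sub X e x : subspace X -> X x -> addspan X e x.
Proof.
by move=> hX hx; elim: e => [|v e IH] //=; exists 0; rewrite scale0r subr0.
Qed.

Lemma addspan_mem X e x : subspace X -> x \in e -> addspan X e x.
Proof.
move=> hX; elim: e => [|v e IH] //=; rewrite inE => /orP [/eqP ->|hx].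
  by exists 1; rewrite scale1r subrr; apply: subspace0; apply: addspan_subspace.
by exists 0; rewrite scale0r subr0; apply: IH.
Qed.

Lemma addspan_min X e Q : subspace Q -> (forall x, X x -> Q x) ->
  (forall x, x \in e -> Q x) -> forall w, addspan X e w -> Q w.
Proof.
move=> hQ hX; elim: e => [|v e IH] he w /=; first exact: hX.
case=> k hk; apply: (@subspace_subr _ _ (k *: v)) => //.
  by apply: IH => // x hx; apply: he; rewrite inE hx orbT.
by apply: subspaceZ => //; apply: he; rewrite inE eqxx.
Qed.

Lemma addspan_mono X X' e e' : subspace X' -> (forall x, X x -> X' x) ->
  (forall x, x \in e -> addspan X' e' x) ->
  forall w, addspan X e w -> addspan X' e' w.
Proof.
move=> hX' h he; apply: addspan_min => //; first exact: addspan_subspace.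
by move=> x /h hx; apply: addspan_sub.
Qed.

(** Steinitz exchange: [v] replaces the first vector of [e] that enters it with a nonzero
    coefficient; there is one because [v] is outside [X]. *)
Lemma addspan_exchange X e v : subspace X -> ~ X v -> addspan X e v ->
  exists2 e', size e = (size e').+1 &
    forall w, addspan X e w -> addspan (addspan X [:: v]) e' w.
Proof.
move=> hX nXv; have hXv := addspan_subspace [:: v] hX.
elim: e => [|u e IH] //= [k hk].
have [k0|k0] := eqVneq k 0; last first.
  exists e => // w [l hl].
  apply: (@subspace_subr _ _ (l *: u)); first exact: addspan_subspace.
    by move: (w - _) hl; apply: addspan_mono => // x hx; [exists 0; rewrite scale0r subr0 | exact: addspan_mem].
  apply: subspaceZ; first exact: addspan_subspace.
  apply: (@subspace_scaleK _ k) => //; first exact: addspan_subspace.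
  rewrite -(subKr v (k *: u)); apply: subspaceB; first exact: addspan_subspace.
    by apply: addspan_sub => //; exists 1; rewrite scale1r subrr; exact: subspace0.
  move: (v - _) hk; apply: addspan_mono => // x hx; last exact: addspan_mem.
  by exists 0; rewrite scale0r subr0.
move: hk; rewrite k0 scale0r subr0 => /IH [e' he' h].
exists (u :: e') => /=; first by rewrite he'.
by move=> w [l /h hl]; exists l.
Qed.

Fixpoint freemod X s : Prop :=
  if s is v :: s' then ~ X v /\ freemod (addspan X [:: v]) s' else True.

Lemma freemod_size X s e : subspace X -> freemod X s ->
  (forall v, v \in s -> addspan X e v) -> (size s <= size e)%N.
Proof.
elim: s X e => [|v s IH] X e hX //= [nXv hs] hse.
have hv : addspan X e v by apply: hse; rewrite inE eqxx.
have [e' -> he'] := addspan_exchange hX nXv hv.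
rewrite ltnS; apply: IH hs _; first exact: (addspan_subspace [:: v] hX).
by move=> w hw; apply: he'; apply: hse; rewrite inE hw orbT.
Qed.

Lemma freemod_anti X Y s : (forall x, X x -> Y x) -> freemod Y s -> freemod X s.
Proof.
elim: s X Y => [|v s IH] X Y h //= [nv hs]; split; first by move/h.
by apply: IH hs => x [k /h hk]; exists k.
Qed.

Lemma freemod_cat X Y s1 s2 : subspace Y -> (forall x, X x -> Y x) ->
  (forall v, v \in s1 -> Y v) -> freemod X s1 -> freemod Y s2 -> freemod X (s1 ++ s2).
Proof.
move=> hY; elim: s1 X => [|v s1 IH] X hXY hs /= h1 h2; first exact: freemod_anti h2.
case: h1 => nv h1; split=> //; apply: IH => //.
  move=> x [k /hXY hk]; apply: subspace_subr hk _ => //.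
  by apply: subspaceZ => //; apply: hs; rewrite inE eqxx.
by move=> w hw; apply: hs; rewrite inE hw orbT.
Qed.

Lemma freemod_rcons X s v : subspace X ->
  freemod X s -> ~ addspan X s v -> freemod X (rcons s v).
Proof.
move=> hX hs nv; rewrite -cats1; apply: freemod_cat (addspan_subspace s hX) _ _ hs _.
- by move=> x; exact: addspan_sub.
- by move=> x; exact: addspan_mem.
- by split.
Qed.

(** [X] is not asked to lie in [Y]: the quotient that is finite-dimensional is [Y] modulo its
    intersection with [X]. *)
Definition fincodim X Y : Prop := exists e, forall y, Y y -> addspan X e y.

End Spans.

(** * Polynomials in an operator *)

Section PolyAction.
Variables (S : comNzRingType) (M : zmodType) (A : S -> M -> M) (T : M -> M).
Implicit Types (p q : {poly S}) (m n : M).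
Hypothesis AD : forall a b m, A (a + b) m = A a m + A b m.
Hypothesis ADr : forall a m n, A a (m + n) = A a m + A a n.
Hypothesis AM : forall a b m, A (a * b) m = A a (A b m).
Hypothesis A1 : forall m, A 1 m = m.
Hypothesis TD : forall m n, T (m + n) = T m + T n.
Hypothesis TA : forall a m, T (A a m) = A a (T m).

(** Scalars act through an arbitrary [A], so the construction serves twice: with [K] for polynomials
    in one operator, and with [{poly K}] acting through [x] for polynomials in [x] and [y]. *)
Definition polyact (p : {poly S}) (m : M) : M :=
  \sum_(i < size p) A p`_i (iter i T m).

Lemma polyactA0 m : A 0 m = 0.
Proof. by apply: (addrI (A 0 m)); rewrite -AD !addr0. Qed.
Lemma polyactAr0 a : A a 0 = 0.
Proof. by apply: (addrI (A a 0)); rewrite -ADr !addr0. Qed.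
Lemma polyact_iterD i m n : iter i T (m + n) = iter i T m + iter i T n.
Proof. by elim: i => //= i ->. Qed.

Lemma polyact_widen (k : nat) p m : (size p <= k)%N ->
  polyact p m = \sum_(i < k) A p`_i (iter i T m).
Proof.
move=> h; rewrite /polyact (big_ord_widen _ (fun i => A p`_i (iter i T m)) h) [RHS](bigID (fun i : 'I_k => (i < size p)%N)) /=.
by rewrite [X in _ = _ + X]big1 ?addr0 // => i; rewrite -leqNgt => hi; rewrite nth_default // polyactA0.
Qed.

Lemma polyactDl p q m : polyact (p + q) m = polyact p m + polyact q m.
Proof.
pose n := maxn (size p) (size q).
rewrite !(@polyact_widen n) ?leq_maxl ?leq_maxr //; last by rewrite (leq_trans (size_polyD _ _)).
by rewrite -big_split; apply: eq_bigr => i _; rewrite coefD AD.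
Qed.

Lemma polyactDr p m n : polyact p (m + n) = polyact p m + polyact p n.
Proof. by rewrite -big_split; apply: eq_bigr => i _; rewrite polyact_iterD ADr. Qed.

Lemma polyact0l m : polyact 0 m = 0.
Proof. by rewrite /polyact size_poly0 big_ord0. Qed.

Lemma polyactC a m : polyact a%:P m = A a m.
Proof. by rewrite (@polyact_widen 1) ?size_polyC ?leq_b1 // big_ord1 coefC. Qed.

Lemma polyactMX p m : polyact (p * 'X) m = polyact p (T m).
Proof.
rewrite (@polyact_widen (size p).+1); last by rewrite (leq_trans (size_polyMleq _ _)) // size_polyX addn2.
rewrite big_ord_recl coefMX /= polyactA0 add0r; apply: eq_bigr => i _.
by rewrite coefMX /= -iterS iterSr.
Qed.

Lemma polyactX m : polyact 'X m = T m.
Proof. by rewrite -['X]mul1r polyactMX polyactC A1. Qed.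

Lemma polyact_comm (B : M -> M) p m :
  (forall x y, B (x + y) = B x + B y) -> (forall a m, B (A a m) = A a (B m)) ->
  (forall m, B (T m) = T (B m)) -> B (polyact p m) = polyact p (B m).
Proof.
move=> BD BA BT; have B0 : B 0 = 0 by apply: (addrI (B 0)); rewrite -BD !addr0.
rewrite (big_morph B BD B0); apply: eq_bigr => i _; rewrite BA; congr (A _ _).
by elim: (i : nat) => //= j <-.
Qed.

Lemma polyactM p q m : polyact (p * q) m = polyact p (polyact q m).
Proof.
elim/poly_ind: p m => [|p c IH] m; first by rewrite mul0r !polyact0l.
rewrite mulrDl !polyactDl mulrAC !polyactMX IH polyactC; congr (_ + _).
  by congr (polyact p _); rewrite (polyact_comm (B := T)).
elim/poly_ind: q {IH} m => [|q a IH] m; first by rewrite mulr0 !polyact0l polyactAr0.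
by rewrite mulrDr !polyactDl mulrA !polyactMX IH -polyCM !polyactC AM ADr.
Qed.

End PolyAction.

Section PolyOp.
Variables (K : fieldType) (M : lmodType K).
Implicit Types (p q : {poly K}) (X : M -> Prop).

Definition pev (T : M -> M) p (m : M) : M := polyact (fun (k : K) (m : M) => k *: m) T p m.

Section OneOp.
Variable T : {linear M -> M}.
Local Notation P := (pev T).

Lemma pevDl p q m : P (p + q) m = P p m + P q m.
Proof. by apply: polyactDl => *; rewrite scalerDl. Qed.
Lemma pevDr p m n : P p (m + n) = P p m + P p n.
Proof. by apply: polyactDr => *; rewrite ?scalerDr ?linearD. Qed.
Lemma pev0 m : P 0 m = 0.
Proof. exact: polyact0l. Qed.
Lemma pevC a m : P a%:P m = a *: m.
Proof. by apply: (@polyactC K M (fun k m => k *: m)) => *; rewrite scalerDl. Qed.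
Lemma pevX m : P 'X m = T m.
Proof. by apply: (@polyactX K M (fun k m => k *: m)) => *; rewrite ?scalerDl ?scale1r. Qed.
Lemma pev1 m : P 1 m = m.
Proof. by rewrite -[1]/(1%:P) pevC scale1r. Qed.
Lemma pevM p q m : P (p * q) m = P p (P q m).
Proof.
by apply: polyactM => *; rewrite ?scalerDl ?scalerDr ?scalerA ?scale1r ?linearD ?linearZ.
Qed.
Lemma pevMX p m : P (p * 'X) m = P p (T m).
Proof. by rewrite pevM pevX. Qed.
Lemma pevZ p k m : P p (k *: m) = k *: P p m.
Proof. by rewrite -!pevC -!pevM mulrC. Qed.
Lemma pevZl p k m : P (k *: p) m = k *: P p m.
Proof. by rewrite -mul_polyC pevM pevC. Qed.
Lemma pevXn n m : P 'X^n m = iter n T m.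
Proof. by elim: n m => [|n IH] m; rewrite ?pev1 // exprSr pevMX IH -iterSr. Qed.
Lemma pevNl p m : P (- p) m = - P p m.
Proof. by rewrite -!scaleN1r pevZl. Qed.
Lemma pevBl p q m : P (p - q) m = P p m - P q m.
Proof. by rewrite pevDl pevNl. Qed.

Fact pev_is_linear p : linear (P p).
Proof. by move=> k x y; rewrite pevDr pevZ. Qed.
HB.instance Definition _ p := GRing.isLinear.Build K M M _ (pev T p) (pev_is_linear p).

Lemma pev_stable X p m : subspace X -> (forall x, X x -> X (T x)) -> X m -> X (P p m).
Proof.
move=> hX hT hm; apply: subspace_sum => // i _; apply: subspaceZ => //.
by elim: (i : nat) => //= j; exact: hT.
Qed.

Lemma pev_commute (B : {linear M -> M}) p m :
  (forall m, B (T m) = T (B m)) -> B (P p m) = P p (B m).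
Proof. by move=> h; apply: polyact_comm => *; rewrite ?linearD ?linearZ. Qed.

End OneOp.

Lemma pev_comp (T : {linear M -> M}) p q m : pev T (p \Po q) m = pev (pev T q) p m.
Proof.
elim/poly_ind: p m => [|p c IH] m; first by rewrite comp_poly0 !pev0.
by rewrite comp_polyD comp_polyM comp_polyX comp_polyC !pevDl [in RHS]pevMX pevM !pevC IH.
Qed.

Lemma pev_eq0_size (T : {linear M -> M}) p m : (size p <= 1)%N -> p != 0 -> pev T p m = 0 -> m = 0.
Proof.
move=> /size1_polyC -> ; rewrite polyC_eq0 pevC => h /eqP.
by rewrite scaler_eq0 (negbTE h) => /eqP.
Qed.

(** A Bezout identity evaluated at [T]; every later appeal to coprimality passes through this form
    or its proof. *)
Lemma pev_coprime (X : M -> Prop) (T : {linear M -> M}) p q m : subspace X ->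
  (forall x, X x -> X (T x)) -> coprimep p q -> X (pev T p m) -> X (pev T q m) -> X m.
Proof.
move=> hX hT /Bezout_eq1_coprimepP [[u v] /= e] hp hq.
by rewrite -[m](pev1 T) -e pevDl !pevM; apply: subspaceD => //; apply: pev_stable.
Qed.

End PolyOp.

Lemma pev_semicommute (K : fieldType) (M M' : lmodType K) (T : {linear M -> M}) (T' : {linear M' -> M'})
  (B : {linear M -> M'}) (p : {poly K}) m :
  (forall m, B (T m) = T' (B m)) -> B (pev T p m) = pev T' p (B m).
Proof.
move=> h; elim/poly_ind: p m => [|p c IH] m; first by rewrite !pev0 linear0.
by rewrite !pevDl !pevMX !pevC linearD linearZ IH h.
Qed.

Lemma eq_pev (K : fieldType) (M : lmodType K) (T T' : {linear M -> M}) (p : {poly K}) m : T =1 T' -> pev T p m = pev T' p m.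
Proof. by move=> h; apply: (pev_semicommute (B := idfun)). Qed.

(** * Hilbert's basis theorem and generic flatness for towers *)

Section Towers.
Variables (K : fieldType) (M : lmodType K).
Implicit Types (X Y G : M -> Prop) (O : (M -> M) -> Prop).

Definition closedby O X : Prop := subspace X /\ forall o, O o -> forall x, X x -> X (o x).

Definition noeth O G : Prop := forall C : nat -> M -> Prop,
  (forall n, closedby O (C n)) -> (forall n x, C n x -> G x) ->
  (forall n x, C n x -> C n.+1 x) ->
  exists N, forall n, (N <= n)%N -> forall x, C n x -> C N x.

Lemma chain_mono (C : nat -> M -> Prop) : (forall n x, C n x -> C n.+1 x) ->
  forall m n, (m <= n)%N -> forall x, C m x -> C n x.
Proof.
move=> h m n; elim: n => [|n IH]; first by rewrite leqn0 => /eqP ->.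
by rewrite leq_eqVlt => /orP [/eqP -> //|]; rewrite ltnS => /IH hn x /hn /h.
Qed.

Section Step.
Variables (O O' : (M -> M) -> Prop) (G : M -> Prop) (T : {linear M -> M}).
Hypothesis Gs : subspace G.

(** The sum of the [T^i G] with [i < n], peeled off from the top degree. *)
Fixpoint tower_upto n w : Prop :=
  if n is n'.+1 then exists2 g, G g & tower_upto n' (w - iter n' T g) else w = 0.
Definition tower w : Prop := exists n, tower_upto n w.

(** Leading coefficients of degree [n]. As the sum is not direct, any [g] for which [T^n g] already
    has lower degree is a leading coefficient of every subspace [X]; this is exploited more than
    once. *)
Definition leading X n g : Prop :=
  G g /\ exists2 w, tower_upto n w & X (iter n T g - w).

Hypothesis hO' : forall X, closedby O' X -> closedby O X /\ forall x, X x -> X (T x).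
Hypothesis leading_closed : forall X, closedby O' X -> forall n, closedby O (leading X n).

Lemma iter_linear n k x y : iter n T (k *: x + y) = k *: iter n T x + iter n T y.
Proof. by elim: n => //= n ->; rewrite linearP. Qed.
Lemma iter_linD n x y : iter n T (x + y) = iter n T x + iter n T y.
Proof. by rewrite -[x]scale1r iter_linear !scale1r. Qed.
Lemma iter_lin0 n : iter n T 0 = 0.
Proof. by elim: n => //= n ->; rewrite linear0. Qed.
Lemma iter_linZ n k x : iter n T (k *: x) = k *: iter n T x.
Proof. by rewrite -[k *: x]addr0 iter_linear iter_lin0 addr0. Qed.

Lemma iter_linB n x y : iter n T (x - y) = iter n T x - iter n T y.
Proof. by rewrite iter_linD -!scaleN1r iter_linZ. Qed.

Lemma tower_upto_subspace n : subspace (tower_upto n).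
Proof.
elim: n => [|n IH] /=; first by split=> // [x y -> ->|k x ->]; rewrite ?addr0 ?scaler0.
split; first by exists 0; [exact: subspace0 | rewrite iter_lin0 subr0; exact: (subspace0 IH)].
- move=> x y [g hg hx] [h hh hy]; exists (g + h); first exact: subspaceD.
  by rewrite iter_linD opprD addrACA; apply: (subspaceD IH).
- move=> k x [g hg hx]; exists (k *: g); first exact: subspaceZ.
  by rewrite iter_linZ -scalerBr; apply: (subspaceZ _ IH).
Qed.

Lemma tower_uptoS n w : tower_upto n w -> tower_upto n.+1 w.
Proof. by move=> h; exists 0; [exact: subspace0 | rewrite iter_lin0 subr0]. Qed.

Lemma tower_upto_mono m n w : (m <= n)%N -> tower_upto m w -> tower_upto n w.
Proof. by move=> h; apply: (chain_mono tower_uptoS h). Qed.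

Lemma tower_uptoT n w : tower_upto n w -> tower_upto n.+1 (T w).
Proof.
elim: n w => [|n IH] w; first by move=> /= ->; exists 0; [exact: subspace0 | rewrite linear0 subrr].
case=> g hg /IH h; exists g => //=.
by move: h; rewrite linearB.
Qed.

Lemma tower_upto_iter n g : G g -> tower_upto n.+1 (iter n T g).
Proof. by move=> hg; exists g => //; rewrite subrr; exact: (subspace0 (tower_upto_subspace n)). Qed.

Lemma tower_subspace : subspace tower.
Proof.
split; first by exists 0%N.
- move=> x y [m hm] [n hn]; exists (maxn m n); apply: (subspaceD (tower_upto_subspace _)).
    by apply: tower_upto_mono hm; exact: leq_maxl.
  by apply: tower_upto_mono hn; exact: leq_maxr.
- by move=> k x [m hm]; exists m; apply: (subspaceZ _ (tower_upto_subspace _)).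
Qed.

Lemma towerT w : tower w -> tower (T w).
Proof. by case=> n /tower_uptoT h; exists n.+1. Qed.

Lemma tower_base g : G g -> tower g.
Proof. by move=> /(tower_upto_iter 0) h; exists 1%N. Qed.

Lemma leading_mono X n g : subspace X -> (forall x, X x -> X (T x)) ->
  leading X n g -> leading X n.+1 g.
Proof.
move=> hX hT [hg [w hw hx]]; split=> //; exists (T w); first exact: tower_uptoT.
by rewrite /= -linearB; apply: hT.
Qed.

Lemma leading_sub X Y n g : (forall x, X x -> Y x) -> leading X n g -> leading Y n g.
Proof. by move=> h [hg [w hw hx]]; split=> //; exists w => //; apply: h. Qed.

Lemma leading_stable X : noeth O G -> closedby O' X ->
  exists n0, forall n g, leading X n g -> leading X n0 g.
Proof.
move=> hN hX; have [[hX0 _] hXT] := hO' hX.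
have hmono n g : leading X n g -> leading X n.+1 g by apply: leading_mono.
have [n0 h0] := hN (leading X) (leading_closed hX) (fun n x => @proj1 _ _) hmono.
exists n0 => n g hg; apply: (h0 (maxn n0 n)); rewrite ?leq_maxl //.
by move: hg; apply: (chain_mono hmono); rewrite leq_maxr.
Qed.

(* The leading coefficient submodules [leading (C k) n] increase with both [k] and [n]. *)
Lemma tower_noeth : noeth O G -> noeth O' tower.
Proof.
move=> hN C hC hCW hmono.
have mono k l : (k <= l)%N -> forall x, C k x -> C l x := chain_mono hmono (n := l).
have Lmono k l m n g : (k <= l)%N -> (m <= n)%N -> leading (C k) m g -> leading (C l) n g.
  move=> hkl hmn h; apply: (@leading_sub (C k)); first exact: mono.
  move: h; apply: (chain_mono _ hmn) => {m n hmn} n x.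
  by have [[hs _] hT] := hO' (hC k); apply: leading_mono.
have [k0 hk0] := hN (fun k => leading (C k) k) (fun n => leading_closed (hC n) n)
  (fun n x => @proj1 _ _) (fun n x => @Lmono _ _ _ _ x (leqnSn n) (leqnSn n)).
have stab1 m : exists N, forall k g, leading (C k) m g -> leading (C N) m g.
  have [N hN'] := hN (fun k => leading (C k) m) (fun n => leading_closed (hC n) m)
    (fun n x => @proj1 _ _) (fun n x => @Lmono _ _ _ _ x (leqnSn n) (leqnn m)).
  exists N => k g hg; apply: (hN' (maxn N k)); rewrite ?leq_maxl //.
  by apply: Lmono hg; rewrite ?leq_maxr.
have stab m : exists N, forall n, (n <= m)%N -> forall k, forall g, leading (C k) n g -> leading (C N) n g.
  elim: m => [|m [N hN']].
    have [N hN'] := stab1 0%N.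
    by exists N => n; rewrite leqn0 => /eqP -> k g; exact: hN'.
  have [N1 hN1] := stab1 m.+1.
  exists (maxn N N1) => n; rewrite leq_eqVlt => /orP [/eqP -> k g /hN1|].
    by apply: Lmono; rewrite ?leq_maxr.
  rewrite ltnS => hn k g /(hN' _ hn).
  by apply: Lmono; rewrite ?leq_maxl.
have [N1 hN1] := stab k0.
pose N := maxn N1 k0; exists N.
have stabN n k g : leading (C k) n g -> leading (C N) n g.
  move=> hg; case: (leqP n k0) => h.
    by apply: (Lmono N1 _ n n); rewrite ?leq_maxl //; apply: hN1 h _ _ hg.
  apply: (Lmono k0 _ k0 n); rewrite ?leq_maxr //; first exact: ltnW.
  apply: (hk0 (maxn k n)); first by rewrite leq_max (ltnW h) orbT.
  by apply: Lmono hg; rewrite ?leq_maxl ?leq_maxr.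
move=> k hk x hx; have [m hm] := hCW _ _ hx.
elim: m x hm hx => [|m IH] x /=; first by move=> -> _; have [[hs _] _] := hO' (hC N); exact: subspace0.
case=> g hg hw hx.
have hs j : subspace (C j) by have [[]] := hO' (hC j).
have [_ [w' hw' hx0]] : leading (C N) m g.
  apply: (@stabN m k); split=> //; exists (iter m T g - x); last by rewrite subKr.
  by rewrite -opprB; apply: (subspaceN (tower_upto_subspace _)).
apply: (subspace_subr (hs N) _ hx0).
apply: IH; last exact: (subspaceB (hs k) hx (mono N k hk _ hx0)).
rewrite opprB addrCA; apply: (subspaceD (tower_upto_subspace _)) => //.
Qed.

Section Flat.
Variable Z : {linear M -> M}.
Hypothesis ZT : forall m, Z (T m) = T (Z m).
Hypothesis ZX : forall X, closedby O' X -> forall x, X x -> X (Z x).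
Hypothesis ZG : forall g, G g -> G (Z g).
Implicit Types p f : {poly K}.

Definition torsionfree f (Y X : M -> Prop) : Prop :=
  forall p, coprimep p f -> forall g, Y g -> X (pev Z p g) -> X g.

(** Generic flatness over [K[Z]], reduced to torsion: modulo a closed subspace, the torsion of [G]
    is confined to polynomials sharing a factor with one nonzero [f]. *)
Definition flat O G : Prop :=
  forall X, closedby O X -> exists2 f, f != 0 & torsionfree f G X.

Lemma pev_iter p n g : pev Z p (iter n T g) = iter n T (pev Z p g).
Proof. by elim: n => //= n <-; rewrite (pev_commute (B := T)). Qed.

Lemma pevG p g : G g -> G (pev Z p g).
Proof. by apply: pev_stable. Qed.

Lemma tower_upto_pev p n w : tower_upto n w -> tower_upto n (pev Z p w).
Proof.
elim: n w => [|n IH] w /=; first by move=> ->; rewrite linear0.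
by case=> g /(pevG p) hg /IH hw; exists (pev Z p g) => //; rewrite -pev_iter -linearB.
Qed.

Lemma flat_upto (L : nat -> M -> Prop) n :
  (forall i, exists2 f, f != 0 & torsionfree f G (L i)) ->
  exists2 f, f != 0 & forall i, (i <= n)%N -> torsionfree f G (L i).
Proof.
move=> h; elim: n => [|n [f f0 hf]].
  by have [f f0 hf] := h 0%N; exists f => // i; rewrite leqn0 => /eqP ->.
have [g g0 hg] := h n.+1; exists (f * g); first by rewrite mulf_neq0.
move=> i; rewrite leq_eqVlt => /orP [/eqP ->|hi] p.
  by rewrite coprimepMr => /andP [_ /hg]; apply.
by rewrite coprimepMr => /andP [/(hf i hi) h1 _]; apply: h1.
Qed.

Lemma leading_flat X : noeth O G -> flat O G -> closedby O' X ->
  exists2 f, f != 0 & forall n, torsionfree f G (leading X n).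
Proof.
move=> hN hF hX; have [n0 hn0] := leading_stable hN hX.
have [f f0 hf] := flat_upto n0 (fun i => hF _ (leading_closed hX i)).
have [[hX0 _] hXT] := hO' hX.
exists f => // n p hp g hg hl; case: (leqP n n0) => h; first exact: (hf n h p).
apply: (chain_mono _ (ltnW h)) => [m x|]; first exact: leading_mono.
by apply: (hf n0 _ p) => //; apply: hn0 hl.
Qed.

(** The leading coefficients of [X] stop growing at some degree, so a product of finitely many
    polynomials serves for all of them. If [p(Z) w] lies in [X], torsion-freeness makes the top
    coefficient of [w] itself a leading coefficient of [X]; subtracting an element of [X] with the
    same top term lowers the degree. *)
Lemma tower_flat : noeth O G -> flat O G -> flat O' tower.
Proof.
move=> hN hF X hX; have [f f0 hf] := leading_flat hN hF hX.
have [[hX0 _] hXT] := hO' hX.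
exists f => // p hp w [n]; elim: n w => [|n IH] w /=; first by move=> -> _; exact: subspace0.
case=> g hg hw hx.
have [_ [w' hw' hx0]] : leading X n g.
  apply: (hf n p) => //; split; first exact: pevG.
  exists (- pev Z p (w - iter n T g)).
    by apply: (subspaceN (tower_upto_subspace n)); apply: tower_upto_pev.
  by rewrite opprK linearB /= pev_iter addrCA subrr addr0.
apply: (subspace_subr hX0 _ hx0); apply: IH.
  by rewrite opprB addrCA; apply: (subspaceD (tower_upto_subspace _)).
rewrite linearB; apply: (subspaceB hX0) => //=.
by apply: pev_stable => //; exact: ZX.
Qed.

(* Apply the torsion-freeness of the quotients of [G] by the leading coefficients of the
   zero submodule: everything above the bottom layer [G] is p-torsion free. *)
Lemma tower_saturated : noeth O G -> flat O G ->
  closedby O' (fun x => x = 0) ->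
  exists2 f, f != 0 & torsionfree f tower G.
Proof.
move=> hN hF h0; have [f f0 hf] := leading_flat hN hF h0.
exists f => // p hp w [n]; elim: n w => [|n IH] w /=; first by move=> -> _; exact: subspace0.
case=> g hg hw hx; case: n IH hw => [|n] IH hw.
  by rewrite (subr0_eq hw).
have [_ [w' hw' /subr0_eq hx0]] : leading (fun x => x = 0) n.+1 g.
  apply: (hf n.+1 p) => //; split; first exact: pevG.
  exists (pev Z p w - pev Z p (w - iter n.+1 T g)); last first.
    by rewrite -linearB subKr -pev_iter subrr.
  apply: (subspaceB (tower_upto_subspace n.+1)); last exact: tower_upto_pev.
  by apply: (tower_upto_mono (ltn0Sn n)); exists (pev Z p w); rewrite //= subrr.
apply: IH => //; apply: (subspace_subr (tower_upto_subspace n.+1) hw).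
by rewrite -/(iter n.+1 T g) hx0.
Qed.
End Flat.
End Step.
End Towers.

(** * Modules over the down-up algebra *)

Section SkewStep.
Variables (K : fieldType) (M : lmodType K).
Implicit Types (X G : M -> Prop) (l : seq {linear M -> M}).

Definition ops l (o : M -> M) : Prop := exists2 T : {linear M -> M}, List.In T l & o = T.

Lemma closedby_nil X : closedby (ops [::]) X <-> subspace X.
Proof. by split=> [[]//|h]; split=> // o [T []]. Qed.

Lemma closedby_cons (T : {linear M -> M}) l X :
  closedby (ops (T :: l)) X <-> closedby (ops l) X /\ forall x, X x -> X (T x).
Proof.
split=> [[hX h]|[[hX h] hT]].
  split; [split=> // o [T' hT' ->]; apply: h; exists T' => //; right => //|].
  by apply: h; exists T => //; left.
by split=> // o [T' [<- -> //|hT'] ->]; apply: h; exists T'.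
Qed.

Variables (Q : {linear M -> M} -> Prop) (G : M -> Prop) (T : {linear M -> M}).
Hypothesis QG : forall o, Q o -> forall g, G g -> G (o g).
Hypothesis QT : forall o, Q o -> exists2 o', Q o' & forall m, T (o m) = o' (T m).
Hypothesis TQ : forall o, Q o -> exists2 o', Q o' & forall m, o (T m) = T (o' m).
Hypothesis Gs : subspace G.

(** Operators of [Q] need not commute with [T]: it is enough that moving one across [T] produces
    another member of [Q], as with the coefficients of a skew polynomial ring. *)
Lemma tower_upto_skew n o w : Q o -> tower_upto G T n w -> tower_upto G T n (o w).
Proof.
elim: n w => [|n IH] w ho /=; first by move=> ->; rewrite linear0.
case=> g hg /(IH _ ho) hw.
suff [o' ho' e] : exists2 o', Q o' & forall m, o (iter n T m) = iter n T (o' m).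
  by exists (o' g); [apply: QG | rewrite -e -linearB].
elim: n {IH hw} => [|n [o' ho' e]]; first by exists o.
have [o2 ho2 e2] := TQ ho'; exists o2 => // m.
by rewrite !iterSr e e2.
Qed.

Lemma tower_skew o w : Q o -> tower G T w -> tower G T (o w).
Proof. by move=> ho [n h]; exists n; apply: tower_upto_skew. Qed.

Lemma leading_skew X n o g : subspace X -> (forall o, Q o -> forall x, X x -> X (o x)) ->
  Q o -> leading G T X n g -> leading G T X n (o g).
Proof.
move=> hX hQ ho [hg [w hw hx]]; split; first exact: QG.
suff [o' ho' e] : exists2 o', Q o' & forall m, iter n T (o m) = o' (iter n T m).
  by exists (o' w); [apply: tower_upto_skew | rewrite e -linearB; apply: hQ].
elim: n {hw hx} => [|n [o' ho' e]]; first by exists o.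
by have [o2 ho2 e2] := QT ho'; exists o2 => // m; rewrite /= e e2.
Qed.

Lemma leading_subspace X n : subspace X -> subspace (leading G T X n).
Proof.
move=> hX; split.
- split; first exact: subspace0.
  exists 0; first exact: (subspace0 (tower_upto_subspace T Gs n)).
  by rewrite iter_lin0 subr0; exact: subspace0.
- move=> x y [hx [v hv hvx]] [hy [w hw hwy]]; split; first exact: subspaceD.
  exists (v + w); first exact: (subspaceD (tower_upto_subspace T Gs n)).
  by rewrite iter_linD opprD addrACA; apply: subspaceD.
- move=> k x [hx [v hv hvx]]; split; first exact: subspaceZ.
  exists (k *: v); first exact: (subspaceZ _ (tower_upto_subspace T Gs n)).
  by rewrite iter_linZ -scalerBr; apply: subspaceZ.
Qed.

End SkewStep.

Section Commuting.
Variables (K : fieldType) (M : lmodType K) (l : seq {linear M -> M}) (G : M -> Prop).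
Variable (T : {linear M -> M}).
Hypothesis comm : forall o : {linear M -> M}, List.In o l -> forall m, T (o m) = o (T m).
Hypothesis hG : closedby (ops l) G.

Let Q (o : {linear M -> M}) := List.In o l.

Lemma closedby_in X (o : {linear M -> M}) x : closedby (ops l) X -> List.In o l -> X x -> X (o x).
Proof. by case=> _ h ho; apply: h; exists o. Qed.

Lemma commuting_leading X : closedby (ops (T :: l)) X ->
  forall n, closedby (ops l) (leading G T X n).
Proof.
move=> /closedby_cons [hX hXT] n; split; first by apply: leading_subspace; [case: hG | case: hX].
move=> _ [o ho ->] g; apply: (leading_skew (Q := Q)) => //.
- by move=> o' ho' x; exact: closedby_in.
- by move=> o' ho'; exists o' => // m; rewrite comm.
- by move=> o' ho'; exists o' => // m; rewrite comm.
- by case: hX.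
- by move=> o' ho' x; exact: closedby_in.
Qed.

Lemma commuting_tower : closedby (ops (T :: l)) (tower G T).
Proof.
have Gs : subspace G by case: hG.
apply/closedby_cons; split; last by move=> x; exact: towerT.
split; first exact: tower_subspace.
move=> _ [o ho ->] g; apply: (tower_skew (Q := Q)) => //.
- by move=> o' ho' x; exact: closedby_in.
- by move=> o' ho'; exists o' => // m; rewrite comm.
Qed.

Lemma commuting_noeth : noeth (ops l) G -> noeth (ops (T :: l)) (tower G T).
Proof.
have Gs : subspace G by case: hG.
by apply: tower_noeth => //; [move=> X /closedby_cons | exact: commuting_leading].
Qed.
End Commuting.

Lemma addspan_noeth (K : fieldType) (M : lmodType K) (s : seq M) :
  noeth (ops [::]) (addspan (fun x => x = 0) s).
Proof.
have h0 : subspace (fun x : M => x = 0) by split=> // [x y -> ->|k x ->]; rewrite ?addr0 ?scaler0.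
move=> C hC hCs hmono; apply: contrapT => hN.
have mono k l : (k <= l)%N -> forall x, C k x -> C l x := chain_mono hmono (n := l).
have hs n : subspace (C n) by case: (hC n).
have step k : exists l, exists2 x, C l x & ~ C k x /\ (k <= l)%N.
  apply: contrapT => h; apply: hN; exists k => l hl x hx.
  by apply: contrapT => hk; apply: h; exists l, x.
have long n : exists k, exists2 e, size e = n & freemod (fun x => x = 0) e /\ forall x, x \in e -> C k x.
  elim: n => [|n [k [e he [hf hk]]]]; first by exists 0%N, [::].
  have [l [x hl [hkx hkl]]] := step k; exists l, (rcons e x); first by rewrite size_rcons he.
  split; last first.
    by move=> v; rewrite mem_rcons inE => /orP [/eqP -> //|/hk]; apply: mono.
  apply: freemod_rcons => // hx; apply: hkx; move: hx; apply: addspan_min => //.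
  by move=> v ->; exact: subspace0.
have [k [e he [hf hk]]] := long (size s).+1.
have := freemod_size h0 hf (fun v hv => hCs _ _ (hk _ hv)).
by rewrite he ltnn.
Qed.

Lemma addr3K (V : zmodType) (a b c : V) : a + b + c - a - c = b.
Proof. by rewrite addrAC addrK [a + b]addrC addrK. Qed.

(** * The commuting operators ud and du *)

Section DownUp.
Variables (K : fieldType) (alpha beta gamma : K).
Hypothesis beta0 : beta != 0.
Variable M : DUModule alpha beta gamma.
Implicit Types (X : M -> Prop).

Local Notation d := (dum_d M).
Local Notation u := (dum_u M).
Definition dux : {linear M -> M} := GRing.Linear.clone _ _ _ _ (u \o d) _.
Definition duy : {linear M -> M} := GRing.Linear.clone _ _ _ _ (d \o u) _.
Local Notation x := dux.
Local Notation y := duy.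

Lemma d_x m : d (x m) = y (d m). Proof. by []. Qed.
Lemma u_y m : u (y m) = x (u m). Proof. by []. Qed.
Lemma d_y m : d (y m) = alpha *: y (d m) + beta *: x (d m) + gamma *: d m.
Proof. exact: dum_rel1. Qed.
Lemma y_u m : y (u m) = alpha *: x (u m) + beta *: u (x m) + gamma *: u m.
Proof. exact: dum_rel2. Qed.
Lemma u_x m : u (x m) = beta^-1 *: (y (u m) - alpha *: x (u m) - gamma *: u m).
Proof.
apply: (scalerI beta0); rewrite scalerA mulfV // scale1r y_u.
by rewrite addr3K.
Qed.
Lemma x_d m : x (d m) = beta^-1 *: (d (y m) - alpha *: d (x m) - gamma *: d m).
Proof.
apply: (scalerI beta0); rewrite scalerA mulfV // scale1r d_y d_x.
by rewrite addr3K.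
Qed.
Lemma xy_comm m : x (y m) = y (x m).
Proof.
have -> : x (y m) = u (d (y m)) by [].
rewrite d_y !linearD !linearZ; exact/esym/(y_u (d m)).
Qed.

Variable Z : {linear M -> M}.
Hypothesis Zd : forall m, Z (d m) = d (Z m).
Hypothesis Zu : forall m, Z (u m) = u (Z m).

(** The span of [1], [x], [y] is preserved when its members are moved across [d] or [u], in both
    directions because [beta] is invertible. Together with the central [Z] it is the family of
    operators normalised by [d] and [u] in the skew steps. *)
Definition affine_op (o : {linear M -> M}) : Prop :=
  (o =1 Z) \/ exists a b c : K, forall m, o m = a *: m + b *: x m + c *: y m.

Definition affop (a b c : K) : {linear M -> M} :=
  GRing.Linear.clone _ _ _ _ ((a \*: idfun \+ b \*: x) \+ c \*: y) _.

Lemma affopE a b c m : affop a b c m = a *: m + b *: x m + c *: y m.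
Proof. by []. Qed.

Lemma affop_affine a b c : affine_op (affop a b c).
Proof. by right; exists a, b, c. Qed.

Lemma affine_closed X o m : closedby (ops [:: y; x; Z]) X -> affine_op o -> X m -> X (o m).
Proof.
move=> /closedby_cons [/closedby_cons [/closedby_cons [[hX _] hZ] hx] hy] [->|[a [b [c ->]]]] hm; first exact: hZ.
by apply: subspaceD => //; [apply: subspaceD => //|]; apply: subspaceZ => //; [exact: hx | exact: hy].
Qed.

Lemma affine_d o : affine_op o -> exists2 o', affine_op o' & forall m, d (o m) = o' (d m).
Proof.
case=> [h|[a [b [c h]]]].
  by exists Z; [left | move=> m; rewrite h Zd].
exists (affop (a + c * gamma) (c * beta) (b + c * alpha)); first exact: affop_affine.
move=> m; rewrite h !linearD !linearZ_LR affopE d_x d_y !scalerDr !scalerA !scalerDl !addrA.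
by rewrite [LHS](ACl (1*5*4*2*3)).
Qed.

Lemma d_affine o : affine_op o -> exists2 o', affine_op o' & forall m, o (d m) = d (o' m).
Proof.
case=> [h|[a [b [c h]]]]; first by exists Z; [left | move=> m; rewrite h Zd].
exists (affop (a - b * beta^-1 * gamma) (c - b * beta^-1 * alpha) (b * beta^-1)); first exact: affop_affine.
move=> m; rewrite h affopE !linearD !linearZ_LR x_d d_x !scalerBl !scalerBr !scalerA !addrA.
by rewrite [LHS](ACl (1*4*5*3*2)).
Qed.

Lemma affine_u o : affine_op o -> exists2 o', affine_op o' & forall m, u (o m) = o' (u m).
Proof.
case=> [h|[a [b [c h]]]]; first by exists Z; [left | move=> m; rewrite h Zu].
exists (affop (a - b * beta^-1 * gamma) (c - b * beta^-1 * alpha) (b * beta^-1)); first exact: affop_affine.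
move=> m; rewrite h affopE !linearD !linearZ_LR u_x u_y !scalerBl !scalerBr !scalerA !addrA.
by rewrite [LHS](ACl (1*4*5*3*2)).
Qed.

Lemma u_affine o : affine_op o -> exists2 o', affine_op o' & forall m, o (u m) = u (o' m).
Proof.
case=> [h|[a [b [c h]]]]; first by exists Z; [left | move=> m; rewrite h Zu].
exists (affop (a + c * gamma) (c * beta) (b + c * alpha)); first exact: affop_affine.
move=> m; rewrite h affopE !linearD !linearZ_LR u_y y_u !scalerDr !scalerA !scalerDl !addrA.
by rewrite [LHS](ACl (1*5*4*2*3)).
Qed.

End DownUp.

Section Submodules.
Variables (K : fieldType) (alpha beta gamma : K) (M : DUModule alpha beta gamma).
Implicit Types (X : M -> Prop).

Lemma submoduleP X : is_submodule X <->
  [/\ subspace X, forall m, X m -> X (dum_d M m) & forall m, X m -> X (dum_u M m)].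
Proof. by split=> [[h1 h2 h3 h4 h5]|[[h1 h2 h3] h4 h5]]; split. Qed.

Lemma submodule_subspace X : is_submodule X -> subspace X.
Proof. by case/submoduleP. Qed.
Lemma submodule_d X m : is_submodule X -> X m -> X (dum_d M m).
Proof. by case/submoduleP=> _ h _; apply: h. Qed.
Lemma submodule_u X m : is_submodule X -> X m -> X (dum_u M m).
Proof. by case/submoduleP=> _ _ h; apply: h. Qed.

Definition acc : Prop := forall C : nat -> M -> Prop,
  (forall n, is_submodule (C n)) -> (forall n x, C n x -> C n.+1 x) ->
  exists N, forall n, (N <= n)%N -> forall x, C n x -> C N x.

Definition generated (P : M -> Prop) (m : M) : Prop :=
  forall X, is_submodule X -> (forall x, P x -> X x) -> X m.

Lemma generated_submodule P : is_submodule (generated P).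
Proof.
split=> [X hX _|x y hx hy X hX hP|k x hx X hX hP|x hx X hX hP|x hx X hX hP].
- by case: hX.
- by case: (hX) => _ h _ _ _; apply: h; [apply: hx | apply: hy].
- by case: (hX) => _ _ h _ _; apply: h; apply: hx.
- by case: (hX) => _ _ _ h _; apply: h; apply: hx.
- by case: (hX) => _ _ _ _ h; apply: h; apply: hx.
Qed.

Lemma generated_in (P : M -> Prop) m : P m -> generated P m.
Proof. by move=> h X _; apply. Qed.

Lemma zero_submodule : is_submodule (fun m : M => m = 0).
Proof.
by split=> // [x y -> ->|k x ->|x ->|x ->]; rewrite ?addr0 ?scaler0 ?linear0.
Qed.

End Submodules.

(** * The module as an iterated tower *)

Section DownUpTower.
Variables (K : fieldType) (alpha beta gamma : K).
Hypothesis beta0 : beta != 0.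
Variable M : DUModule alpha beta gamma.
Implicit Types (X : M -> Prop).
Local Notation d := (dum_d M).
Local Notation u := (dum_u M).
Local Notation x := (dux M).
Local Notation y := (duy M).

Variable Z : {linear M -> M}.
Hypothesis Zd : forall m, Z (d m) = d (Z m).
Hypothesis Zu : forall m, Z (u m) = u (Z m).
Variable s : seq M.

Local Notation affine := (affine_op Z).

(** The layers successively adjoin powers of [Z], [x], [y], [d], [u]; the last one is the span of
    the vectors [u^i d^j y^k x^l Z^r v] with [v] in [s]. *)
Definition layer0 := addspan (fun m : M => m = 0) s.
Definition layerZ := tower layer0 Z.
Definition layerx := tower layerZ x.
Definition layery := tower layerx y.
Definition layerd := tower layery d.
Definition layeru := tower layerd u.

Lemma affine_Z : affine Z. Proof. by left. Qed.
Lemma affine_x : affine x.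
Proof. by right; exists 0, 1, 0 => m; rewrite !scale0r scale1r add0r addr0. Qed.
Lemma affine_y : affine y.
Proof. by right; exists 0, 0, 1 => m; rewrite !scale0r scale1r !add0r. Qed.

Lemma affine_ops o : List.In o [:: y; x; Z] -> affine o.
Proof. by move=> [<-|[<-|[<-|//]]]; [exact: affine_y | exact: affine_x | exact: affine_Z]. Qed.

Lemma zero_subspace : subspace (fun m : M => m = 0).
Proof. exact: submodule_subspace (@zero_submodule _ _ _ _ M). Qed.

Lemma layer0_closed : closedby (ops [::]) layer0.
Proof. by apply/closedby_nil/addspan_subspace/zero_subspace. Qed.

Lemma Z_comm (o : {linear M -> M}) : List.In o [::] -> forall m, Z (o m) = o (Z m). Proof. by []. Qed.
Lemma x_comm (o : {linear M -> M}) : List.In o [:: Z] -> forall m, x (o m) = o (x m).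
Proof. by case=> // <- m; rewrite /= Zu Zd. Qed.
Lemma y_comm (o : {linear M -> M}) : List.In o [:: x; Z] -> forall m, y (o m) = o (y m).
Proof. by case=> [<- m|[<- m|//]]; [rewrite xy_comm | rewrite /= Zd Zu]. Qed.

Lemma layerZ_closed : closedby (ops [:: Z]) layerZ.
Proof. exact: commuting_tower Z_comm layer0_closed. Qed.
Lemma layerx_closed : closedby (ops [:: x; Z]) layerx.
Proof. exact: commuting_tower x_comm layerZ_closed. Qed.
Lemma layery_closed : closedby (ops [:: y; x; Z]) layery.
Proof. exact: commuting_tower y_comm layerx_closed. Qed.

Lemma layery_affine o : affine o -> forall m, layery m -> layery (o m).
Proof. by move=> ho m; apply: affine_closed ho; exact: layery_closed. Qed.

Lemma layery_subspace : subspace layery. Proof. by case: layery_closed. Qed.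

Lemma layerd_affine o : affine o -> forall m, layerd m -> layerd (o m).
Proof. by move=> ho m; apply: (tower_skew layery_affine (d_affine beta0 Zd)). Qed.

Lemma layerd_closed : closedby (ops [:: d; y; x; Z]) layerd.
Proof.
apply/closedby_cons; split; last by move=> m; exact: (towerT layery_subspace).
split; first exact: (tower_subspace d layery_subspace).
by move=> _ [o /affine_ops ho ->]; exact: layerd_affine.
Qed.

Lemma layerd_leading X : closedby (ops [:: d; y; x; Z]) X ->
  forall n, closedby (ops [:: y; x; Z]) (leading layery d X n).
Proof.
move=> /closedby_cons [hX hXd] n; have hXs : subspace X by case: hX.
split; first by apply: leading_subspace => //; exact: layery_subspace.
move=> _ [o /affine_ops ho ->] g.
apply: (leading_skew layery_affine (affine_d Zd) (d_affine beta0 Zd) hXs _ ho).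
by move=> o' ho' m; apply: affine_closed ho'.
Qed.

Lemma layerd_subspace : subspace layerd. Proof. by case: layerd_closed. Qed.

Lemma layeru_affine o : affine o -> forall m, layeru m -> layeru (o m).
Proof. by move=> ho m; apply: (tower_skew layerd_affine (u_affine Zu)). Qed.

Lemma layeru_subspace : subspace layeru.
Proof. exact: (tower_subspace u layerd_subspace). Qed.

Lemma layeru_d m : layeru m -> layeru (d m).
Proof.
case=> n; elim: n m => [|n IH] m /=; first by move=> ->; rewrite linear0; exact: subspace0 layeru_subspace.
case=> g hg /IH; rewrite linearB => h.
apply: (subspace_subr layeru_subspace h).
(* In positive degree [d u^(n+1) g = y u^n g], and the affine operator [y] preserves the tower. *)
case: n {IH h} => [|n] /=.
  by apply: (tower_base _ layerd_subspace); case/closedby_cons: layerd_closed => _; apply.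
rewrite -[d _]/(y (iter n u g)); apply: layeru_affine affine_y _ _.
by exists n.+1; apply: (tower_upto_iter _ layerd_subspace).
Qed.

Lemma layeru_closed : closedby (ops [:: u; d; y; x; Z]) layeru.
Proof.
apply/closedby_cons; split; last by move=> m; exact: (towerT layerd_subspace).
apply/closedby_cons; split; last exact: layeru_d.
split; first exact: layeru_subspace.
by move=> _ [o /affine_ops ho ->]; exact: layeru_affine.
Qed.

Lemma layeru_leading X : closedby (ops [:: u; d; y; x; Z]) X ->
  forall n, closedby (ops [:: d; y; x; Z]) (leading layerd u X n).
Proof.
move=> /closedby_cons [/closedby_cons [hX hXd] hXu] n; have hXs : subspace X by case: hX.
apply/closedby_cons; split.
  split; first by apply: leading_subspace => //; exact: layerd_subspace.
  move=> _ [o /affine_ops ho ->] g.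
  apply: (leading_skew layerd_affine (affine_u beta0 Zu) (u_affine Zu) hXs _ ho).
  by move=> o' ho' m; apply: affine_closed ho'.
have hd : forall g, layerd g -> layerd (d g) by case/closedby_cons: layerd_closed.
move=> g [hg [w hw hx]]; split; first exact: hd.
case: n hw hx => [|n] /= hw hx.
  by exists 0; rewrite // subr0; apply: hXd; move: hx; rewrite hw subr0.
(* [u^(n+1) d g = u^n x g] has lower degree, so in positive degree [d g] is automatically a leading
   coefficient. *)
exists (iter n.+1 u (d g)); last by rewrite subrr; exact: subspace0.
rewrite iterSr -[u (d g)]/(x g); apply: (tower_upto_iter _ layerd_subspace).
exact: layerd_affine affine_x _ hg.
Qed.

Lemma layerZ_noeth : noeth (ops [:: Z]) layerZ.
Proof. apply: (commuting_noeth Z_comm layer0_closed); exact: addspan_noeth. Qed.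
Lemma layerx_noeth : noeth (ops [:: x; Z]) layerx.
Proof. exact: (commuting_noeth x_comm layerZ_closed layerZ_noeth). Qed.
Lemma layery_noeth : noeth (ops [:: y; x; Z]) layery.
Proof. exact: (commuting_noeth y_comm layerx_closed layerx_noeth). Qed.
Lemma layerd_noeth : noeth (ops [:: d; y; x; Z]) layerd.
Proof.
apply: (tower_noeth layery_subspace _ layerd_leading layery_noeth).
by move=> X /closedby_cons.
Qed.
Lemma layeru_noeth : noeth (ops [:: u; d; y; x; Z]) layeru.
Proof.
apply: (tower_noeth layerd_subspace _ layeru_leading layerd_noeth).
by move=> X /closedby_cons.
Qed.

Lemma layeru_submodule : is_submodule layeru.
Proof.
apply/submoduleP; case/closedby_cons: layeru_closed => /closedby_cons [[h _] hd] hu.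
by split.
Qed.

Lemma layeru_mem m : m \in s -> layeru m.
Proof.
move=> hm; apply/(tower_base _ layerd_subspace)/(tower_base _ layery_subspace).
apply: tower_base; first by case: layerx_closed.
apply: tower_base; first by case: layerZ_closed.
apply: tower_base; first by case: layer0_closed.
exact: (addspan_mem zero_subspace).
Qed.

End DownUpTower.

Section Noetherian.
Variables (K : fieldType) (alpha beta gamma : K).
Hypothesis beta0 : beta != 0.
Variable M : DUModule alpha beta gamma.

Lemma submodule_closedby (X : M -> Prop) : is_submodule X ->
  closedby (ops [:: dum_u M; dum_d M; duy M; dux M; idfun : {linear M -> M}]) X.
Proof.
case/submoduleP=> hX hd hu; split=> // _ [o ho ->] m hm.
case: ho => [<-|[<-|[<-|[<-|[<-|//]]]]] //=; by [apply: hu | apply: hd | apply/hd/hu | apply/hu/hd].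
Qed.

(** Noetherianity is the tower theorem with the identity for [Z]; a genuine central [Z] is put in
    for the Nullstellensatz. *)
Theorem fin_generated_acc : fin_generated M -> acc M.
Proof.
case=> s hs C hC hmono.
have hZ (m : M) (f : M -> M) : idfun (f m) = f (idfun m) by [].
apply: (layeru_noeth beta0 (Z := idfun : {linear M -> M}) (fun m => hZ m (dum_d M)) (fun m => hZ m (dum_u M)) (s := s)) => //.
- by move=> n; exact: submodule_closedby.
- move=> n m _; apply: hs; first exact: layeru_submodule.
  by move=> x; exact: layeru_mem.
Qed.
End Noetherian.

(** * Central operators: generic flatness and Fitting's argument *)

Section Nullstellensatz.
Variables (K : fieldType) (alpha beta gamma : K).
Hypothesis beta0 : beta != 0.
Variable M : DUModule alpha beta gamma.
Implicit Types (X : M -> Prop) (p f : {poly K}).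
Local Notation d := (dum_d M).
Local Notation u := (dum_u M).
Local Notation x := (dux M).
Local Notation y := (duy M).
Variable s0 : M.

Section OneOperator.
Variable Z : {linear M -> M}.
Hypothesis Zd : forall m, Z (d m) = d (Z m).
Hypothesis Zu : forall m, Z (u m) = u (Z m).
Local Notation s := [:: s0].
Local Notation LZ := (layerZ Z s).
Local Notation Lx := (layerx Z s).
Local Notation Ly := (layery Z s).
Local Notation Ld := (layerd Z s).
Local Notation Lu := (layeru Z s).

Lemma layerZ_pev m : LZ m -> exists q, m = pev Z q s0.
Proof.
case=> n; elim: n m => [|n IH] m /=; first by move=> ->; exists 0; rewrite pev0.
case=> g [k /= /subr0_eq hk] /IH [q hq]; exists (q + k *: 'X^n).
by rewrite pevDl -hq pevZl pevXn -iter_linZ -hk subrK.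
Qed.

Lemma layerZ_subspace : subspace LZ.
Proof. by case: (layerZ_closed Z s). Qed.
Lemma layerx_subspace : subspace Lx.
Proof. by case: (layerx_closed Zd Zu s). Qed.

Lemma layer_Z (l : seq {linear M -> M}) X : closedby (ops (rcons l Z)) X ->
  forall m, X m -> X (Z m).
Proof.
move=> h m; apply: (closedby_in h); elim: l {h} => [|o l IH] /=; by [left | right].
Qed.

(** [K[Z] s0] is cyclic. If [X] contains [f(Z) s0] with [f] nonzero, Bezout excludes torsion prime
    to [f]. Otherwise [X] contains no [q(Z) s0] with [q] nonzero, and coprimality to ['X] only
    serves to exclude [p = 0]. *)
Lemma layerZ_flat : flat Z (ops [:: Z]) LZ.
Proof.
move=> X hX; have hXs : subspace X by case: hX.
have XZ := layer_Z (l := [::]) hX.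
have [[f [f0 hf]]|h] := pselect (exists f, f != 0 /\ X (pev Z f s0)).
  exists f => // p hp g /layerZ_pev [q ->] hg.
  apply: (pev_coprime hXs XZ hp hg).
  by rewrite -pevM mulrC pevM; apply: pev_stable.
exists 'X; rewrite ?polyX_eq0 // => p hp g /layerZ_pev [q ->]; rewrite -pevM => hg.
have [q0|q0] := eqVneq q 0; first by rewrite q0 pev0; exact: subspace0.
have [p0|p0] := eqVneq p 0.
  by move: hp; rewrite p0 coprime0p -size_poly_eq1 size_polyX.
by case: h; exists (p * q); rewrite mulf_neq0.
Qed.

Lemma zero_closedby (l : seq {linear M -> M}) : closedby (ops l) (fun m : M => m = 0).
Proof. by split=> [|_ [o _ ->] m ->]; [exact: zero_subspace | rewrite linear0]. Qed.

Let cons_in (o : {linear M -> M}) l X : closedby (ops (o :: l)) X ->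
  closedby (ops l) X /\ forall m, X m -> X (o m).
Proof. by move/closedby_cons. Qed.
Let ZZx m : Z (x m) = x (Z m). Proof. by rewrite /= Zu Zd. Qed.
Let ZZy m : Z (y m) = y (Z m). Proof. by rewrite /= Zd Zu. Qed.

Let LZ_Z : forall m, LZ m -> LZ (Z m).
Proof. exact: (@layer_Z [::] _ (layerZ_closed Z s)). Qed.
Let Lx_Z : forall m, Lx m -> Lx (Z m).
Proof. exact: (@layer_Z [:: x] _ (layerx_closed Zd Zu s)). Qed.
Let Ly_Z : forall m, Ly m -> Ly (Z m).
Proof. exact: (@layer_Z [:: y; x] _ (layery_closed Zd Zu s)). Qed.
Let Ld_Z : forall m, Ld m -> Ld (Z m).
Proof. exact: (@layer_Z [:: d; y; x] _ (layerd_closed beta0 Zd Zu s)). Qed.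

Let nZ : noeth (ops [:: Z]) LZ. Proof. exact: layerZ_noeth. Qed.
Let nx : noeth (ops [:: x; Z]) Lx. Proof. exact: layerx_noeth. Qed.
Let ny : noeth (ops [:: y; x; Z]) Ly. Proof. exact: layery_noeth. Qed.
Let nd : noeth (ops [:: d; y; x; Z]) Ld. Proof. exact: layerd_noeth. Qed.

Let leadx := commuting_leading (x_comm Zd Zu) (layerZ_closed Z s).
Let leady := commuting_leading (y_comm Zd Zu) (layerx_closed Zd Zu s).

Lemma layerx_flat : flat Z (ops [:: x; Z]) Lx.
Proof.
exact: (tower_flat layerZ_subspace (@cons_in x _) leadx ZZx (@layer_Z [:: x]) LZ_Z nZ layerZ_flat).
Qed.
Lemma layery_flat : flat Z (ops [:: y; x; Z]) Ly.
Proof.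
exact: (tower_flat layerx_subspace (@cons_in y _) leady ZZy (@layer_Z [:: y; x]) Lx_Z nx layerx_flat).
Qed.
Lemma layerd_flat : flat Z (ops [:: d; y; x; Z]) Ld.
Proof.
exact: (tower_flat (layery_subspace Zd Zu s) (@cons_in d _) (layerd_leading beta0 Zd Zu s) Zd (@layer_Z [:: d; y; x]) Ly_Z ny layery_flat).
Qed.

(** Each of the four upper towers is torsion-free over the one below away from some polynomial;
    their product allows the descent from the whole cyclic module to [K[Z] s0]. *)
Lemma layerZ_saturated : exists2 f, f != 0 & torsionfree Z f Lu LZ.
Proof.
have [f1 f10 h1] := tower_saturated layerZ_subspace (@cons_in x _) leadx ZZx LZ_Z
  nZ layerZ_flat (zero_closedby _).
have [f2 f20 h2] := tower_saturated layerx_subspace (@cons_in y _) leady ZZy Lx_Z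
  nx layerx_flat (zero_closedby _).
have [f3 f30 h3] := tower_saturated (layery_subspace Zd Zu s) (@cons_in d _)
  (layerd_leading beta0 Zd Zu s) Zd Ly_Z ny layery_flat (zero_closedby _).
have [f4 f40 h4] := tower_saturated (layerd_subspace beta0 Zd Zu s) (@cons_in u _)
  (layeru_leading beta0 Zd Zu s) Zu Ld_Z nd layerd_flat (zero_closedby _).
exists (f1 * f2 * f3 * f4); first by rewrite !mulf_neq0.
move=> p; rewrite !coprimepMr -!andbA => /and4P [p1 p2 p3 p4] w hw hpw.
have ix m : LZ m -> Lx m by exact: (tower_base x layerZ_subspace).
have iy m : Lx m -> Ly m by exact: (tower_base y layerx_subspace).
have id m : Ly m -> Ld m by exact: (tower_base d (layery_subspace Zd Zu s)).
have hd := h4 p p4 w hw (id _ (iy _ (ix _ hpw))).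
have hy := h3 p p3 w hd (iy _ (ix _ hpw)).
by have hx := h2 p p2 w hy (ix _ hpw); exact: h1 p p1 w hx hpw.
Qed.

Hypothesis s0_min : forall X, is_submodule X -> nonzero_sub X -> X s0.

Lemma Z_image_submodule p X : is_submodule X -> is_submodule (fun m => exists2 w, X w & m = pev Z p w).
Proof.
case/submoduleP=> hX hd hu; apply/submoduleP; split.
- split; first by exists 0; [exact: subspace0 | rewrite linear0].
  + by move=> _ _ [v hv ->] [w hw ->]; exists (v + w); [apply: subspaceD | rewrite linearD].
  + by move=> k _ [v hv ->]; exists (k *: v); [apply: subspaceZ | rewrite linearZ].
- by move=> _ [w hw ->]; exists (d w); [apply: hd | rewrite (pev_commute (B := d))].
- by move=> _ [w hw ->]; exists (u w); [apply: hu | rewrite (pev_commute (B := u))].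
Qed.

(** If no nonzero polynomial in [Z] kills [s0], take a nonconstant [p] coprime to the exceptional
    [f]. The image under [p(Z)] of the submodule generated by [s0] is nonzero, so [s0 = p(Z) w];
    saturation gives [w = q(Z) s0], whence [p q = 1], against the degree of [p]. *)
Theorem nullstellensatz : exists2 p, p != 0 & pev Z p s0 = 0.
Proof.
apply: contrapT => h.
have inj p : p != 0 -> pev Z p s0 <> 0 by move=> p0 e; apply: h; exists p.
have [f f0 hf] := layerZ_saturated.
have Lu_sub := layeru_submodule beta0 Zd Zu s.
have Lu_s0 : Lu s0 by apply: layeru_mem; rewrite ?inE.
(* Coprime to [f] by an explicit Bezout identity, and nonconstant because [f] is nonzero. *)
pose p := f * 'X + 1.
have szp : size p = (size f).+1.
  rewrite /p -polyC1 size_MXaddC (negbTE f0) //.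
have p0 : p != 0 by rewrite -size_poly_gt0 szp.
have cp : coprimep p f.
  by apply/Bezout_eq1_coprimepP; exists (1, - 'X); rewrite /= /p mul1r mulNr mulrC addrC addKr.
have [w hw e] : exists2 w, Lu w & s0 = pev Z p w.
  apply: (s0_min (Z_image_submodule p Lu_sub)); exists (pev Z p s0); last exact: inj.
  by exists s0.
have /layerZ_pev [q hq] : LZ w.
  apply: (hf p cp w hw); rewrite -e.
  have h0 := layer0_closed s.
  apply: tower_base; first by case: h0.
  by apply: (addspan_mem (zero_subspace M)); rewrite inE.
case: (eqVneq (p * q - 1) 0) => [/subr0_eq pq1|pq0]; last first.
  by apply: (inj _ pq0); rewrite pevBl pevM pev1 -hq -e subrr.
have := size_mul p0 (_ : q != 0); rewrite pq1 size_poly1 szp /=.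
case: (eqVneq q 0) => [q0|q0 /(_ isT)].
  by move/eqP: pq1; rewrite q0 mulr0 eq_sym oner_eq0.
by move/eqP; rewrite -size_poly_gt0 in f0; rewrite -size_poly_gt0 in q0; case: (size f) f0 => // n _; case: (size q) q0 => // k _; rewrite addSn addnS.
Qed.
End OneOperator.

Hypothesis s0_min : forall X, is_submodule X -> nonzero_sub X -> X s0.
Hypothesis s00 : s0 <> 0.

(** Commutation up to nonzero scalars is enough for kernels and images of powers to be submodules;
    it covers the central operators as well as the eigenvectors of the automorphism [s]. *)
Definition normal_op (phi : {linear M -> M}) : Prop :=
  (exists2 e, e != 0 & forall m, d (phi m) = e *: phi (d m)) /\
  (exists2 e, e != 0 & forall m, u (phi m) = e *: phi (u m)).

Lemma normal_iter phi k : normal_op phi ->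
  (exists2 e, e != 0 & forall m, d (iter k phi m) = e *: iter k phi (d m)) /\
  (exists2 e, e != 0 & forall m, u (iter k phi m) = e *: iter k phi (u m)).
Proof.
move=> [[e e0 he] [e' e'0 he']]; split.
  exists (e ^+ k); rewrite ?expf_neq0 //; elim: k => [|k IH] m; first by rewrite scale1r.
  by rewrite /= he IH linearZ scalerA exprS.
exists (e' ^+ k); rewrite ?expf_neq0 //; elim: k => [|k IH] m; first by rewrite scale1r.
by rewrite /= he' IH linearZ scalerA exprS.
Qed.

Lemma normal_ker phi k : normal_op phi -> is_submodule (fun m => iter k phi m = 0).
Proof.
move=> /(normal_iter k) [[e e0 he] [e' e'0 he']]; apply/submoduleP; split.
- split=> [|v w hv hw|c v hv]; first exact: iter_lin0.
    by rewrite iter_linD hv hw addr0.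
  by rewrite iter_linZ hv scaler0.
- by move=> m hm; apply: (scalerI e0); rewrite -he hm linear0 scaler0.
- by move=> m hm; apply: (scalerI e'0); rewrite -he' hm linear0 scaler0.
Qed.

Lemma normal_image phi k : normal_op phi -> is_submodule (fun m => exists w, m = iter k phi w).
Proof.
move=> /(normal_iter k) [[e e0 he] [e' e'0 he']]; apply/submoduleP; split.
- split=> [|_ _ [v ->] [w ->]|c _ [v ->]]; first by exists 0; rewrite iter_lin0.
    by exists (v + w); rewrite iter_linD.
  by exists (c *: v); rewrite iter_linZ.
- by move=> _ [w ->]; exists (e *: d w); rewrite he iter_linZ.
- by move=> _ [w ->]; exists (e' *: u w); rewrite he' iter_linZ.
Qed.

(* Fitting: if [ker phi^n] is stationary, then [im phi^n] meets [ker phi] in 0. *)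
Lemma normal_nilpotent phi : acc M -> normal_op phi -> phi s0 = 0 ->
  exists n, forall m, iter n phi m = 0.
Proof.
move=> hacc hphi h0.
have [n hn] := hacc (fun k m => iter k phi m = 0) (fun k => normal_ker k hphi)
  (fun k m (h : iter k phi m = 0) => etrans (congr1 phi h) (linear0 phi)).
exists n => m; apply: contrapT => hm.
have [w hw] : exists w, s0 = iter n phi w.
  by apply: (s0_min (normal_image n hphi)); exists (iter n phi m) => //; exists m.
apply: s00; rewrite hw; apply: (hn n.+1) => //.
by rewrite iterS -hw.
Qed.

End Nullstellensatz.

(** The polynomial [p] with [p(Z) s0 = 0] need not annihilate [M], but [p(Z)] is nilpotent by the
    Fitting argument, so a power of [p] does. *)
Lemma central_algebraic (K : fieldType) (alpha beta gamma : K) (M : DUModule alpha beta gamma)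
  (Z : {linear M -> M}) : beta != 0 -> fin_generated M -> monolithic M ->
  (forall m, Z (dum_d M m) = dum_d M (Z m)) -> (forall m, Z (dum_u M m) = dum_u M (Z m)) ->
  exists2 p, p != 0 & forall m, pev Z p m = 0.
Proof.
move=> beta0 hfg [s0 s00 hmin] Zd Zu.
have [p p0 hp] := nullstellensatz beta0 Zd Zu hmin.
have hn : normal_op (pev Z p : {linear M -> M}).
  split; exists 1; rewrite ?oner_neq0 // => m; rewrite scale1r.
    by rewrite (pev_commute (B := dum_d M)).
  by rewrite (pev_commute (B := dum_u M)).
have [n h] := normal_nilpotent hmin s00 (fin_generated_acc beta0 hfg) hn hp.
exists (p ^+ n); first by rewrite expf_neq0.
move=> m; rewrite -(h m); elim: n {h} => [|n IH] /=; first by rewrite pev1.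
by rewrite exprS pevM IH.
Qed.

(** * Submodules as modules, and chain conditions inside them *)

Section SubDU.
Variables (K : fieldType) (alpha beta gamma : K) (M : DUModule alpha beta gamma).
Variable (W : M -> Prop) (hW : is_submodule W).

(** Carrying the proof in the predicate lets its closure properties, and then the module structure
    of the subtype, be inferred. *)
Definition submodule_pred (_ : is_submodule W) : {pred M} := fun m => `[< W m >].
Local Notation Wp := (submodule_pred hW).

Fact submodule_pred_closed : submod_closed Wp.
Proof.
have [h0 hD hZ _ _] := hW; split; first exact/asboolP.
by move=> k x y /asboolP hx /asboolP hy; apply/asboolP/hD => //; apply: hZ.
Qed.
HB.instance Definition _ := GRing.isSubmodClosed.Build K M Wp (GRing.submod_closed_semi submodule_pred_closed).

Record sub_carrier := SubCarrier { sub_val : M; _ : sub_val \in Wp }.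
HB.instance Definition _ := [isSub for sub_val].
HB.instance Definition _ := [Choice of sub_carrier by <:].
HB.instance Definition _ := [SubChoice_isSubLmodule of sub_carrier by <:].

Lemma sub_valP (w : sub_carrier) : W (\val w).
Proof. by case: w => m /= /asboolP. Qed.

Definition sub_mk m (h : W m) : sub_carrier := SubCarrier (introT (asboolP _) h).

Definition sub_d (w : sub_carrier) := sub_mk (submodule_d hW (sub_valP w)).
Definition sub_u (w : sub_carrier) := sub_mk (submodule_u hW (sub_valP w)).

Lemma sub_valD (v w : sub_carrier) : \val (v + w) = \val v + \val w. Proof. exact: raddfD. Qed.
Lemma sub_valZ k (v : sub_carrier) : \val (k *: v) = k *: \val v. Proof. exact: linearZ. Qed.
Lemma sub_val_d (v : sub_carrier) : \val (sub_d v) = dum_d M (\val v). Proof. by []. Qed.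
Lemma sub_val_u (v : sub_carrier) : \val (sub_u v) = dum_u M (\val v). Proof. by []. Qed.
Definition sub_valE := (sub_valD, sub_valZ, sub_val_d, sub_val_u).

Fact sub_d_linear : linear sub_d.
Proof. by move=> k v w; apply: val_inj; rewrite !sub_valE linearP. Qed.
Fact sub_u_linear : linear sub_u.
Proof. by move=> k v w; apply: val_inj; rewrite !sub_valE linearP. Qed.
HB.instance Definition _ := GRing.isLinear.Build K sub_carrier sub_carrier _ sub_d sub_d_linear.
HB.instance Definition _ := GRing.isLinear.Build K sub_carrier sub_carrier _ sub_u sub_u_linear.

Fact sub_rel1 (m : sub_carrier) : sub_d (sub_d (sub_u m)) =
  alpha *: sub_d (sub_u (sub_d m)) + beta *: sub_u (sub_d (sub_d m)) + gamma *: sub_d m.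
Proof. by apply: val_inj; rewrite !sub_valE dum_rel1. Qed.
Fact sub_rel2 (m : sub_carrier) : sub_d (sub_u (sub_u m)) =
  alpha *: sub_u (sub_d (sub_u m)) + beta *: sub_u (sub_u (sub_d m)) + gamma *: sub_u m.
Proof. by apply: val_inj; rewrite !sub_valE dum_rel2. Qed.

Definition subDU : DUModule alpha beta gamma := Build_DUModule sub_rel1 sub_rel2.
End SubDU.

Section SubDUTheory.
Variables (K : fieldType) (alpha beta gamma : K) (M : DUModule alpha beta gamma).
Implicit Types (X W : M -> Prop).

Definition artinian_in W : Prop := forall C : nat -> M -> Prop,
  (forall n, is_submodule (C n)) -> (forall n x, C n x -> W x) ->
  (forall n x, C n.+1 x -> C n x) ->
  exists N, forall n, (N <= n)%N -> forall x, C N x -> C n x.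

Lemma desc_mono (C : nat -> M -> Prop) : (forall n x, C n.+1 x -> C n x) ->
  forall m n, (m <= n)%N -> forall x, C n x -> C m x.
Proof.
move=> h m n; elim: n => [|n IH]; first by rewrite leqn0 => /eqP ->.
by rewrite leq_eqVlt => /orP [/eqP -> //|]; rewrite ltnS => /IH hn x /h /hn.
Qed.

Lemma artinian_inT W : (forall m, W m) -> artinian_in W <-> artinian M.
Proof.
move=> hW; split=> h C hC.
  move=> hmono; have [N hN] := h C hC (fun n x _ => hW x) hmono.
  by exists N => n hn x; split; [exact: desc_mono | exact: hN].
move=> _ hmono; have [N hN] := h C hC hmono.
by exists N => n hn x /(hN n hn).
Qed.

Section Sub.
Variables (W : M -> Prop) (hW : is_submodule W).
Local Notation val := (\val : sub_carrier hW -> M).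

Lemma sub_preim_submodule X : is_submodule X -> is_submodule (fun w : subDU hW => X (val w)).
Proof.
case=> h0 hD hZ hd hu; split.
- by have -> : val 0 = 0 by apply: raddf0.
- by move=> x y hx hy; rewrite sub_valD; apply: hD.
- by move=> k x hx; rewrite sub_valZ; apply: hZ.
- by move=> x hx; exact: hd.
- by move=> x hx; exact: hu.
Qed.

Lemma sub_im_submodule (Y : subDU hW -> Prop) : is_submodule Y ->
  is_submodule (fun m : M => exists2 w : subDU hW, Y w & m = val w).
Proof.
case=> h0 hD hZ hd hu; split.
- by exists 0 => //; rewrite raddf0.
- by move=> _ _ [v hv ->] [w hw ->]; exists (v + w); [exact: hD | rewrite sub_valD].
- by move=> k _ [v hv ->]; exists (k *: v); [exact: hZ | rewrite sub_valZ].
- by move=> _ [v hv ->]; exists (dum_d (subDU hW) v); first exact: hd.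
- by move=> _ [v hv ->]; exists (dum_u (subDU hW) v); first exact: hu.
Qed.

Lemma sub_monolithic : monolithic M -> nonzero_sub W -> monolithic (subDU hW).
Proof.
move=> [m0 m00 hm0] hW0; have hm := hm0 W hW hW0.
exists (sub_mk hW hm) => [e|Y hY [w hw w0]].
  by apply: m00; move/(congr1 val): e; rewrite raddf0.
have [|w' hw' e] := hm0 _ (sub_im_submodule hY).
  exists (val w); first by exists w.
  by move=> e; apply: w0; apply: val_inj; rewrite e raddf0.
by have -> : sub_mk hW hm = w' by apply: val_inj.
Qed.

Lemma sub_artinian : artinian (subDU hW) -> artinian_in W.
Proof.
move=> h C hC hCW hmono.
have [N hN] := h (fun n (w : subDU hW) => C n (val w)) (fun n => sub_preim_submodule (hC n))
  (fun n w => hmono n (val w)).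
exists N => n hn x hx.
by have /(hN n hn) := hx : C N (val (sub_mk hW (hCW _ _ hx))).
Qed.

(** Dependent choice: as long as the chosen vectors do not generate [W], another one is picked in
    [W] outside the submodule they generate; this ascending chain must stop. *)
Lemma acc_fin_generated : acc M ->
  exists s : seq M, (forall x, x \in s -> W x) /\
    forall X, is_submodule X -> (forall x, x \in s -> X x) -> forall m, W m -> X m.
Proof.
move=> hacc; apply: contrapT => hn.
have next (s : seq M) : exists x, (forall z, z \in s -> W z) -> W x /\ ~ generated (fun z => z \in s) x.
  (* The value 0 makes the choice total on lists not contained in [W], which the iteration from the
     empty list never meets. *)
  case: (pselect (forall z, z \in s -> W z)) => hs; last by exists 0.
  apply: contrapT => h; apply: hn; exists s; split=> // X hX hsX m hm.
  apply: contrapT => hXm; apply: h; exists m => _; split=> // hg.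
  by apply: hXm; apply: hg.
pose nx s := sval (cid (next s)).
pose sq := fix sq n := if n is n'.+1 then nx (sq n') :: sq n' else [::].
have sqW n : forall z, z \in sq n -> W z.
  elim: n => [|n IH] z //=; rewrite inE => /orP [/eqP ->|]; last exact: IH.
  by rewrite /nx; case: cid => x /= /(_ IH) [].
have [N hN] := hacc (fun n => generated (fun z => z \in sq n)) (fun n => generated_submodule _)
  (fun n m (h : generated _ m) X hX hs => h X hX (fun x hx => hs x (mem_behead (s := sq n.+1) hx))).
have : generated (fun z => z \in sq N.+1) (nx (sq N)) by apply: generated_in; rewrite /= inE eqxx.
move/(hN _ (leqnSn N)).
by rewrite /nx; case: cid => x /= /(_ (sqW N)) [].
Qed.

Lemma sub_fin_generated : acc M -> fin_generated (subDU hW).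
Proof.
move=> /acc_fin_generated [s [hs hgen]].
have hsq : exists s' : seq (subDU hW), map val s' = s.
  elim: s hs {hgen} => [|x s IH] hs; first by exists [::].
  have [s' hs'] := IH (fun z hz => hs z (mem_behead (s := x :: s) hz)).
  have hx : W x by apply: hs; rewrite inE eqxx.
  by exists (sub_mk hW hx :: s'); rewrite /= hs'.
have [s' hs'] := hsq; exists s' => Y hY hYs w.
have [|w' hw' e] := hgen _ (sub_im_submodule hY) _ (val w) (sub_valP w); last first.
  by have -> : w = w' by apply: val_inj.
by move=> x; rewrite -hs' => /mapP [z hz ->]; exists z => //; apply: hYs.
Qed.

End Sub.

Lemma submoduleI X Y : is_submodule X -> is_submodule Y -> is_submodule (fun m => X m /\ Y m).
Proof.
case=> h0 hD hZ hd hu [k0 kD kZ kd ku].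
by split=> [|x y [h1 h2] [h3 h4]|c x [h1 h2]|x [h1 h2]|x [h1 h2]]; split; auto.
Qed.

(** Induction on the nilpotency index, which drops on images under [phi]: a descending chain [C]
    stops once [phi(C)] and the intersection of [C] with the kernel of [phi] have both stopped. *)
Lemma normal_artinian (phi : {linear M -> M}) n : normal_op phi ->
  artinian_in (fun m => phi m = 0) -> (forall m, iter n phi m = 0) -> artinian M.
Proof.
move=> hphi hker hn; apply/(artinian_inT hn).
elim: n {hn} => [|n IH] C hC hCW hmono.
  by exists 0%N => n _ x /hCW /= ->; case: (hC n).
have hsub X : is_submodule X -> is_submodule (fun m => exists2 w, X w & m = phi w).
  have [[e e0 he] [e' e'0 he']] := hphi.
  case=> h0 hD hZ hd hu; split.
  - by exists 0; rewrite ?linear0.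
  - by move=> _ _ [v hv ->] [w hw ->]; exists (v + w); [exact: hD | rewrite linearD].
  - by move=> k _ [v hv ->]; exists (k *: v); [exact: hZ | rewrite linearZ].
  - by move=> _ [v hv ->]; exists (e *: dum_d M v); [apply/hZ/hd | rewrite he linearZ].
  - by move=> _ [v hv ->]; exists (e' *: dum_u M v); [apply/hZ/hu | rewrite he' linearZ].
have [|||N1 hN1] := IH (fun k m => exists2 w, C k w & m = phi w).
- by move=> k; exact: hsub.
- by move=> k _ [w hw ->]; rewrite -iterSr; exact: hCW hw.
- by move=> k _ [w hw ->]; exists w => //; exact: hmono.
have [|||N2 hN2] := hker (fun k m => C k m /\ phi m = 0).
- by move=> k; exact: (submoduleI (hC k) (normal_ker 1 hphi)).
- by move=> k x [].
- by move=> k x [h1 h2]; split=> //; exact: hmono.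
exists (maxn N1 N2) => k hk x hx.
have hxN : C N1 x by apply: (desc_mono hmono _ hx); rewrite leq_maxl.
have [w hw e] := hN1 k (leq_trans (leq_maxl _ _) hk) (phi x) (ex_intro2 _ _ x hxN erefl).
have [] : C k (x - w) /\ phi (x - w) = 0; last first.
  by move=> h _; apply: (subspace_subr (submodule_subspace (hC k)) h hw).
apply: (hN2 k (leq_trans (leq_maxr _ _) hk)); split; last by rewrite linearB e subrr.
apply: (subspaceB (submodule_subspace (hC N2))).
  by apply: (desc_mono hmono _ hx); rewrite leq_maxr.
by apply: (desc_mono hmono _ hw); apply: leq_trans (leq_maxr _ _) hk.
Qed.

End SubDUTheory.

(** * Growth and skew operators *)

Section PowerSpan.
Variables (K : fieldType) (M : lmodType K) (T : {linear M -> M}) (P : M -> Prop).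
Hypothesis hP : subspace P.

Definition power_span : M -> Prop := span (fun w => exists j z, P z /\ w = iter j T z).

Lemma power_span_in j z : P z -> power_span (iter j T z).
Proof. by move=> hz; apply: span_in; exists j, z. Qed.

Lemma power_sum_pad (f : nat -> M) m n : (forall k, (m <= k)%N -> f k = 0) -> (m <= n)%N ->
  \sum_(k < n) iter k T (f k) = \sum_(k < m) iter k T (f k).
Proof.
move=> hf hmn; rewrite [RHS](big_ord_widen n (fun k => iter k T (f k)) hmn) [LHS](bigID (fun k : 'I_n => (k < m)%N)) /=.
by rewrite [X in _ + X]big1 ?addr0 // => k; rewrite -leqNgt => /hf ->; rewrite iter_lin0.
Qed.

Lemma power_span_sum w : power_span w -> exists N f,
  [/\ forall k, P (f k), forall k, (N <= k)%N -> f k = 0 & w = \sum_(k < N) iter k T (f k)].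
Proof.
move: w; apply: span_min => [|_ [j [z [hz ->]]]].
  split.
  - exists 0%N, (fun=> 0); split=> //; first by move=> k; exact: subspace0.
    by rewrite big_ord0.
  - move=> _ _ [m [f [hf hm ->]]] [n [g [hg hn ->]]].
    exists (maxn m n), (fun k => f k + g k); split=> [k|k|]; first exact: subspaceD.
      by rewrite geq_max => /andP [/hm -> /hn ->]; rewrite addr0.
    rewrite (eq_bigr (fun k : 'I_(maxn m n) => iter k T (f k) + iter k T (g k))); last by move=> k _; rewrite iter_linD.
    by rewrite big_split /= (power_sum_pad hm (leq_maxl m n)) (power_sum_pad hn (leq_maxr m n)).
  - move=> a _ [m [f [hf hm ->]]]; exists m, (fun k => a *: f k); split=> [k|k hk|]; first exact: subspaceZ.
      by rewrite hm // scaler0.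
    by rewrite scaler_sumr; apply: eq_bigr => k _; rewrite iter_linZ.
exists j.+1, (fun k => if k == j then z else 0); split=> [k|k hk|].
- by case: eqP => _ //; exact: subspace0.
- by case: eqP => // e; rewrite e ltnn in hk.
- rewrite big_ord_recr /= eqxx big1 ?add0r // => i _.
  by rewrite ltn_eqF // iter_lin0.
Qed.
End PowerSpan.

(** * Monomials in one of d, u: freeness, its failure, linear growth *)

Section OneSided.
Variables (K : fieldType) (M : lmodType K) (d u t c : {linear M -> M}) (zeta : K).
Implicit Types (Q : M -> Prop).
Hypothesis zeta0 : zeta != 0.
Hypothesis ct : forall m, c (t m) = t (c m).
Hypothesis dt : forall m, d (t m) = t (d m) + d m.
Hypothesis ut : forall m, u (t m) = t (u m) - u m.
Hypothesis dc : forall m, d (c m) = zeta *: c (d m).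
Hypothesis uc : forall m, u (c m) = zeta^-1 *: c (u m).

(** The [K[c,t]]-submodules. They need not be stable under [d] and [u], but images and preimages
    under powers of [d] and [u] are again of this kind, since [c] and [t] cross [d] and [u] up to
    scalars and integer shifts. *)
Definition ctclosed Q : Prop :=
  [/\ subspace Q, forall m, Q m -> Q (c m) & forall m, Q m -> Q (t m)].

Lemma t_iter_d j m : t (iter j d m) = iter j d (t m) - j%:R *: iter j d m.
Proof.
elim: j => [|j IH] /=; first by rewrite scale0r subr0.
have -> : t (d (iter j d m)) = d (t (iter j d m)) - d (iter j d m) by rewrite dt addrK.
by rewrite IH linearB linearZ /= -natr1 scalerDl scale1r opprD addrA.
Qed.

Lemma c_iter_d j m : c (iter j d m) = zeta ^- j *: iter j d (c m).
Proof.
elim: j m => [|j IH] m /=; first by rewrite invr1 scale1r.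
apply: (scalerI zeta0); rewrite -dc IH linearZ scalerA exprS invfM mulrA mulfV // mul1r //.
Qed.

Lemma t_iter_u j m : t (iter j u m) = iter j u (t m) + j%:R *: iter j u m.
Proof.
elim: j => [|j IH] /=; first by rewrite scale0r addr0.
have -> : t (u (iter j u m)) = u (t (iter j u m)) + u (iter j u m) by rewrite ut subrK.
by rewrite IH linearD linearZ /= -natr1 scalerDl scale1r addrA.
Qed.

Lemma c_iter_u j m : c (iter j u m) = zeta ^+ j *: iter j u (c m).
Proof.
elim: j m => [|j IH] m /=; first by rewrite scale1r.
have z1 : zeta^-1 != 0 by rewrite invr_eq0.
by apply: (scalerI z1); rewrite -uc IH linearZ scalerA exprS mulrA mulVf // mul1r.
Qed.

Lemma ctclosed_im_d Q j : ctclosed Q -> ctclosed (fun w => exists2 z, Q z & w = iter j d z).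
Proof.
case=> hQ hc ht; split.
- split; first by exists 0; [exact: subspace0 | rewrite iter_lin0].
  + by move=> _ _ [v hv ->] [w hw ->]; exists (v + w); [exact: subspaceD | rewrite iter_linD].
  + by move=> k _ [v hv ->]; exists (k *: v); [exact: subspaceZ | rewrite iter_linZ].
- by move=> _ [v hv ->]; exists (zeta ^- j *: c v); [apply: subspaceZ => //; exact: hc | rewrite c_iter_d iter_linZ].
- move=> _ [v hv ->]; exists (t v - j%:R *: v); last first.
    by rewrite iter_linD -scaleNr iter_linZ t_iter_d scaleNr.
  by apply: subspaceB; [| exact: ht | exact: subspaceZ].
Qed.

Lemma ctclosed_im_u Q j : ctclosed Q -> ctclosed (fun w => exists2 z, Q z & w = iter j u z).
Proof.
case=> hQ hc ht; split.
- split; first by exists 0; [exact: subspace0 | rewrite iter_lin0].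
  + by move=> _ _ [v hv ->] [w hw ->]; exists (v + w); [exact: subspaceD | rewrite iter_linD].
  + by move=> k _ [v hv ->]; exists (k *: v); [exact: subspaceZ | rewrite iter_linZ].
- by move=> _ [v hv ->]; exists (zeta ^+ j *: c v); [apply: subspaceZ => //; exact: hc | rewrite c_iter_u iter_linZ].
- move=> _ [v hv ->]; exists (t v + j%:R *: v); last by rewrite t_iter_u iter_linD iter_linZ.
  by apply: subspaceD; [| exact: ht | exact: subspaceZ].
Qed.

Lemma ctclosed_pre_d Q j : ctclosed Q -> ctclosed (fun w => Q (iter j d w)).
Proof.
case=> hQ hc ht; split.
- split=> [|v w hv hw|k v hv]; first by rewrite iter_lin0; exact: subspace0.
    by rewrite iter_linD; exact: subspaceD.
  by rewrite iter_linZ; exact: subspaceZ.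
- move=> v /hc; rewrite c_iter_d; apply: subspace_scaleK => //.
  by rewrite invr_eq0 expf_neq0.
- move=> v hv; have := ht _ hv; rewrite t_iter_d => h; apply: subspace_subr h _ => //.
  exact: subspaceZ.
Qed.

Variables (x0 x1 x2 y0 y1 y2 : {poly K}).
Hypothesis hx : forall m, u (d m) = pev c x0 m + pev c x1 (t m) + pev c x2 (t (t m)).
Hypothesis hy : forall m, d (u m) = pev c y0 m + pev c y1 (t m) + pev c y2 (t (t m)).

Lemma ctclosed_ud Q m : ctclosed Q -> Q m -> Q (u (d m)).
Proof.
move=> [hQ hc ht] hm; rewrite hx.
have ev p w : Q w -> Q (pev c p w) by apply: pev_stable.
by apply: (subspaceD hQ); [apply: (subspaceD hQ)|]; apply: ev => //; do ?apply: (ht _).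
Qed.

Lemma ctclosed_du Q m : ctclosed Q -> Q m -> Q (d (u m)).
Proof.
move=> [hQ hc ht] hm; rewrite hy.
have ev p w : Q w -> Q (pev c p w) by apply: pev_stable.
by apply: (subspaceD hQ); [apply: (subspaceD hQ)|]; apply: ev => //; do ?apply: (ht _).
Qed.

Variable G : {poly K}.
Hypothesis G0 : G != 0.
(** A divisibility of [G(t)] by [y = du] in [K[c,t]] modulo a relation for [c], stated on subspaces.
    The operator [y] may fail to be injective, but its kernel is killed by a fixed nonzero
    polynomial in [t]. *)
Hypothesis star : forall Q, ctclosed Q -> forall w, Q (d (u w)) -> Q (pev t G w).

Variable m0 : M.
Definition cyc (v : M) : Prop := exists q, v = pev c q m0.
Local Notation V := cyc.
(** [K[c] m0] is simple over [K[c]], so it plays the role of a coefficient field: a relation found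
    for one nonzero [v] carries over to all of them. *)
Hypothesis irr : forall v, V v -> v <> 0 -> exists q, m0 = pev c q v.

Lemma cyc_subspace : subspace V.
Proof.
split; first by exists 0; rewrite pev0.
- by move=> _ _ [p ->] [q ->]; exists (p + q); rewrite pevDl.
- by move=> k _ [p ->]; exists (k *: p); rewrite pevZl.
Qed.
Lemma cyc_c v : V v -> V (c v).
Proof. by case=> q ->; exists ('X * q); rewrite pevM pevX. Qed.
Lemma cyc_m0 : V m0. Proof. by exists 1; rewrite pev1. Qed.

Definition mono j i v : M := iter j d (iter i t v).

Lemma mono0 j i : mono j i 0 = 0. Proof. by rewrite /mono !iter_lin0. Qed.
Lemma monoD j i v w : mono j i (v + w) = mono j i v + mono j i w.
Proof. by rewrite /mono !iter_linD. Qed.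
Lemma monoZ j i k v : mono j i (k *: v) = k *: mono j i v.
Proof. by rewrite /mono !iter_linZ. Qed.

Definition mspan (P : nat -> nat -> Prop) : M -> Prop :=
  span (fun w => exists j i v, [/\ P j i, V v & w = mono j i v]).

Lemma mspan_subspace P : subspace (mspan P). Proof. exact: span_subspace. Qed.

Lemma mspan_in (P : nat -> nat -> Prop) j i v : P j i -> V v -> mspan P (mono j i v).
Proof. by move=> h hv; apply: span_in; exists j, i, v. Qed.

Lemma mspan_min (P : nat -> nat -> Prop) Q : subspace Q ->
  (forall j i v, P j i -> V v -> Q (mono j i v)) -> forall w, mspan P w -> Q w.
Proof. by move=> hQ h; apply: span_min => // _ [j [i [v [hP hv ->]]]]; apply: h. Qed.

Lemma mspan_mono (P P' : nat -> nat -> Prop) : (forall j i, P j i -> P' j i) ->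
  forall w, mspan P w -> mspan P' w.
Proof.
move=> h; apply: mspan_min => [|j i v /h hP hv]; [exact: mspan_subspace | exact: mspan_in].
Qed.

Lemma preim_subspace (f : {linear M -> M}) Q : subspace Q -> subspace (fun w => Q (f w)).
Proof.
move=> h; split=> [|v w hv hw|k v hv].
- by rewrite linear0; exact: subspace0.
- by rewrite linearD; exact: subspaceD.
- by rewrite linearZ; exact: subspaceZ.
Qed.

Lemma mspan_c P w : mspan P w -> mspan P (c w).
Proof.
move: w; apply: mspan_min => [|j i v hP hv].
  exact: preim_subspace (mspan_subspace P).
rewrite /mono c_iter_d; apply: (subspaceZ _ (mspan_subspace P)).
have -> : c (iter i t v) = iter i t (c v) by elim: i {hP} => //= i <-; rewrite ct.
by apply: mspan_in => //; exact: cyc_c.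
Qed.

Lemma t_mono j i v : t (mono j i v) = mono j i.+1 v - j%:R *: mono j i v.
Proof. by rewrite /mono t_iter_d. Qed.

(* Exponents are compared lexicographically: [d]-degree first, then [t]-degree. *)
Definition below b e (j i : nat) : Prop := (j < b)%N \/ j = b /\ (i < e)%N.
(** Assumed only to be refuted: no leading term is absorbed by smaller monomials, as in a free
    module. *)
Definition lead_free : Prop :=
  forall b e v, V v -> mspan (below b e) (mono b e v) -> v = 0.

Definition kspan a n : M -> Prop := mspan (fun j i => j = 0%N /\ (a <= i < n)%N).

Lemma kspan_last a n w : kspan a n.+1 w -> (a <= n)%N ->
  exists2 v, V v & kspan a n (w - iter n t v).
Proof.
move=> hw han; move: w hw; apply: mspan_min.
  split; first by exists 0; [exact: (subspace0 cyc_subspace) | rewrite iter_lin0 subr0; exact: (subspace0 (mspan_subspace _))].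
  - move=> x y [v hv hx'] [w hw hy']; exists (v + w); first exact: (subspaceD cyc_subspace).
    by rewrite iter_linD opprD addrACA; apply: (subspaceD (mspan_subspace _)).
  - move=> k x [v hv hx']; exists (k *: v); first exact: (subspaceZ _ cyc_subspace).
    by rewrite iter_linZ -scalerBr; apply: (subspaceZ _ (mspan_subspace _)).
move=> j i v [-> /andP [hai]]; rewrite ltnS leq_eqVlt => /orP [/eqP -> hv|hin hv].
  by exists v => //; rewrite /mono subrr; exact: (subspace0 (mspan_subspace _)).
exists 0; first exact: (subspace0 cyc_subspace).
by rewrite iter_lin0 subr0; apply: mspan_in => //; split; rewrite ?hai.
Qed.

Lemma kspan_lead a n w : kspan a n w -> w <> 0 ->
  exists e v, [/\ (a <= e < n)%N, V v, v <> 0 & kspan a e (w - iter e t v)].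
Proof.
elim: n w => [|n IH] w hw w0.
  case: w0; move: w hw; apply: mspan_min => [|j i v [_ /andP[]] //].
  by split=> // [x y -> ->|k x ->]; rewrite ?addr0 ?scaler0.
case: (leqP a n) => han; last first.
  case: w0; move: w hw; apply: mspan_min => [|j i v [_ /andP[]] //].
    by split=> // [x y -> ->|k x ->]; rewrite ?addr0 ?scaler0.
  by move=> h1 h2; lia.
have [v hv hwv] := kspan_last hw han.
have [v0|v0] := pselect (v = 0); last by exists n, v; split=> //; rewrite han ltnSn.
move: hwv; rewrite v0 iter_lin0 subr0 => /IH /(_ w0) [e [v' [/andP [h1 h2] h3 h4 h5]]].
by exists e, v'; split=> //; rewrite h1 ltnS ltnW.
Qed.

Lemma mspan_bound P w : mspan P w -> exists B, mspan (fun j i => P j i /\ (i < B)%N) w.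
Proof.
move: w; apply: mspan_min => [|j i v hP hv]; last first.
  by exists i.+1; apply: mspan_in.
have hm B B' w : (B <= B')%N -> mspan (fun j i => P j i /\ (i < B)%N) w ->
    mspan (fun j i => P j i /\ (i < B')%N) w.
  by move=> h; apply: mspan_mono => j i [hP hi]; split=> //; exact: leq_trans h.
split; first by exists 0%N; exact: (subspace0 (mspan_subspace _)).
- move=> x y [B hB] [B' hB']; exists (maxn B B'); apply: (subspaceD (mspan_subspace _)).
    by apply: hm hB; rewrite leq_maxl.
  by apply: hm hB'; rewrite leq_maxr.
- by move=> k x [B hB]; exists B; apply: (subspaceZ _ (mspan_subspace _)).
Qed.

Definition kpoly n : M -> Prop := mspan (fun j i => j = 0%N /\ (n <= i)%N).

Lemma kpoly_kspan n w : kpoly n w -> exists e, kspan n e w.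
Proof.
move=> /mspan_bound [B hB]; exists B; apply: mspan_mono hB.
by move=> j i [[-> h1] h2]; split=> //; rewrite h1.
Qed.

Lemma kpoly_ctclosed n : ctclosed (kpoly n).
Proof.
split; [exact: mspan_subspace | by move=> m; exact: mspan_c |].
apply: mspan_min => [|j i v [-> h] hv]; first exact: preim_subspace (mspan_subspace _).
rewrite t_mono scale0r subr0; apply: mspan_in => //; split=> //.
exact: leq_trans h (leqnSn i).
Qed.

Lemma kspan_t a n i w : kspan a n w -> kspan (a + i) (n + i) (iter i t w).
Proof.
elim: i => [|i IH]; first by rewrite !addn0.
move=> /IH {IH}; rewrite iterS; move: (iter i t w).
apply: mspan_min => [|j k v [-> /andP [h1 h2]] hv]; first exact: preim_subspace (mspan_subspace _).
rewrite t_mono scale0r subr0; apply: mspan_in => //; split=> //.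
by rewrite !addnS ltnS h1.
Qed.

Lemma kspan_mono a n a' n' w : (a' <= a)%N -> (n <= n')%N -> kspan a n w -> kspan a' n' w.
Proof.
move=> h1 h2; apply: mspan_mono => j i [-> /andP [h3 h4]]; split=> //.
by rewrite (leq_trans h1 h3) (leq_trans h4 h2).
Qed.

Lemma kspan_below a n w : kspan a n w -> mspan (below 0 n) w.
Proof. by apply: mspan_mono => j i [-> /andP [_ h]]; right. Qed.

Lemma kspan_d b n w : kspan 0 n w -> mspan (below b n) (iter b d w).
Proof.
move: w; apply: mspan_min.
  split; first by rewrite iter_lin0; exact: (subspace0 (mspan_subspace _)).
  - by move=> x y hx' hy'; rewrite iter_linD; exact: (subspaceD (mspan_subspace _)).
  - by move=> k x hx'; rewrite iter_linZ; exact: (subspaceZ _ (mspan_subspace _)).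
move=> j i v [-> /andP [_ h]] hv; rewrite -[iter b d _]/(mono b i v).
by apply: mspan_in => //; right.
Qed.

Section LeadFree.
Hypothesis LF : lead_free.

(** A nonzero element with leading exponent [e] cannot also be a combination of exponents above [e],
    since its leading exponent would then be larger. *)
Lemma kpoly_cap w : (forall n, kpoly n w) -> w = 0.
Proof.
move=> h; apply: contrapT => w0.
have [n hn] := kpoly_kspan (h 0%N).
have [e [v [_ hv v0 hw]]] := kspan_lead hn w0.
have [n' hn'] := kpoly_kspan (h e.+1).
have [e' [v' [/andP [he' _] hv' v'0 hw']]] := kspan_lead hn' w0.
apply: v'0; apply: (LF (b := 0%N) (e := e') hv').
have hS := mspan_subspace (below 0 e').
rewrite -[mono 0 e' v']/(iter e' t v') -(subKr w (iter e' t v')).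
apply: (subspaceB hS); last exact: kspan_below hw'.
apply: (@subspace_subr _ _ _ _ (iter e t v) hS).
  by move: hw => /(kspan_mono (leqnn 0) (ltnW he')) /kspan_below.
by apply: (mspan_in (j := 0%N)) => //; right.
Qed.

(** The leading exponent of [g(t) z] is the sum of the degree of [g] and the leading exponent of
    [z]. *)
Lemma kpoly_torsionfree g z : g != 0 -> kpoly 0 z -> pev t g z = 0 -> z = 0.
Proof.
move=> g0 /kpoly_kspan [n hn] hz; apply: contrapT => z0.
have [e [v [_ hv v0 hw]]] := kspan_lead hn z0.
have zS : kspan 0 e.+1 z.
  apply: (subspace_subr (mspan_subspace _) (kspan_mono (leqnn 0) (leqnSn e) hw)).
  by apply: (mspan_in (j := 0%N)) => //; split=> //=.
have sg : (0 < size g)%N by rewrite size_poly_gt0.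
pose k := (size g).-1.
have lc0 : g`_k != 0 by rewrite -[g`_k]/(lead_coef g) lead_coef_eq0.
have : g`_k *: iter k t z = - \sum_(i < k) g`_i *: iter i t z.
  have e1 : pev t g z = \sum_(i < k) g`_i *: iter i t z + g`_k *: iter k t z.
    by rewrite /pev /polyact (_ : size g = k.+1) ?big_ord_recr // /k prednK.
  by apply/eqP; rewrite -addr_eq0 addrC -e1 hz.
move=> e1; apply: v0; apply: (LF (b := 0%N) (e := (e + k)%N) hv).
have hS := mspan_subspace (below 0 (e + k)).
have -> : mono 0 (e + k) v = iter k t z - iter k t (z - iter e t v).
  by rewrite iter_linB opprB addrC subrK /mono /= addnC iterD.
apply: (subspaceB hS); last by move: hw => /(@kspan_t 0 e k) /kspan_below.
apply: (subspace_scaleK hS lc0); rewrite e1.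
apply: (subspaceN hS); apply: subspace_sum => // i _; apply: (subspaceZ _ hS).
apply: (@kspan_below 0); apply: kspan_mono (@kspan_t 0 _ i _ zS) => //.
by have := ltn_ord i; lia.
Qed.

Lemma d_pow_free b w : kpoly 0 w -> mspan (fun j i => (j < b)%N) (iter b d w) -> w = 0.
Proof.
move=> /kpoly_kspan [n hn] hb; apply: contrapT => w0.
have [e [v [_ hv v0 hw]]] := kspan_lead hn w0.
apply: v0; apply: (LF (b := b) (e := e) hv).
have hS := mspan_subspace (below b e).
have -> : mono b e v = iter b d w - iter b d (w - iter e t v).
  by rewrite iter_linB opprB addrC subrK.
apply: (subspaceB hS); last exact: kspan_d.
by apply: mspan_mono hb => j i; left.
Qed.

Lemma kpoly_d j w : kpoly 0 w -> mspan (fun j' i => j' = j) (iter j d w).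
Proof.
move: w; apply: mspan_min.
  split; first by rewrite iter_lin0; exact: (subspace0 (mspan_subspace _)).
  - by move=> x y hx' hy'; rewrite iter_linD; exact: (subspaceD (mspan_subspace _)).
  - by move=> k x hx'; rewrite iter_linZ; exact: (subspaceZ _ (mspan_subspace _)).
by move=> j' i v [-> _] hv; rewrite -[iter j d _]/(mono j i v); apply: mspan_in.
Qed.

Lemma d_sum_free N (f : nat -> M) : (forall k, kpoly 0 (f k)) ->
  \sum_(k < N) iter k d (f k) = 0 -> forall k, (k < N)%N -> f k = 0.
Proof.
move=> hf; elim: N => [|N IH] //; rewrite big_ord_recr /= => e.
have fN : f N = 0.
  apply: (d_pow_free (b := N) (hf N)).
  have -> : iter N d (f N) = - \sum_(k < N) iter k d (f k).
    by apply/eqP; rewrite -addr_eq0 addrC e.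
  apply: (subspaceN (mspan_subspace _)); apply: subspace_sum => [|i _]; first exact: mspan_subspace.
  by move: (@kpoly_d i _ (hf i)); apply: mspan_mono => j k ->.
move: e; rewrite fN iter_lin0 addr0 => /IH h k.
by rewrite ltnS leq_eqVlt => /orP [/eqP -> //|/h].
Qed.

Lemma ctclosed_d_u Q j z : ctclosed Q -> Q z -> Q (iter j d (iter j u z)).
Proof.
move=> hQ; elim: j z => [|j IH] z hz //.
have [z' hz' e] := ctclosed_du (ctclosed_im_u j hQ) (ex_intro2 _ _ z hz erefl : exists2 z', Q z' & iter j u z = iter j u z').
by rewrite iterSr iterS e; apply: IH.
Qed.

Lemma pev_iter_u j p z : pev t p (iter j u z) = iter j u (pev t (p \Po ('X + j%:R%:P)) z).
Proof.
elim/poly_ind: p z => [|p a IH] z; first by rewrite comp_poly0 !pev0 iter_lin0.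
rewrite comp_polyD comp_polyM comp_polyX comp_polyC !pevDl !pevM !pevC pevX iter_linD iter_linZ.
by rewrite t_iter_u -iter_linZ -iter_linD IH pevDl pevX pevC.
Qed.

(** The innermost [du] is removed by [star], applied to the kernel of [d^j], at the cost of a factor
    [G(t)]. Moved across [u^j] it becomes [G(t + j)], which is harmless because [K[t] V] is
    torsion-free. *)
Lemma d_u_injective j z : kpoly 0 z -> iter j d (iter j u z) = 0 -> z = 0.
Proof.
elim: j z => [|j IH] z hz //; rewrite iterSr iterS => e.
have h0 : ctclosed (fun w : M => w = 0).
  split; first by split=> // [x y -> ->|k x ->]; rewrite ?addr0 ?scaler0.
    by move=> m ->; rewrite linear0.
  by move=> m ->; rewrite linear0.
have := star (ctclosed_pre_d j h0) e; rewrite pev_iter_u => /IH.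
case: (kpoly_ctclosed 0) => hs hc ht /(_ (pev_stable _ hs ht hz)).
apply: kpoly_torsionfree => //.
by rewrite -size_poly_eq0 size_comp_poly2 ?size_poly_eq0 // size_XaddC.
Qed.

(** Pure powers suffice for a submodule: in a mixed word [ud] and [du] lie in [K[c,t]] and move
    across the remaining power into [t^n K[t] V]. *)
Definition yspan n : M -> Prop :=
  span (fun w => exists j z, kpoly n z /\ (w = iter j d z \/ w = iter j u z)).

Lemma yspan_d n w : yspan n w -> yspan n (d w).
Proof.
move: w; apply: span_min => [|_ [j [z [hz [->|->]]]]].
- exact: preim_subspace (span_subspace _).
- by apply: span_in; exists j.+1, z; split=> //; left.
case: j => [|j]; first by apply: span_in; exists 1%N, z; split=> //; left.
have [z' hz' e] := ctclosed_du (ctclosed_im_u j (kpoly_ctclosed n)) (ex_intro2 _ _ z hz erefl : exists2 z', kpoly n z' & iter j u z = iter j u z').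
by rewrite iterS e; apply: span_in; exists j, z'; split=> //; right.
Qed.

Lemma yspan_u n w : yspan n w -> yspan n (u w).
Proof.
move: w; apply: span_min => [|_ [j [z [hz [->|->]]]]].
- exact: preim_subspace (span_subspace _).
- case: j => [|j]; first by apply: span_in; exists 1%N, z; split=> //; right.
  have [z' hz' e] := ctclosed_ud (ctclosed_im_d j (kpoly_ctclosed n)) (ex_intro2 _ _ z hz erefl : exists2 z', kpoly n z' & iter j d z = iter j d z').
  by rewrite iterS e; apply: span_in; exists j, z'; split=> //; left.
by apply: span_in; exists j.+1, z; split=> //; right.
Qed.

Lemma yspan_d_power n w : yspan n w -> exists B, forall e, power_span d (kpoly n) (iter (e + B) d w).
Proof.
have hS := span_subspace (fun w => exists j z, kpoly n z /\ w = iter j d z).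
move: w; apply: span_min => [|_ [j [z [hz [->|->]]]]].
- split.
  + by exists 0%N => e; rewrite iter_lin0; exact: (subspace0 hS).
  + move=> x y [B hB] [B' hB']; exists (B + B')%N => e; rewrite iter_linD; apply: (subspaceD hS).
      by rewrite [(B + _)%N]addnC addnA; exact: hB.
    by rewrite addnA; exact: hB'.
  + by move=> k x [B hB]; exists B => e; rewrite iter_linZ; apply: (subspaceZ _ hS); exact: hB.
- by exists 0%N => e; rewrite -iterD; exact: power_span_in.
- exists j => e; rewrite iterD; apply: power_span_in.
  exact: (ctclosed_d_u j (kpoly_ctclosed n) hz).
Qed.

Lemma power_sum_shift (T : {linear M -> M}) e N (f : nat -> M) :
  iter e T (\sum_(k < N) iter k T (f k)) = \sum_(k < N) iter (k + e) T (f k).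
Proof.
elim: N => [|N IH]; first by rewrite !big_ord0 iter_lin0.
by rewrite !big_ord_recr iter_linD IH -iterD addnC.
Qed.

Lemma yspan_split w : yspan 0 w -> exists a b,
  [/\ w = a + b, power_span d (kpoly 0) a & power_span u (fun x => exists2 z, kpoly 0 z & x = u z) b].
Proof.
move: w; apply: span_min => [|_ [j [z [hz [->|->]]]]].
- split.
  + by exists 0, 0; split; rewrite ?addr0 //; exact: (subspace0 (span_subspace _)).
  + move=> _ _ [a [b [-> ha hb]]] [a' [b' [-> ha' hb']]]; exists (a + a'), (b + b').
    by split; [rewrite addrACA | exact: (subspaceD (span_subspace _)) | exact: (subspaceD (span_subspace _))].
  + move=> k _ [a [b [-> ha hb]]]; exists (k *: a), (k *: b).
    by split; [rewrite scalerDr | exact: (subspaceZ _ (span_subspace _)) | exact: (subspaceZ _ (span_subspace _))].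
- exists (iter j d z), 0; split; rewrite ?addr0 //; last exact: (subspace0 (span_subspace _)).
  exact: power_span_in.
- case: j => [|j].
    exists z, 0; split; rewrite ?addr0 //; last exact: (subspace0 (span_subspace _)).
    exact: (@power_span_in _ _ d (kpoly 0) 0%N z hz).
  exists 0, (iter j.+1 u z); split; rewrite ?add0r //; first exact: (subspace0 (span_subspace _)).
  by rewrite iterSr; apply: power_span_in; exists z.
Qed.

(* An element of every [yspan n] vanishes: after multiplication by a power of [d], its
   [K[t]]-coefficients on the powers of [d] are divisible by every power of [t]. *)
Lemma yspan_cap w : (forall n, yspan n w) -> w = 0.
Proof.
move=> hw; have [a [b [ew ha hb]]] := yspan_split (hw 0%N).
have kS n : subspace (kpoly n) by case: (kpoly_ctclosed n).
have uS : subspace (fun x => exists2 z, kpoly 0 z & x = u z).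
  by case: (ctclosed_im_u 1 (kpoly_ctclosed 0)).
have [Na [f [hf hNa ea]]] := power_span_sum (kS 0%N) ha.
have [Nb [g [hg hNb eb]]] := power_span_sum uS hb.
pose N := maxn Na Nb.
have f0 k : (N <= k)%N -> f k = 0 by rewrite geq_max => /andP [/hNa].
have g0 k : (N <= k)%N -> g k = 0 by rewrite geq_max => /andP [_ /hNb].
rewrite -(power_sum_pad d hNa (leq_maxl Na Nb)) -/N in ea.
rewrite -(power_sum_pad u hNb (leq_maxr Na Nb)) -/N in eb.
(* The coefficient of [d^k] in [d^N w]. A term [u^j z] with [j = N - k] contributes through
   [d^N u^j z = d^k (d^j u^j z)], the inner vector lying in [K[t] V]; the [d]-part of [w] is just
   shifted by [N]. *)
pose h k := if (k < N)%N then iter (N - k) d (iter (N - k).-1 u (g (N - k).-1)) else f (k - N)%N.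
have hh k : kpoly 0 (h k).
  rewrite /h; case: (ltnP k N) => hk //; have [z hz ->] := hg (N - k).-1.
  by rewrite -iterSr prednK ?subn_gt0 //; exact: (ctclosed_d_u _ (kpoly_ctclosed 0)).
have e1 : iter N d w = \sum_(k < N + N) iter k d (h k).
  rewrite big_split_ord /= ew iter_linD [LHS]addrC; congr (_ + _).
    rewrite eb (reindex_inj rev_ord_inj) /=.
    rewrite (big_morph (iter N d) (iter_linD d N) (iter_lin0 d N)); apply: eq_bigr => k _.
    rewrite /h; have hk := ltn_ord k; rewrite ifT; last by lia.
    have -> : ((N - k).-1 = N - k.+1)%N by lia.
    by rewrite -[in RHS]iterD subnKC // ltnW.
  rewrite ea power_sum_shift; apply: eq_bigr => k _.
  by rewrite /h ifN; [rewrite addKn addnC | rewrite -leqNgt leq_addr].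
(* [d^(N+B) w] has one expansion with coefficients in [t^n K[t] V] and another with the shifted [h];
   uniqueness of coefficients identifies them. *)
have h_n n k : kpoly n (h k).
  case: (ltnP k (N + N)) => hk; last first.
    rewrite /h ifN; last by rewrite -leqNgt; lia.
    by rewrite f0; [exact: (subspace0 (kS n)) | lia].
  have [B hB] := yspan_d_power (hw n).
  have [m [f' [hf' hm e2]]] := power_span_sum (kS n) (hB N).
  have e3 : iter (N + B) d w = \sum_(k < N + N) iter (k + B) d (h k).
    by rewrite addnC iterD e1 power_sum_shift.
  pose Q := maxn m (N + N + B).
  rewrite e3 -(power_sum_pad d hm (leq_maxl m (N + N + B))) -/Q in e2.
  pose h' k := if (B <= k)%N then h (k - B)%N else 0.
  have h'0 j : (N + N + B <= j)%N -> h' j = 0.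
    move=> hj; rewrite /h' ifT; last by lia.
    by rewrite /h ifN; [rewrite f0 //; lia | rewrite -leqNgt; lia].
  have e4 : \sum_(k < N + N) iter (k + B) d (h k) = \sum_(k < Q) iter k d (h' k).
    rewrite (power_sum_pad d h'0) ?leq_maxr // (addnC (N + N)%N B) [RHS]big_split_ord /=.
    rewrite [X in _ = X + _]big1 ?add0r; last by move=> i _; rewrite /h' leqNgt ltn_ord iter_lin0.
    by apply: eq_bigr => i _; rewrite /h' leq_addr addKn addnC.
  have h'k j : kpoly 0 (h' j) by rewrite /h'; case: ifP => _ //; exact: (subspace0 (kS 0%N)).
  have f'k j : kpoly 0 (f' j) by apply: mspan_mono (hf' j) => j' i [-> _].
  have e5 : \sum_(k < Q) iter k d (f' k - h' k) = 0.
    rewrite (eq_bigr (fun k : 'I_Q => iter k d (f' k) - iter k d (h' k))); last by move=> i _; rewrite iter_linB.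
    by rewrite big_split sumrN /= -e2 e4 subrr.
  have := d_sum_free (fun j => subspaceB (kS 0%N) (f'k j) (h'k j)) e5 (k := (k + B)%N).
  have -> : (k + B < Q)%N by rewrite leq_max; apply/orP; right; lia.
  by move=> /(_ isT) /subr0_eq; rewrite /h' leq_addl addnK => <-.
have hz k : h k = 0 by apply: kpoly_cap.
rewrite ew ea eb !big1 ?addr0 // => k _; have hk := ltn_ord k.
- have [z hz' ez] := hg k; rewrite ez -iterSr; have := hz (N - k.+1)%N.
  rewrite /h ifT; last by lia.
  have -> : (N - (N - k.+1) = k.+1)%N by lia.
  rewrite /= ez -iterS -iterSr => /(@d_u_injective k.+1) -> //; rewrite iter_lin0 linear0 //.
- have := hz (N + k)%N; rewrite /h ifN; last by rewrite -leqNgt leq_addr.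
  by rewrite addKn => ->; rewrite iter_lin0.
Qed.
End LeadFree.

Definition du_submodule (X : M -> Prop) : Prop :=
  [/\ subspace X, forall m, X m -> X (d m) & forall m, X m -> X (u m)].

Variable s0 : M.
Hypothesis s00 : s0 <> 0.
Hypothesis s0_min : forall X, du_submodule X -> (exists2 x, X x & x <> 0) -> X s0.
Hypothesis m00 : m0 <> 0.

(** Under freeness every [yspan n] is nonzero, as it contains [t^n m0], hence contains [s0]; but
    these submodules meet in 0. *)
Lemma not_lead_free : exists b e v, [/\ V v, v <> 0 & mspan (below b e) (mono b e v)].
Proof.
apply: contrapT => h.
have LF : lead_free.
  by move=> b e v hv hm; apply: contrapT => v0; apply: h; exists b, e, v.
apply: s00; apply: (yspan_cap LF) => n.
apply: s0_min; first by split; [exact: span_subspace | exact: yspan_d | exact: yspan_u].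
exists (iter n t m0).
  apply: span_in; exists 0%N, (iter n t m0); split; last by left.
  by rewrite -[iter n t m0]/(mono 0 n m0); apply: mspan_in; [split | exact: cyc_m0].
move=> e; apply: m00; apply: (LF 0%N n _ cyc_m0).
by rewrite -[mono 0 n m0]/(iter n t m0) e; exact: (subspace0 (mspan_subspace _)).
Qed.

Lemma iter_d_pev j p z : iter j d (pev t p z) = pev t (p \Po ('X + j%:R%:P)) (iter j d z).
Proof.
elim/poly_ind: p z => [|p a IH] z; first by rewrite comp_poly0 !pev0 iter_lin0.
rewrite comp_polyD comp_polyM comp_polyX comp_polyC !pevDl !pevM !pevC pevX iter_linD iter_linZ.
by rewrite IH pevDl pevX pevC t_iter_d subrK.
Qed.

Lemma pev_iter_d j p z : pev t p (iter j d z) = iter j d (pev t (p \Po ('X - j%:R%:P)) z).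
Proof.
rewrite iter_d_pev -comp_polyA comp_polyB comp_polyX comp_polyC addrK.
by rewrite comp_polyXr.
Qed.

Lemma u_mono j i v : V v ->
  mspan (fun j' i' => j' = j /\ (i' <= i + 2)%N) (u (mono j.+1 i v)).
Proof.
move=> hv; have -> : u (mono j.+1 i v) = u (d (mono j i v)) by [].
set P := fun _ _ => _; have hS := mspan_subspace P.
have h0 k : (k <= i + 2)%N -> mspan P (mono j k v) by move=> hk; apply: mspan_in.
have h1 : mspan P (t (mono j i v)).
  by rewrite t_mono; apply: (subspaceB hS); [|apply: (subspaceZ _ hS)]; apply: h0; lia.
have h2 : mspan P (t (t (mono j i v))).
  rewrite t_mono linearB linearZ /= !t_mono; apply: (subspaceB hS); last apply: (subspaceZ _ hS).
    by apply: (subspaceB hS); [|apply: (subspaceZ _ hS)]; apply: h0; lia.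
  by apply: (subspaceB hS); [|apply: (subspaceZ _ hS)]; apply: h0; lia.
have h3 p w : mspan P w -> mspan P (pev c p w).
  by move=> hw; apply: (pev_stable p hS) => // x; exact: mspan_c.
by rewrite hx; do 2?apply: (subspaceD hS); apply: h3 => //; apply: h0; lia.
Qed.

(** Weighted degree with [t] of weight 1 and [d] of weight [D]; [D] stays free so that it can exceed
    the [t]-exponents of the rewriting rule. *)
Definition filt D n : M -> Prop := mspan (fun j i => (i + D * j <= n)%N).

Lemma filt_d D n w : filt D n w -> filt D (n + D) (d w).
Proof.
move: w; apply: mspan_min => [|j i v h hv]; first exact: preim_subspace (mspan_subspace _).
by apply: (mspan_in (j := j.+1)) => //=; rewrite mulnS; lia.
Qed.

Section Reduction.
Variables (b e B : nat).
Hypothesis lead : forall v, V v -> mspan (fun j i => below b e j i /\ (i < B)%N) (mono b e v).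

Definition reduced n : M -> Prop :=
  mspan (fun j i => [/\ (i <= n)%N, (j <= n)%N & (j < b)%N \/ (i < e)%N]).

(** Every monomial divisible by the leading one is rewritten, recursing on the lexicographic order.
    Weight does not grow: a drop in the power of [d] saves at least [D], while the power of [t]
    rises by less than [B], which is at most [D]. *)
Lemma filt_reduced D n w : (0 < D)%N -> (B <= D)%N -> filt D n w -> reduced n w.
Proof.
move=> D0 BD; have hS : subspace (reduced n) by exact: mspan_subspace.
suff main j : forall i v, V v -> (i + D * j <= n)%N -> reduced n (mono j i v).
  by move: w; apply: mspan_min => // j i v h hv; exact: main.
elim/ltn_ind: j => j IHj i; elim/ltn_ind: i => i IHi v hv hn.
have hj : (j <= D * j)%N by rewrite leq_pmull.
case: (ltnP j b) => [hjb|hbj].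
  by apply: mspan_in => //; split; [lia | lia | left].
case: (ltnP i e) => [hie|hei].
  by apply: mspan_in => //; split; [lia | lia | right].
pose s := (j - b)%N; pose r := (i - e)%N.
(* [d^j t^i v = d^s (t + b)^r d^b t^e v], because [d t = (t + 1) d]. *)
pose p : {poly K} := 'X^r \Po ('X + b%:R%:P).
have -> : mono j i v = iter s d (pev t p (mono b e v)).
  by rewrite /p -iter_d_pev pevXn /mono -!iterD !subnK.
have sp : size p = r.+1 by rewrite size_comp_poly2 ?size_XaddC // size_polyXn.
move: (lead hv); move: (mono b e v).
apply: mspan_min => [|j' i' v' [hP hB] hv'].
  have hpre := preim_subspace (pev t p) (_ : subspace (fun w => reduced n (iter s d w))).
  apply: hpre; split; first by rewrite iter_lin0; exact: subspace0 hS.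
  - by move=> x y hx' hy'; rewrite iter_linD; exact: (subspaceD hS).
  - by move=> k x hx'; rewrite iter_linZ; exact: (subspaceZ _ hS).
rewrite /mono pev_iter_d /pev /polyact.
have sp' : size (p \Po ('X - j'%:R%:P)) = r.+1 by rewrite size_comp_poly2 ?size_XsubC.
rewrite sp' (big_morph (iter j' d) (iter_linD d j') (iter_lin0 d j')).
rewrite (big_morph (iter s d) (iter_linD d s) (iter_lin0 d s)).
apply: subspace_sum => // -[l hl] _; rewrite !iter_linZ; apply: (subspaceZ _ hS).
rewrite -!iterD -[iter _ d _]/(mono (s + j') (l + i') v').
case: hP => [hj'|[ej hi']].
  apply: IHj => //; first by rewrite /s; lia.
  have hDj : (D * (s + j') + D <= D * j)%N by rewrite -mulnSr leq_mul2l; apply/orP; right; rewrite /s; lia.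
  move: hDj hn; rewrite /r in hl; set X1 := (D * (s + j'))%N; set X2 := (D * j)%N.
  by move=> h1 h2; lia.
have -> : (s + j' = j)%N by rewrite ej /s subnK.
by apply: IHi => //; move: hl; rewrite /r; lia.
Qed.

Variable eV : seq M.
Hypothesis heV : forall v, V v -> addspan (fun x => x = 0) eV v.

Lemma mspan_list (P : nat -> nat -> Prop) (L : seq (nat * nat)) w :
  (forall j i, P j i -> (j, i) \in L) -> mspan P w ->
  addspan (fun x => x = 0) [seq mono ji.1 ji.2 v | ji <- L, v <- eV] w.
Proof.
move=> hL; have h0 : subspace (fun x : M => x = 0).
  by split=> // [x y -> ->|k x ->]; rewrite ?addr0 ?scaler0.
set S := addspan _ _; have hS : subspace S by exact: addspan_subspace.
move: w; apply: mspan_min => // j i v /hL hP /heV.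
move: v; apply: addspan_min.
- split; first by rewrite mono0; exact: subspace0 hS.
  + by move=> x y hx' hy'; rewrite monoD; exact: subspaceD hS hx' hy'.
  + by move=> k x hx'; rewrite monoZ; exact: subspaceZ _ hS hx'.
- by move=> x ->; rewrite mono0; exact: subspace0 hS.
- move=> x hx'; apply: addspan_mem => //.
  by apply/allpairsP; exists ((j, i), x).
Qed.

(** The surviving exponents lie in two strips of widths [b] and [e] and of length [n + 1]. *)
Lemma reduced_list n : exists2 L, (size L <= (b + e) * size eV * n.+1)%N &
  forall w, reduced n w -> addspan (fun x => x = 0) L w.
Proof.
pose L := [seq (j, i) | j <- iota 0 b, i <- iota 0 n.+1] ++ [seq (j, i) | j <- iota 0 n.+1, i <- iota 0 e].
exists [seq mono ji.1 ji.2 v | ji <- L, v <- eV].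
  by rewrite size_allpairs size_cat !size_allpairs !size_iota [(n.+1 * e)%N]mulnC -mulnDl mulnAC.
move=> w; apply: mspan_list => j i [hi hj h].
rewrite mem_cat; apply/orP; case: h => h; [left | right].
all: by apply/allpairsP; exists (j, i); rewrite !mem_iota /= add0n ?ltnS.
Qed.

End Reduction.

Variable p0 : {poly K}.
Hypothesis p00 : p0 != 0.
Hypothesis p0c : pev c p0 m0 = 0.

Lemma cyc_list v : V v -> addspan (fun x => x = 0) [seq iter l c m0 | l <- iota 0 (size p0)] v.
Proof.
have h0 : subspace (fun x : M => x = 0).
  by split=> // [x y -> ->|k x ->]; rewrite ?addr0 ?scaler0.
move=> [q ->]; rewrite (divp_eq q p0) pevDl pevM p0c linear0 add0r.
apply: subspace_sum => [|l _]; first exact: addspan_subspace.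
apply: subspaceZ; first exact: addspan_subspace.
apply: addspan_mem => //; apply/mapP; exists (l : nat) => //.
rewrite mem_iota add0n /=; apply: leq_trans (ltn_ord l) _.
by apply/ltnW; rewrite ltn_modp.
Qed.

(** The relation for a single [v] gives a rule for all of [V], since [v] generates [V] and [c]
    crosses monomials up to nonzero scalars. The slope [E] does not depend on [D], so one [D] can
    later be chosen for several generators. *)
Lemma filt_growth : exists D0 E, forall D n, (D0 <= D)%N -> exists2 L, (size L <= E * n.+1)%N &
  forall w, filt D n w -> addspan (fun x => x = 0) L w.
Proof.
have [b [e [v [hv v0 /mspan_bound [B hB]]]]] := not_lead_free.
have lead v' : V v' -> mspan (fun j i => below b e j i /\ (i < B)%N) (mono b e v').
  have hS := mspan_subspace (fun j i => below b e j i /\ (i < B)%N).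
  move: hB hS; set P := mspan _ => hB hS hv'.
  have [q hq] := irr hv v0; case: hv' => q' ->; rewrite hq -pevM.
  apply: (pev_stable (X := fun w => P (mono b e w))) hB.
    split; first by rewrite mono0; exact: subspace0 hS.
    - by move=> x y hx' hy'; rewrite monoD; exact: subspaceD hS hx' hy'.
    - by move=> k x hx'; rewrite monoZ; exact: subspaceZ _ hS hx'.
  move=> x /mspan_c; rewrite /mono c_iter_d => /(subspace_scaleK hS).
  have -> : c (iter e t x) = iter e t (c x) by elim: (e) => //= k <-; rewrite ct.
  by apply; rewrite invr_eq0 expf_neq0.
exists (maxn 1 B), ((b + e) * size [seq iter l c m0 | l <- iota 0 (size p0)])%N.
move=> D n; rewrite geq_max => /andP [D0 BD].
have [L hL hw] := reduced_list b e cyc_list n.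
by exists L => // w /(filt_reduced lead D0 BD); exact: hw.
Qed.
End OneSided.

(** * From linear growth to finite codimension along chains *)

Section Growth.
Variables (K : fieldType) (alpha beta gamma : K) (M : DUModule alpha beta gamma).
Implicit Types (X Y : M -> Prop).
Local Notation d := (dum_d M).
Local Notation u := (dum_u M).
Local Notation zero := (fun m : M => m = 0).
Hypothesis hacc : acc M.

(** Strict inclusions below [C i0] supply vectors of [C i0] independent modulo a later member of the
    chain, and there can be at most [size e] of them. *)
Lemma bounded_codim_stable (C : nat -> M -> Prop) i0 e : (forall n, is_submodule (C n)) ->
  (forall n x, C n.+1 x -> C n x) ->
  (forall j, (i0 <= j)%N -> forall x, C i0 x -> addspan (C j) e x) ->
  exists N, forall n, (N <= n)%N -> forall x, C N x -> C n x.
Proof.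
move=> hC hmono he; apply: contrapT => h.
have step i : exists j x, [/\ (i <= j)%N, C i x & ~ C j x].
  apply: contrapT => h1; apply: h; exists i => j hij x hx; apply: contrapT => hjx.
  by apply: h1; exists j, x.
have long l i : exists j, (i <= j)%N /\ exists2 L, size L = l &
    freemod (C j) L /\ forall x, x \in L -> C i x.
  elim: l i => [|l IH] i; first by exists i; split=> //; exists [::].
  have [j1 [x [hij hx hjx]]] := step i.
  have [j [hj [L hL [hf hLC]]]] := IH j1; exists j; split; first exact: leq_trans hj.
  exists (L ++ [:: x]); first by rewrite size_cat hL addn1.
  split; last first.
    move=> z; rewrite mem_cat inE => /orP [/hLC|/eqP -> //].
    exact: desc_mono hmono _ _ hij z.
  have hs := submodule_subspace (hC j1).
  by apply: freemod_cat hs _ hLC hf _ => // z; exact: desc_mono hmono _ _ hj z.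
have [j [hj [L hL [hf hLC]]]] := long (size e).+1 i0.
have := freemod_size (submodule_subspace (hC j)) hf (fun v hv => he j hj v (hLC v hv)).
by rewrite hL ltnn.
Qed.

Section Words.
Variable s : seq M.
Fixpoint words n : M -> Prop :=
  if n is n'.+1 then
    span (fun w => words n' w \/ exists2 w', words n' w' & w = d w' \/ w = u w')
  else span (fun w => w \in s).

Lemma wordsS n w : words n w -> words n.+1 w.
Proof. by move=> h; apply: span_in; left. Qed.
Lemma words0 n w : w \in s -> words n w.
Proof. by move=> h; elim: n => [|n IH]; [exact: span_in | exact: wordsS]. Qed.

Lemma words_free X n : is_submodule X -> ~ fincodim X (generated (fun w => w \in s)) ->
  exists2 L, size L = n & freemod X L /\ forall w, w \in L -> words n w.
Proof.
move=> hX hinf; have hXs := submodule_subspace hX.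
elim: n => [|n [L hL [hf hLw]]]; first by exists [::].
have [w hw hn] : exists2 w, words n.+1 w & ~ addspan X L w.
  apply: contrapT => h; apply: hinf; exists L => y.
  have hS := addspan_subspace L hXs.
  have hin w : words n.+1 w -> addspan X L w.
    by move=> hw; apply: contrapT => hn; apply: h; exists w.
  move=> hy; apply: hy => [|x hx]; last exact/hin/words0.
  apply/submoduleP; split=> //.
    apply: (@addspan_min _ _ X L (fun m => addspan X L (d m))) => [|x hx|x /hLw hx]; first exact: preim_subspace hS.
      by apply: addspan_sub => //; exact: submodule_d hX hx.
    by apply: hin; apply: span_in; right; exists x => //; left.
  apply: (@addspan_min _ _ X L (fun m => addspan X L (u m))) => [|x hx|x /hLw hx]; first exact: preim_subspace hS.
    by apply: addspan_sub => //; exact: submodule_u hX hx.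
  by apply: hin; apply: span_in; right; exists x => //; right.
exists (rcons L w); first by rewrite size_rcons hL.
split; first exact: freemod_rcons.
by move=> z; rewrite mem_rcons inE => /orP [/eqP -> //|/hLw]; exact: wordsS.
Qed.
End Words.

Variables (F : nat -> M -> Prop) (E D : nat).
Hypothesis Fs : forall n, subspace (F n).
Hypothesis Fmono : forall n w, F n w -> F n.+1 w.
Hypothesis Fd : forall n w, F n w -> F (n + D)%N (d w).
Hypothesis Fu : forall n w, F n w -> F (n + D)%N (u w).
Hypothesis Fall : forall w, exists n, F n w.
Hypothesis Flist : forall n, exists2 L, (size L <= E * n.+1)%N &
  forall w, F n w -> addspan zero L w.

Lemma words_filt s k n w : (forall v, v \in s -> F k v) -> words s n w -> F (k + n * D)%N w.
Proof.
move=> hs; elim: n w => [|n IH] w /=; first by rewrite mul0n addn0; apply: span_min.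
apply: span_min => // x [/IH hx|[x' /IH hx' hx]].
  by apply: (chain_mono Fmono) hx; rewrite mulSn; lia.
have -> : (k + n.+1 * D = k + n * D + D)%N by rewrite mulSn; lia.
by case: hx => ->; [exact: Fd | exact: Fu].
Qed.

(* Each infinite-codimensional step of a chain costs at least [n] dimensions out of
   a linearly growing total. *)
Lemma growth_chain (C : nat -> M -> Prop) : (forall n, is_submodule (C n)) ->
  (forall n x, C n.+1 x -> C n x) ->
  exists i0, forall j, (i0 <= j)%N -> fincodim (C j) (C i0).
Proof.
move=> hC hmono; apply: contrapT => h.
have step i : exists j, (i <= j)%N /\ ~ fincodim (C j) (C i).
  apply: contrapT => h1; apply: h; exists i => j hij; apply: contrapT => hjx.
  by apply: h1; exists j.
have gen i j : ~ fincodim (C j) (C i) -> exists c, forall n, exists2 L, size L = n &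
    [/\ freemod (C j) L, forall x, x \in L -> C i x & forall x, x \in L -> F (c + n * D)%N x].
  move=> hij; have [s [hsC hgen]] := @acc_fin_generated _ _ _ _ _ (C i) hacc.
  have [c hc] : exists c, forall v, v \in s -> F c v.
    elim: (s) => [|v s' [c hc]]; first by exists 0%N.
    have [k hk] := Fall v; exists (maxn c k) => w; rewrite inE => /orP [/eqP ->|/hc].
      by apply: (chain_mono Fmono _ hk); rewrite leq_maxr.
    by apply: (chain_mono Fmono); rewrite leq_maxl.
  exists c => n; have [|L hL [hf hw]] := words_free (s := s) n (hC j).
    move=> [e he]; apply: hij; exists e => y hy; apply: he => X hX hXs.
    exact: hgen hX hXs _ hy.
  exists L => //; split=> // x /hw; last exact: words_filt.
  move: x; elim: (n) => [|k IH] x /=.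
    by apply: span_min => //; exact: submodule_subspace (hC i).
  apply: span_min => [|y [/IH //|[y' /IH hy' [->|->]]]]; first exact: submodule_subspace (hC i).
    exact: submodule_d (hC i) hy'.
  exact: submodule_u (hC i) hy'.
have long l i : exists j c, (i <= j)%N /\ forall n, exists2 L, size L = (l * n)%N &
    [/\ freemod (C j) L, forall x, x \in L -> C i x & forall x, x \in L -> F (c + n * D)%N x].
  elim: l i => [|l IH] i; first by exists i, 0%N; split=> // n; exists [::].
  have [j1 [hij /gen [c1 h1]]] := step i.
  have [j [c [hj h2]]] := IH j1; exists j, (maxn c c1); split; first exact: leq_trans hj.
  move=> n; have [L1 hL1 [hf1 hC1 hF1]] := h1 n; have [L2 hL2 [hf2 hC2 hF2]] := h2 n.
  exists (L2 ++ L1); first by rewrite size_cat hL1 hL2 mulSn addnC.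
  split.
  - have hs := submodule_subspace (hC j1).
    by apply: freemod_cat hs _ hC2 hf2 hf1 => z; exact: desc_mono hmono _ _ hj z.
  - move=> z; rewrite mem_cat => /orP [/hC2|/hC1 //]; exact: desc_mono hmono _ _ hij z.
  - move=> z; rewrite mem_cat => /orP [/hF2|/hF1]; apply: (chain_mono Fmono).
      by rewrite leq_add2r leq_maxl.
    by rewrite leq_add2r leq_maxr.
have [j [c [_ hL]]] := long (E * D).+1 0%N.
(* [(E D + 1) n] independent vectors sit in a space of dimension at most [E (c + n D + 1)]; this [n]
   is the first to exceed [E (c + 1)], which is absurd. *)
pose n := (E * c.+1).+1.
have [L szL [hf _ hF]] := hL n.
have [L' szL' hL'] := Flist (c + n * D).
have hfz : freemod zero L.
  by apply: freemod_anti hf => x ->; exact: subspace0 (submodule_subspace (hC j)).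
have := freemod_size (zero_subspace M) hfz (fun v hv => hL' v (hF v hv)).
rewrite szL => h1; have := leq_trans h1 szL'.
have -> : (E * (c + n * D).+1 = E * c.+1 + E * D * n)%N by rewrite -addSn mulnDr; congr (_ + _)%N; rewrite mulnCA mulnC.
by rewrite mulSn /n leq_add2r ltnn.
Qed.
End Growth.

(** * Splitting fields and integer shifts of polynomials *)

Lemma splitting_field (F : fieldType) (p : {poly F}) : p != 0 ->
  exists (L : fieldType) (f : {rmorphism F -> L}) (rs : seq L),
    map_poly f p %= \prod_(r <- rs) ('X - r%:P).
Proof.
have [n] := ubnP (size p); elim: n => // n IHn in F p *; rewrite ltnS => szp p0.
have [sz1|sz1] := leqP (size p) 1.
  exists F, (idfun : {rmorphism F -> F}), [::]; rewrite big_nil map_poly_id //.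
  by rewrite -size_poly_eq1 eqn_leq sz1 size_poly_gt0.
have [q [qirr qp]] : exists q : {poly F}, irreducible_poly q /\ q %| p.
  have [m] := ubnP (size p); elim: m => // m IH in p sz1 {p0 szp} *; rewrite ltnS => szp.
  have [hp|hp] := pselect (irreducible_poly p); first by exists p; rewrite dvdpp.
  have [q [q1 qp nqp]] : exists q : {poly F}, [/\ size q != 1%N, q %| p & ~~ (q %= p)].
    apply: contrapT => h; apply: hp; split=> // q q1 qp; apply/negPn/negP => nqp.
    by apply: h; exists q.
  have p0 : p != 0 by rewrite -size_poly_gt0 ltnW.
  have szq : (size q < size p)%N.
    by rewrite ltn_neqAle (dvdp_leq p0 qp) andbT; apply: contra nqp; rewrite -dvdp_size_eqp.
  have q0 : q != 0 by apply: contraNneq p0 => q0; move: qp; rewrite q0 dvd0p.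
  have [||r [rirr rq]] := IH q.
  - by rewrite ltn_neqAle eq_sym q1 size_poly_gt0.
  - exact: leq_trans szq szp.
  - by exists r; split=> //; exact: dvdp_trans qp.
have [L _ [z rz _]] := irredp_FAdjoin qirr.
have rpz : root (map_poly (in_alg L) p) z.
  by apply: root_dvdp rz; rewrite dvdp_map.
have /factor_theorem [r er] := rpz.
have p0' : map_poly (in_alg L) p != 0 by rewrite map_poly_eq0.
have r0 : r != 0 by apply: contraNneq p0' => r0; rewrite er r0 mul0r.
have szr : (size r < n)%N.
  have : size (map_poly (in_alg L) p) = (size r).+1.
    by rewrite er size_mul ?polyXsubC_eq0 // size_XsubC addn2.
  by rewrite size_map_poly => e; rewrite -ltnS -e.
have [E [f [rs h]]] := IHn L r szr r0.
exists E, (GRing.RMorphism.clone _ _ (f \o in_alg L) _), (f z :: rs).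
rewrite big_cons map_poly_comp er rmorphM /= mulrC map_polyXsubC.
exact: eqp_mull h.
Qed.

Lemma coprimep_comp_poly (F : fieldType) (p q r : {poly F}) :
  coprimep p q -> coprimep (p \Po r) (q \Po r).
Proof.
move=> /Bezout_eq1_coprimepP [[u v] /= e]; apply/Bezout_eq1_coprimepP.
by exists (u \Po r, v \Po r); rewrite /= -!comp_polyM -comp_polyD e comp_polyC.
Qed.

Lemma coprimep_prod_XsubC (F : fieldType) (rs : seq F) (q : {poly F}) :
  (forall r, r \in rs -> ~~ root q r) -> coprimep (\prod_(r <- rs) ('X - r%:P)) q.
Proof.
elim: rs => [|r rs IH] h; first by rewrite big_nil coprime1p.
rewrite big_cons coprimepMl coprimep_sym coprimep_XsubC h ?inE ?eqxx //=.
by apply: IH => x hx; apply: h; rewrite inE hx orbT.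
Qed.

Lemma natr_inj_pchar0 (F : fieldType) : [pchar F] =i pred0 -> injective (fun n : nat => n%:R : F).
Proof.
move=> h; suff main m n : (m <= n)%N -> m%:R = n%:R :> F -> m = n.
  by move=> m n e; case: (leqP m n) => hmn; [exact: main | rewrite (main n m (ltnW hmn))].
move=> hmn e; apply/eqP; rewrite eqn_leq hmn -subn_eq0 /=; move/pcharf0P: h => h.
by rewrite -h natrB // e subrr.
Qed.

Lemma natr_avoid (F : fieldType) (vs : seq F) : [pchar F] =i pred0 ->
  exists j0, forall j, (j0 <= j)%N -> (j%:R : F) \notin vs.
Proof.
move=> h; elim: vs => [|v vs [j0 hj0]]; first by exists 0%N.
have [[k ek]|hv] := pselect (exists k, (k%:R : F) = v).
  exists (maxn j0 k.+1) => j; rewrite geq_max => /andP [h1 h2].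
  rewrite inE negb_or hj0 // andbT -ek; apply: contraTneq h2 => /(natr_inj_pchar0 h) ->.
  by rewrite ltnn.
exists j0 => j hj; rewrite inE negb_or hj0 // andbT.
by apply/eqP => e; apply: hv; exists j.
Qed.

Lemma pchar0_rmorph (F L : fieldType) (f : {rmorphism F -> L}) :
  [pchar F] =i pred0 -> [pchar L] =i pred0.
Proof. by move=> h p; rewrite (fmorph_pchar f). Qed.

(* In characteristic 0 a polynomial has only finitely many integer root differences
   with another one. *)
Lemma shift_coprimep (F : fieldType) (f g : {poly F}) : [pchar F] =i pred0 ->
  f != 0 -> g != 0 ->
  exists j0, forall j, (j0 <= j)%N -> coprimep f (g \Po ('X + j%:R%:P)).
Proof.
move=> char0 f0 g0.
have [L [i [rs hrs]]] := splitting_field (mulf_neq0 f0 g0).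
have charL := pchar0_rmorph i char0.
have [j0 hj0] := natr_avoid [seq b - a | a <- rs, b <- rs] charL.
exists j0 => j hj; rewrite -(coprimep_map i).
have fdvd : map_poly i f %| \prod_(r <- rs) ('X - r%:P).
  by rewrite -(eqp_dvdr _ hrs) rmorphM dvdp_mulr.
have [m em] := dvdp_prod_XsubC fdvd.
rewrite (eqp_coprimepl _ em); apply: coprimep_prod_XsubC => a ha.
have inrs b : root (map_poly i f * map_poly i g) b -> b \in rs.
  by rewrite -rmorphM (eqp_root hrs) root_prod_XsubC.
rewrite map_comp_poly rmorphD /= map_polyX map_polyC /= rmorph_nat root_comp.
apply/negP; rewrite !hornerE => rb.
have := hj0 j hj; rewrite -[j%:R](addrK a) [j%:R + a]addrC.
move/negP; apply; apply/allpairsP; exists (a, a + j%:R); split=> //=.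
  by apply: inrs; rewrite rootM (eqp_root em) root_prod_XsubC ha.
by apply: inrs; rewrite rootM rb orbT.
Qed.

Section OppOp.
Variables (K : fieldType) (M : lmodType K) (t : {linear M -> M}).
(** Exchanging [d] and [u] replaces [t] by [-t] and [zeta] by its inverse; with this operator every
    one-sided statement has its mirror image. *)
Definition opp_op : {linear M -> M} := GRing.Linear.clone _ _ _ _ ((-1) \*: t) _.
Lemma opp_opE m : opp_op m = - t m. Proof. exact: scaleN1r. Qed.
Lemma pev_opp p m : pev opp_op (p \Po (- 'X)) m = pev t p m.
Proof.
by rewrite pev_comp; apply: eq_pev => v /=; rewrite pevNl pevX opp_opE opprK.
Qed.
Lemma iter_opp i m : iter i opp_op m = (-1) ^+ i *: iter i t m.
Proof.
elim: i => [|i IH]; first by rewrite scale1r.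
by rewrite iterS IH opp_opE linearZ /= exprS mulN1r scaleNr.
Qed.
Lemma ctclosed_opp (c : {linear M -> M}) Q : ctclosed opp_op c Q <-> ctclosed t c Q.
Proof.
split=> -[hQ hc ht]; split=> // m /ht; rewrite opp_opE.
  by move/(subspaceN hQ); rewrite opprK.
by move=> h; apply: subspaceN.
Qed.
End OppOp.

(** * Subspaces of finite codimension *)

Section FiniteCodim.
Variables (K : fieldType) (M : lmodType K) (X N : M -> Prop).
Hypothesis hX : subspace X.

Lemma fincodim_basis : fincodim X N ->
  exists2 L, (forall v, v \in L -> N v) & forall y, N y -> addspan X L y.
Proof.
move=> [e he]; apply: contrapT => h.
have long n : exists2 L, size L = n & freemod X L /\ forall v, v \in L -> N v.
  elim: n => [|n [L szL [hf hL]]]; first by exists [::].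
  have [w hw hn] : exists2 w, N w & ~ addspan X L w.
    apply: contrapT => h1; apply: h; exists L => // y hy.
    by apply: contrapT => hn; apply: h1; exists y.
  exists (rcons L w); first by rewrite size_rcons szL.
  split; first exact: freemod_rcons.
  by move=> v; rewrite mem_rcons inE => /orP [/eqP ->|/hL].
have [L szL [hf hL]] := long (size e).+1.
have := freemod_size hX hf (fun v hv => he v (hL v hv)).
by rewrite szL ltnn.
Qed.

Variable t : {linear M -> M}.
Hypothesis Nt : forall m, N m -> N (t m).
Hypothesis Xt : forall m, X m -> X (t m).

Lemma fincodim_algebraic1 v : fincodim X N -> N v -> exists2 f : {poly K}, f != 0 & X (pev t f v).
Proof.
move=> [e he] hv; apply: contrapT => h.
have hN i : N (iter i t v) by elim: i => //= i; exact: Nt.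
have hspan l w : addspan X [seq iter i t v | i <- rev (iota 0 l)] w ->
    exists2 q : {poly K}, (size q <= l)%N & X (w - pev t q v).
  elim: l w => [|l IH] w; first by exists 0; rewrite ?size_poly0 // pev0 subr0.
  rewrite -[l.+1]addn1 iotaD rev_cat /= add0n => -[k /IH [q hq hw]].
  exists (q + k *: 'X^l); last by rewrite pevDl pevZl pevXn opprD addrA addrAC.
  rewrite addn1 (leq_trans (size_polyD _ _)) // geq_max (leq_trans hq) //=.
  by rewrite (leq_trans (size_scale_leq _ _)) // size_polyXn.
have long l : freemod X (rev [seq iter i t v | i <- rev (iota 0 l)]).
  elim: l => [|l IH] //; rewrite -[l.+1]addn1 iotaD rev_cat /= add0n rev_cons.
  apply: freemod_rcons => // hl.
  have {}hl : addspan X [seq iter i t v | i <- rev (iota 0 l)] (iter l t v).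
    apply: addspan_mono hl => // w; rewrite mem_rev; exact: addspan_mem.
  have [q hq hw] := hspan _ _ hl.
  apply: h; exists ('X^l - q); last by rewrite pevBl pevXn.
  apply/negP => /eqP /(congr1 (fun p : {poly K} => p`_l)).
  rewrite coefB coefXn eqxx (nth_default _ hq) coef0 subr0 => /eqP.
  by rewrite oner_eq0.
have hm w : w \in rev [seq iter i t v | i <- rev (iota 0 (size e).+1)] -> addspan X e w.
  by rewrite mem_rev => /mapP [i _ ->]; exact: he.
have := freemod_size hX (long (size e).+1) hm.
by rewrite size_rev size_map size_rev size_iota ltnn.
Qed.

(** The product of annihilators of finitely many spanning vectors; these have to be chosen inside
    [N], where powers of [t] stay. *)
Lemma fincodim_algebraic : fincodim X N -> exists2 f : {poly K}, f != 0 & forall w, N w -> X (pev t f w).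
Proof.
move=> hf; have [L hL hN] := fincodim_basis hf.
have [f f0 hfL] : exists2 f : {poly K}, f != 0 & forall v, v \in L -> X (pev t f v).
  elim: (L) hL => [|v L' IH] hL; first by exists 1; rewrite ?oner_neq0.
  have [f f0 hf'] := IH (fun z hz => hL z (mem_behead (s := v :: L') hz)).
  have [g g0 hg] := fincodim_algebraic1 hf (hL v (mem_head v L')).
  exists (f * g); first by rewrite mulf_neq0.
  move=> w; rewrite inE => /orP [/eqP ->|/hf'].
    by rewrite pevM; apply: pev_stable.
  by rewrite mulrC pevM; apply: pev_stable.
exists f => // w /hN; apply: (addspan_min (Q := fun w => X (pev t f w))) => //.
  exact: preim_subspace hX.
by move=> x hx; apply: pev_stable.
Qed.

(* [f(t)] and [f(t+k)] both annihilate [d^k N] modulo [X]. *)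
Lemma fincodim_nilpotent (d : {linear M -> M}) (f : {poly K}) k :
  (forall m, d (t m) = t (d m) + d m) -> (forall m, N m -> N (d m)) -> (forall m, X m -> X (d m)) ->
  coprimep f (f \Po ('X + k%:R%:P)) ->
  (forall w, N w -> X (pev t f w)) -> forall w, N w -> X (iter k d w).
Proof.
move=> dt Nd Xd cop hf w hw.
apply: (pev_coprime hX Xt cop).
  by apply: hf; elim: (k) => //= i; exact: Nd.
rewrite -(iter_d_pev dt); elim: (k) => [|i] /=; first exact: hf.
exact: Xd.
Qed.
End FiniteCodim.

Lemma span_list (K : fieldType) (M : lmodType K) (P : M -> Prop) w : span P w ->
  exists2 e, (forall x, x \in e -> P x) & addspan (fun m => m = 0) e w.
Proof.
have h0 : subspace (fun m : M => m = 0).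
  by split=> // [x y -> ->|k x ->]; rewrite ?addr0 ?scaler0.
move: w; apply: span_min => [|x hx].
  split; first by exists [::].
  - move=> x y [e he hx] [e' he' hy]; exists (e ++ e').
      by move=> z; rewrite mem_cat => /orP [/he|/he'].
    apply: subspaceD; first exact: addspan_subspace.
      by move: x hx; apply: addspan_mono => // z hz; apply: addspan_mem => //; rewrite mem_cat hz.
    by move: y hy; apply: addspan_mono => // z hz; apply: addspan_mem => //; rewrite mem_cat hz orbT.
  - by move=> k x [e he hx]; exists e => //; apply: subspaceZ => //; exact: addspan_subspace.
exists [:: x] => [z|]; first by rewrite inE => /eqP ->.
by apply: addspan_mem => //; rewrite inE.
Qed.

(** * Primary decomposition for a separable annihilator *)

Section Primary.
Variables (K : fieldType) (M : lmodType K) (c : {linear M -> M}).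
Definition primary_vector (m : M) : Prop :=
  exists2 p : {poly K}, irreducible_poly p & pev c p m = 0.

(** Separability makes every factorisation coprime, so Bezout splits [m] until the annihilators are
    irreducible and not merely powers of irreducibles. *)
Lemma separable_primary (p : {poly K}) m : separable_poly p -> pev c p m = 0 ->
  span primary_vector m.
Proof.
have [n] := ubnP (size p); elim: n => // n IH in p m *; rewrite ltnS => szp sep hpm.
have hS := span_subspace primary_vector.
have [hp|hp] := pselect (irreducible_poly p); first by apply: span_in; exists p.
have p0 := separable_poly_neq0 sep.
have [sz1|sz1] := leqP (size p) 1.
  by rewrite (pev_eq0_size sz1 p0 hpm); exact: subspace0 hS.
have [q [q1 qp nqp]] : exists q : {poly K}, [/\ size q != 1%N, q %| p & ~~ (q %= p)].
  apply: contrapT => h; apply: hp; split=> // q q1 qp; apply/negPn/negP => nqp.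
  by apply: h; exists q.
have epq := divpK qp; move: (p %/ q) epq => r epq.
have r0 : r != 0 by apply: contraNneq p0 => r0; rewrite -epq r0 mul0r.
have q0 : q != 0 by apply: contraNneq p0 => q0; rewrite -epq q0 mulr0.
have szq : (size q < size p)%N.
  by rewrite ltn_neqAle (dvdp_leq p0 qp) andbT; apply: contra nqp; rewrite -dvdp_size_eqp.
have szr : (size r < size p)%N.
  rewrite -epq size_mul //; have : (1 < size q)%N by rewrite ltn_neqAle eq_sym q1 size_poly_gt0.
  by case: (size q) => [|[|k]] // _; rewrite !addnS /= ltnS leq_addr.
have [sepr [sepq /Bezout_eq1_coprimepP [[a b] /= e]]] : separable_poly r /\ separable_poly q /\ coprimep r q.
  by move: sep; rewrite -epq separable_mul => /and3P [].
rewrite -(pev1 c m) -e pevDl; apply: (subspaceD hS).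
  apply: (IH q) => //; first exact: leq_trans szq szp.
  by rewrite -pevM mulrCA [q * r]mulrC epq pevM hpm linear0.
apply: (IH r) => //; first exact: leq_trans szr szp.
by rewrite -pevM mulrCA epq pevM hpm linear0.
Qed.

(** For [m] nonzero, [K[c] m] is a quotient of the field [K[X]/(p)]; this provides the simplicity
    needed for the one-sided estimates. *)
Lemma primary_cyclic m v : primary_vector m -> cyc c m v -> v <> 0 ->
  exists q, m = pev c q v.
Proof.
move=> [p [sz irr] hpm] [r ->] hv.
have [hpr|hpr] := boolP (p %| r).
  by case: hv; rewrite -(divpK hpr) pevM hpm linear0.
have cop : coprimep p r.
  apply/coprimepP => e ep er; rewrite -size_poly_eq1; apply/negPn/negP => e1.
  move: hpr; rewrite -(eqp_dvdl _ (irr e e1 ep)).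
  by rewrite er.
have /Bezout_eq1_coprimepP [[a b] /= e] := cop; exists b.
by rewrite -pevM -[LHS](pev1 c) -e pevDl pevM hpm linear0 add0r.
Qed.
End Primary.

(** * The artinian property when s(t) = t + 1 and s(c) = zeta c *)

Section SkewArtinian.
Variables (K : fieldType) (alpha beta gamma : K).
Hypothesis char0 : [pchar K] =i pred0.
Variable M : DUModule alpha beta gamma.
Implicit Types (X : M -> Prop).
Local Notation d := (dum_d M).
Local Notation u := (dum_u M).
Local Notation zero := (fun m : M => m = 0).
Hypothesis hacc : acc M.
Variable s0 : M.
Hypothesis s00 : s0 <> 0.
Hypothesis s0_min : forall X, is_submodule X -> nonzero_sub X -> X s0.

Variables (c t : {linear M -> M}) (zeta : K).
Hypothesis zeta0 : zeta != 0.
Hypothesis ct : forall m, c (t m) = t (c m).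
Hypothesis dt : forall m, d (t m) = t (d m) + d m.
Hypothesis ut : forall m, u (t m) = t (u m) - u m.
Hypothesis dc : forall m, d (c m) = zeta *: c (d m).
Hypothesis uc : forall m, u (c m) = zeta^-1 *: c (u m).
Variables (x0 x1 x2 y0 y1 y2 : {poly K}).
Hypothesis hx : forall m, u (d m) = pev c x0 m + pev c x1 (t m) + pev c x2 (t (t m)).
Hypothesis hy : forall m, d (u m) = pev c y0 m + pev c y1 (t m) + pev c y2 (t (t m)).
Variables (Gx Gy : {poly K}).
Hypothesis Gx0 : Gx != 0.
Hypothesis Gy0 : Gy != 0.
Hypothesis starx : forall Q, ctclosed t c Q -> forall w, Q (u (d w)) -> Q (pev t Gx w).
Hypothesis stary : forall Q, ctclosed t c Q -> forall w, Q (d (u w)) -> Q (pev t Gy w).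
Hypothesis sub_ct : forall X, is_submodule X -> ctclosed t c X.
Variable p0 : {poly K}.
Hypothesis p0_sep : separable_poly p0.
Hypothesis hp0 : forall m, pev c p0 m = 0.

Let t' := opp_op t.
Let p00 : p0 != 0. Proof. exact: separable_poly_neq0. Qed.
Let zetaV0 : zeta^-1 != 0. Proof. by rewrite invr_eq0. Qed.
Let ct' m : c (t' m) = t' (c m). Proof. by rewrite !opp_opE linearN ct. Qed.
Let dt' m : d (t' m) = t' (d m) - d m. Proof. by rewrite !opp_opE linearN dt opprD. Qed.
Let ut' m : u (t' m) = t' (u m) + u m. Proof. by rewrite !opp_opE linearN ut opprB addrC. Qed.
Let dc' m : d (c m) = zeta^-1^-1 *: c (d m). Proof. by rewrite invrK. Qed.
Let pevNN p m : pev c (- p) (t' m) = pev c p (t m).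
Proof. by rewrite opp_opE pevNl linearN opprK. Qed.
Let tt' m : t' (t' m) = t (t m). Proof. by rewrite !opp_opE linearN opprK. Qed.
Let hx' m : u (d m) = pev c x0 m + pev c (- x1) (t' m) + pev c x2 (t' (t' m)).
Proof. by rewrite pevNN tt'. Qed.
Let hy' m : d (u m) = pev c y0 m + pev c (- y1) (t' m) + pev c y2 (t' (t' m)).
Proof. by rewrite pevNN tt'. Qed.
Let starx' Q : ctclosed t' c Q -> forall w, Q (u (d w)) -> Q (pev t' (Gx \Po (- 'X)) w).
Proof. by move=> /ctclosed_opp hQ w /(starx hQ); rewrite pev_opp. Qed.
Let comp0 (G : {poly K}) : G != 0 -> G \Po (- 'X) != 0.
Proof. by rewrite -!size_poly_eq0 size_comp_poly2 // size_polyN size_polyX. Qed.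

Let Xs X : is_submodule X -> subspace X. Proof. exact: submodule_subspace. Qed.
Let du_sub X : du_submodule d u X -> is_submodule X.
Proof. by case=> h1 h2 h3; apply/submoduleP; split. Qed.

Definition filts D n m (w : M) := filt d t c m D n w \/ filt u t' c m D n w.

(** The one-sided estimate is used for monomials in [d], and again for those in [u] after exchanging
    [d] with [u], negating [t] and inverting [zeta]. *)
Lemma primary_growth m : primary_vector c m -> exists D0 E, forall D n, (D0 <= D)%N ->
  exists2 L : seq M, (size L <= E * n.+1)%N & forall w, filts D n m w -> addspan zero L w.
Proof.
move=> hm; have z := zero_subspace M.
have [m0|m0] := pselect (m = 0).
  exists 0%N, 0%N => D n _; exists [::] => // w hw.
  have mz d' t'' i j v : cyc c m v -> mono (M := M) d' t'' j i v = 0.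
    by move=> [q ->]; rewrite m0 linear0 mono0.
  by case: hw; move: w; apply: mspan_min => // j i v _ /mz ->.
have smin X : du_submodule d u X -> (exists2 x, X x & x <> 0) -> X s0.
  by move=> /du_sub; exact: s0_min.
have smin' X : du_submodule u d X -> (exists2 x, X x & x <> 0) -> X s0.
  by case=> h1 h2 h3; apply: smin.
have [D1 [E1 h1]] := filt_growth zeta0 ct dt ut dc uc hx hy Gy0 stary
  (fun v => @primary_cyclic _ _ c m v hm) s00 smin m0 p00 (hp0 m).
have [D2 [E2 h2]] := filt_growth zetaV0 ct' ut' dt' uc dc' hy' hx' (comp0 Gx0) starx'
  (fun v => @primary_cyclic _ _ c m v hm) s00 smin' m0 p00 (hp0 m).
exists (maxn D1 D2), (E1 + E2)%N => D n; rewrite geq_max => /andP [hD1 hD2].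
have [L1 szL1 hL1] := h1 D n hD1; have [L2 szL2 hL2] := h2 D n hD2.
exists (L1 ++ L2); first by rewrite size_cat mulnDl leq_add.
move=> w [/hL1|/hL2]; apply: addspan_mono => // x hx0; apply: addspan_mem => //.
  by rewrite mem_cat hx0.
by rewrite mem_cat hx0 orbT.
Qed.

Lemma primary_generators : exists2 ms : seq M, (forall m, m \in ms -> primary_vector c m) &
  forall X, is_submodule X -> (forall m, m \in ms -> X m) -> forall m, X m.
Proof.
have [s [_ hs]] := @acc_fin_generated _ _ _ _ M (fun=> True) hacc.
have [ms hms hin] : exists2 ms : seq M, (forall m, m \in ms -> primary_vector c m) &
    forall X, is_submodule X -> (forall m, m \in ms -> X m) -> forall m, m \in s -> X m.
  elim: (s) => [|v s' [ms hms hin]]; first by exists [::].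
  have [e he hv] := span_list (separable_primary p0_sep (hp0 v)).
  exists (e ++ ms) => [m|X hX hXm m]; first by rewrite mem_cat => /orP [/he|/hms].
  rewrite inE => /orP [/eqP ->|].
    apply: (addspan_min _ _ _ hv); first exact: Xs.
      by move=> x ->; exact: subspace0 (Xs hX).
    by move=> x hx0; apply: hXm; rewrite mem_cat hx0.
  by apply: hin => // z hz; apply: hXm; rewrite mem_cat hz orbT.
by exists ms => // X hX hXm m; apply: hs => //; exact: hin.
Qed.

Definition filtration (ms : seq M) D n : M -> Prop :=
  span (fun w => exists2 m, m \in ms & filts D n m w).

Lemma filts_filtration ms D n m w : m \in ms -> filts D n m w -> filtration ms D n w.
Proof. by move=> hm hw; apply: span_in; exists m. Qed.

Lemma filt_widen (d' t'' : {linear M -> M}) D n k m w : (n <= k)%N ->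
  filt d' t'' c m D n w -> filt d' t'' c m D k w.
Proof. by move=> h; apply: mspan_mono => j i hji; apply: leq_trans h. Qed.

Lemma mono_opp i j v : mono u t j i v = (-1) ^+ i *: mono u t' j i v.
Proof.
by rewrite /mono iter_opp iter_linZ scalerA -exprMn mulN1r opprK expr1n scale1r.
Qed.

Lemma mono_opp_d i j v : mono d t' j i v = (-1) ^+ i *: mono d t j i v.
Proof. by rewrite /mono iter_opp iter_linZ. Qed.

(** On a monomial [u^(j+1) t^i v] the operator [du] costs at most two powers of [t], while a factor
    [u] of weight [D] disappears. A monomial without [u] passes to the [d]-side, its power of [-t]
    becoming one of [t] up to sign. *)
Lemma filtration_d ms D n w : (0 < D)%N -> filtration ms D n w -> filtration ms D (n + D) (d w).
Proof.
move=> D0; have hS : subspace (filtration ms D (n + D)) by exact: span_subspace.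
move: w; apply: span_min => [|w [m hm]]; first exact: preim_subspace hS.
case=> hw; first by apply: (filts_filtration hm); left; exact: (filt_d zeta0 Gx0 hw).
move: w hw; apply: mspan_min => [|j i v hji hv]; first exact: preim_subspace hS.
case: j hji => [|j] hji; last first.
  have h := u_mono zetaV0 ct' ut' uc hy' Gx0 (j := j) (i := i) hv.
  apply: (filts_filtration hm); right; apply: mspan_mono h => j' i' [-> hi'].
  by rewrite mulnS in hji; lia.
rewrite -[mono u t' 0 i v]/(mono d t' 0 i v) mono_opp_d linearZ; apply: (subspaceZ _ hS).
apply: (filts_filtration hm); left.
rewrite -[d _]/(mono d t 1 i v); apply: mspan_in => //.
by rewrite muln0 muln1 in hji *; lia.
Qed.

Lemma filtration_u ms D n w : (0 < D)%N -> filtration ms D n w -> filtration ms D (n + D) (u w).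
Proof.
move=> D0; have hS : subspace (filtration ms D (n + D)) by exact: span_subspace.
move: w; apply: span_min => [|w [m hm]]; first exact: preim_subspace hS.
case=> hw; last by apply: (filts_filtration hm); right; exact: (filt_d zeta0 Gx0 hw).
move: w hw; apply: mspan_min => [|j i v hji hv]; first exact: preim_subspace hS.
case: j hji => [|j] hji; last first.
  have h := u_mono zeta0 ct dt dc hx Gx0 (j := j) (i := i) hv.
  apply: (filts_filtration hm); left; apply: mspan_mono h => j' i' [-> hi'].
  by rewrite mulnS in hji; lia.
rewrite -[mono d t 0 i v]/(mono u t 0 i v) mono_opp linearZ; apply: (subspaceZ _ hS).
apply: (filts_filtration hm); right.
rewrite -[u _]/(mono u t' 1 i v); apply: mspan_in => //.
by rewrite muln0 muln1 in hji *; lia.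
Qed.

Lemma filtration_growth ms : (forall m, m \in ms -> primary_vector c m) ->
  exists D0 E, forall D n, (D0 <= D)%N -> exists2 L : seq M, (size L <= E * n.+1)%N &
  forall w, filtration ms D n w -> addspan zero L w.
Proof.
have z := zero_subspace M.
elim: ms => [|m ms IH] hms.
  exists 0%N, 0%N => D n _; exists [::] => // w; apply: span_min => [|x [m]] //.
have [D1 [E1 h1]] := IH (fun x hx => hms x (mem_behead (s := m :: ms) hx)).
have [D2 [E2 h2]] := primary_growth (hms m (mem_head m ms)).
exists (maxn D1 D2), (E1 + E2)%N => D n; rewrite geq_max => /andP [hD1 hD2].
have [L1 szL1 hL1] := h1 D n hD1; have [L2 szL2 hL2] := h2 D n hD2.
exists (L1 ++ L2); first by rewrite size_cat mulnDl leq_add.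
apply: span_min => [|w [m']]; first exact: addspan_subspace.
rewrite inE => /orP [/eqP ->|hm'] hw.
  move: (hL2 _ hw); apply: addspan_mono => // x hx0; apply: addspan_mem => //.
  by rewrite mem_cat hx0 orbT.
move: (hL1 _ (filts_filtration hm' hw)); apply: addspan_mono => // x hx0.
by apply: addspan_mem => //; rewrite mem_cat hx0.
Qed.

Lemma chain_fincodim (C : nat -> M -> Prop) : (forall n, is_submodule (C n)) ->
  (forall n x, C n.+1 x -> C n x) ->
  exists i0, forall j, (i0 <= j)%N -> fincodim (C j) (C i0).
Proof.
have [ms hms hgen] := primary_generators.
have [D0 [E hgrowth]] := filtration_growth hms.
pose D := D0.+1.
have Fmono n w : filtration ms D n w -> filtration ms D n.+1 w.
  apply: span_mono => x [m hm hx0]; exists m => //.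
  by case: hx0 => h; [left | right]; exact: filt_widen (leqnSn n) h.
apply: (growth_chain hacc (F := filtration ms D) (E := E) (D := D)) => //.
- by move=> n; exact: span_subspace.
- by move=> n w; exact: filtration_d.
- by move=> n w; exact: filtration_u.
- apply: hgen.
    apply/submoduleP; split.
    + split; first by exists 0%N; exact: subspace0 (span_subspace _).
      * move=> x y [k hk] [l hl]; exists (maxn k l); apply: (subspaceD (span_subspace _)).
          by apply: (chain_mono Fmono _ hk); rewrite leq_maxl.
        by apply: (chain_mono Fmono _ hl); rewrite leq_maxr.
      * by move=> k x [l hl]; exists l; exact: (subspaceZ _ (span_subspace _)).
    + by move=> m [n hn]; exists (n + D)%N; exact: filtration_d.
    + by move=> m [n hn]; exists (n + D)%N; exact: filtration_u.
  move=> m hm; exists 0%N; apply: (filts_filtration hm); left.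
  rewrite -[m in filt _ _ _ _ _ _ m]/(mono d t 0 0 m).
  by apply: mspan_in; [rewrite muln0 | exact: cyc_m0].
- by move=> n; apply: hgrowth; rewrite /D.
Qed.

Let pre_d Q j : ctclosed t c Q -> ctclosed t c (fun w => Q (iter j d w)).
Proof. exact: (ctclosed_pre_d zeta0 dt dc). Qed.
Let pre_u Q j : ctclosed t c Q -> ctclosed t c (fun w => Q (iter j u w)).
Proof.
by move=> /(@ctclosed_opp _ _ t) hQ; apply/(@ctclosed_opp _ _ t)/(ctclosed_pre_d zetaV0 ut' uc).
Qed.

(** [Gminus 0 k] and [Gplus k] play for [u^k d^k] and [d^k u^k] the role of [Gx] for [ud] and [Gy]
    for [du]: each successive elimination crosses one more [d] or [u], which shifts the argument.
    The offset [j] allows a product to be cut in two. *)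
Definition Gminus j k : {poly K} := \prod_(i < k) (Gx \Po ('X - (j + i)%:R%:P)).
Definition Gplus k : {poly K} := \prod_(i < k) (Gy \Po ('X + i%:R%:P)).

Lemma Gminus_kill X k w : is_submodule X -> X (iter k u (iter k d w)) -> X (pev t (Gminus 0 k) w).
Proof.
move=> hX; elim: k w => [|k IH] w; first by rewrite /Gminus big_ord0 pev1.
rewrite iterSr iterS => /(starx (pre_u k (sub_ct hX))).
by rewrite (pev_iter_d dt) => /IH; rewrite /Gminus big_ord_recr pevM.
Qed.

Lemma Gplus_kill X k w : is_submodule X -> X (iter k d (iter k u w)) -> X (pev t (Gplus k) w).
Proof.
move=> hX; elim: k w => [|k IH] w; first by rewrite /Gplus big_ord0 pev1.
rewrite iterSr iterS => /(stary (pre_d k (sub_ct hX))).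
by rewrite (pev_iter_u ut) => /IH; rewrite /Gplus big_ord_recr pevM.
Qed.

Lemma Gminus_split j k : Gminus 0 (j + k) = Gminus 0 j * Gminus j k.
Proof. by rewrite /Gminus big_split_ord. Qed.

(** The shifts of [Gx] and [Gy] being compared differ by [j0 + i + i'], hence by at least [j0],
    uniformly in the numbers of factors. *)
Lemma Gminus_coprime : exists j0, forall k k', coprimep (Gminus j0 k) (Gplus k').
Proof.
have [j0 hj0] := shift_coprimep char0 Gx0 Gy0; exists j0 => k k'.
apply: (big_ind (fun q => coprimep q (Gplus k'))) => [|p q hp hq|i _].
- exact: coprime1p.
- by rewrite coprimepMl hp hq.
apply: (big_ind (fun q => coprimep _ q)) => [|p q hp hq|i' _].
- exact: coprimep1.
- by rewrite coprimepMr hp hq.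
have hle : (j0 <= j0 + i + i')%N by rewrite -addnA leq_addr.
have := coprimep_comp_poly ('X - (j0 + i)%:R%:P) (hj0 _ hle).
rewrite -comp_polyA comp_polyD comp_polyX comp_polyC (natrD K (j0 + i)) polyCD.
by rewrite addrA subrK.
Qed.

Let subN N : is_submodule N -> forall m, N m -> N (t m).
Proof. by move=> /sub_ct []. Qed.

Lemma iter_sub X (o : {linear M -> M}) k w : (forall m, X m -> X (o m)) -> X w -> X (iter k o w).
Proof. by move=> h hw; elim: k => //= k; exact: h. Qed.

Lemma fincodim_nilpotent_d f : f != 0 -> exists k, forall X N, is_submodule X -> is_submodule N ->
  (forall w, N w -> X (pev t f w)) -> forall w, N w -> X (iter k d w).
Proof.
move=> f0; have [j hj] := shift_coprimep char0 f0 f0; exists j => X N hX hN.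
apply: (fincodim_nilpotent (Xs hX) (subN hX) dt _ _ (hj j (leqnn j))).
  by move=> m; exact: submodule_d.
by move=> m; exact: submodule_d.
Qed.

Lemma fincodim_nilpotent_u f : f != 0 -> exists k, forall X N, is_submodule X -> is_submodule N ->
  (forall w, N w -> X (pev t f w)) -> forall w, N w -> X (iter k u w).
Proof.
move=> f0; have [j hj] := shift_coprimep char0 (comp0 f0) (comp0 f0); exists j => X N hX hN hf.
have hX' : forall m, X m -> X (t' m) by case/(@ctclosed_opp _ _ t): (sub_ct hX).
apply: (fincodim_nilpotent (Xs hX) hX' ut' _ _ (hj j (leqnn j))).
- by move=> m; exact: submodule_u.
- by move=> m; exact: submodule_u.
- by move=> w /hf; rewrite pev_opp.
Qed.

(** An annihilator [f] of [N] modulo [X] depends on the pair, but it only serves to get [d^k1 N] and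
    [u^k2 N] into [X]. Then [Gminus 0 (j0 + k1)] and [Gplus k2] both send [N] into [X], and removing
    from the former the factor [Gminus j0 k1], coprime to the latter, leaves [Gminus 0 j0]. *)
Lemma uniform_annihilator : exists2 g : {poly K}, g != 0 & forall X N,
  is_submodule X -> is_submodule N -> fincodim X N -> forall w, N w -> X (pev t g w).
Proof.
have [j0 hj0] := Gminus_coprime; exists (Gminus 0 j0).
  apply/prodf_neq0 => i _; rewrite -size_poly_eq0 size_comp_poly2 ?size_poly_eq0 //.
  by rewrite size_XsubC.
move=> X N hX hN hf w hw.
have [f f0 hfN] := fincodim_algebraic (Xs hX) (subN hN) (subN hX) hf.
have [k1 hk1] := fincodim_nilpotent_d f0; have [k2 hk2] := fincodim_nilpotent_u f0.
have hd z : N z -> X (iter k1 d z) := hk1 X N hX hN hfN z.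
have hu z : N z -> X (iter k2 u z) := hk2 X N hX hN hfN z.
pose k := (j0 + k1)%N.
have Xd m : X m -> X (d m) by exact: submodule_d.
have Xu m : X m -> X (u m) by exact: submodule_u.
have Nd m : N m -> N (d m) by exact: submodule_d.
have Nu m : N m -> N (u m) by exact: submodule_u.
have h1 : X (pev t (Gminus 0 k) w).
  apply: Gminus_kill => //; apply: iter_sub => //.
  by rewrite iterD; apply: iter_sub => //; exact: hd.
have h2 : X (pev t (Gplus k2) w).
  by apply: Gplus_kill => //; apply: iter_sub => //; exact: hu.
apply: (pev_coprime (Xs hX) (subN hX) (hj0 k1 k2)).
  by rewrite -pevM mulrC -Gminus_split.
by rewrite -pevM mulrC pevM; apply: pev_stable; [exact: Xs | exact: subN|].
Qed.

(** [N] is spanned by powers of [d] and of [u] on the [K[c,t]]-module of its generators. Modulo any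
    [X] that module is cut down by [g(t)] and [p0(c)], and the powers stop at exponents [k1], [k2]
    determined by [g] alone, so one finite list serves for all [X]. *)
Lemma uniform_codim N : is_submodule N -> exists e, forall X, is_submodule X -> fincodim X N ->
  forall y, N y -> addspan X e y.
Proof.
move=> hN; have [sN [hsN hgen]] := @acc_fin_generated _ _ _ _ M N hacc.
have [g g0 hg] := uniform_annihilator.
have [k1 hk1] := fincodim_nilpotent_d g0; have [k2 hk2] := fincodim_nilpotent_u g0.
pose e0 := [seq iter i t v | i <- iota 0 (size g), v <- [seq iter l c v | l <- iota 0 (size p0), v <- sN]].
pose e := [seq iter j d v | j <- iota 0 k1, v <- e0] ++ [seq iter j u v | j <- iota 0 k2, v <- e0].
exists e => X hX hXN.
have hgX := hg X N hX hN hXN.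
have hd z : N z -> X (iter k1 d z) := hk1 X N hX hN hgX z.
have hu z : N z -> X (iter k2 u z) := hk2 X N hX hN hgX z.
have [_ Nc Nt] := sub_ct hN.
have Nd m : N m -> N (d m) by exact: submodule_d.
have Nu m : N m -> N (u m) by exact: submodule_u.
pose T := span (fun w => exists q r v, v \in sN /\ w = pev t q (pev c r v)).
have Ts : subspace T by exact: span_subspace.
have TN z : T z -> N z.
  apply: span_min; first exact: Xs.
  move=> _ [q [r [v [hv ->]]]].
  by do 2!(apply: pev_stable; [exact: Xs | by []|]); exact: hsN.
have Tct : ctclosed t c T.
  split=> //.
    apply: span_min => [|_ [q [r [v [hv ->]]]]]; first exact: preim_subspace Ts.
    apply: span_in; exists q, ('X * r), v; split=> //.
    by rewrite (pev_commute (B := c)) // [pev c (_ * _) _]pevM pevX.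
  apply: span_min => [|_ [q [r [v [hv ->]]]]]; first exact: preim_subspace Ts.
  by apply: span_in; exists ('X * q), r, v; split=> //; rewrite pevM pevX.
have A0s := addspan_subspace e0 (Xs hX).
have As := addspan_subspace e (Xs hX).
have TA z : T z -> addspan X e0 z.
  apply: span_min => // _ [q [r [v [hv ->]]]].
  rewrite (divp_eq q g) (divp_eq r p0) !pevDl !pevM hp0 linear0 add0r.
  have Nr : N (pev c (r %% p0) v) by apply: pev_stable; [exact: Xs | by [] | exact: hsN].
  apply: (subspaceD A0s).
    apply: addspan_sub; first exact: Xs.
    by apply: pev_stable; [exact: Xs | exact: subN | exact: hgX].
  apply: subspace_sum => // i _; apply: (subspaceZ _ A0s).
  rewrite (big_morph (iter i t) (iter_linD t i) (iter_lin0 t i)).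
  apply: subspace_sum => // l _; rewrite iter_linZ; apply: (subspaceZ _ A0s).
  apply: addspan_mem; first exact: Xs.
  apply/allpairsP; exists (nat_of_ord i, iter l c v); split=> //=.
    rewrite mem_iota add0n /=; apply: leq_trans (ltn_ord i) _.
    by apply/ltnW; rewrite ltn_modp.
  apply/allpairsP; exists (nat_of_ord l, v); split=> //=.
  rewrite mem_iota add0n /=; apply: leq_trans (ltn_ord l) _.
  by apply/ltnW; rewrite ltn_modp.
have Td j z : T z -> addspan X e (iter j d z).
  move=> hz; case: (leqP k1 j) => hj.
    apply: addspan_sub; first exact: Xs.
    by rewrite -(subnKC hj) iterD; apply: hd; apply: iter_sub => //; exact: TN.
  move: (TA z hz); apply: (@addspan_min _ _ X e0 (fun z => addspan X e (iter j d z))) => [|x hx0|x hx0].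
  - split; first by rewrite iter_lin0; exact: subspace0.
    + by move=> a b ha hb; rewrite iter_linD; exact: subspaceD.
    + by move=> a b hb; rewrite iter_linZ; exact: subspaceZ.
  - apply: addspan_sub; first exact: Xs.
    by apply: iter_sub hx0 => m; exact: submodule_d.
  - apply: addspan_mem; first exact: Xs.
    rewrite mem_cat; apply/orP; left; apply/allpairsP; exists (j, x); split=> //=.
    by rewrite mem_iota add0n.
have Tu j z : T z -> addspan X e (iter j u z).
  move=> hz; case: (leqP k2 j) => hj.
    apply: addspan_sub; first exact: Xs.
    by rewrite -(subnKC hj) iterD; apply: hu; apply: iter_sub => //; exact: TN.
  move: (TA z hz); apply: (@addspan_min _ _ X e0 (fun z => addspan X e (iter j u z))) => [|x hx0|x hx0].
  - split; first by rewrite iter_lin0; exact: subspace0.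
    + by move=> a b ha hb; rewrite iter_linD; exact: subspaceD.
    + by move=> a b hb; rewrite iter_linZ; exact: subspaceZ.
  - apply: addspan_sub; first exact: Xs.
    by apply: iter_sub hx0 => m; exact: submodule_u.
  - apply: addspan_mem; first exact: Xs.
    rewrite mem_cat; apply/orP; right; apply/allpairsP; exists (j, x); split=> //=.
    by rewrite mem_iota add0n.
pose Y := span (fun w => exists j z, T z /\ (w = iter j d z \/ w = iter j u z)).
have Ys : subspace Y by exact: span_subspace.
have hY : is_submodule Y.
  apply/submoduleP; split=> //.
    apply: span_min => [|_ [j [z [hz [->|->]]]]]; first exact: preim_subspace Ys.
      by apply: span_in; exists j.+1, z; split=> //; left.
    case: j => [|j]; first by apply: span_in; exists 1%N, z; split=> //; left.
    have [z' hz' ez] : exists2 z', T z' & d (u (iter j u z)) = iter j u z'.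
      apply: (ctclosed_du hy (ctclosed_im_u zeta0 ut uc j Tct)).
      by exists z.
    by rewrite iterS ez; apply: span_in; exists j, z'; split=> //; right.
  apply: span_min => [|_ [j [z [hz [->|->]]]]]; first exact: (@preim_subspace _ _ u _ Ys).
    case: j => [|j]; first by apply: span_in; exists 1%N, z; split=> //; right.
    have [z' hz' ez] : exists2 z', T z' & u (d (iter j d z)) = iter j d z'.
      apply: (ctclosed_ud hx (ctclosed_im_d zeta0 dt dc j Tct)).
      by exists z.
    by rewrite iterS ez; apply: span_in; exists j, z'; split=> //; left.
  by apply: span_in; exists j.+1, z; split=> //; right.
move=> y hNy; have hYy : Y y.
  apply: hgen hNy => // v hv; apply: span_in; exists 0%N, v; split; last by left.
  by apply: span_in; exists 1, 1, v; rewrite !pev1.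
move: y hYy {hNy}; apply: span_min => // _ [j [z [hz [->|->]]]]; [exact: Td | exact: Tu].
Qed.

Theorem skew_artinian : artinian M.
Proof.
apply/(artinian_inT (W := fun=> True)) => // C hC _ hmono.
have [i0 hi0] := chain_fincodim hC hmono.
have [e he] := uniform_codim (hC i0).
apply: (bounded_codim_stable (i0 := i0) (e := e) hC hmono) => j hj.
by apply: he => //; exact: hi0.
Qed.
End SkewArtinian.

(** * Root-of-unity parameters *)

Section IntegralTower.
Variables (K : fieldType) (M : lmodType K) (G : M -> Prop) (T : {linear M -> M}).
Hypothesis Gs : subspace G.
Local Notation zero := (fun m : M => m = 0).

Lemma zero_subsp : subspace zero.
Proof. by split=> // [x y -> ->|k x ->]; rewrite ?addr0 ?scaler0. Qed.

Lemma tower_fd n e : (forall g, G g -> tower_upto G T n (iter n T g)) ->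
  (forall g, G g -> addspan zero e g) ->
  exists e', forall w, tower G T w -> addspan zero e' w.
Proof.
move=> hint he; have hS := tower_upto_subspace T Gs n.
have hT w : tower_upto G T n w -> tower_upto G T n (T w).
  move=> /(tower_uptoT Gs) [g hg hw]; apply: (subspace_subr hS hw); exact: hint.
have hall k g : G g -> tower_upto G T n (iter k T g).
  move=> hg; elim: k => [|k IH]; last exact: hT.
  case: (n) (hint g hg) hS hT => [|k]; last first.
    by move=> _ _ _; apply: (tower_upto_mono Gs (ltn0Sn k)); apply: (tower_upto_iter T Gs 0).
  by move=> /= ->.
exists [seq iter i T v | i <- iota 0 n, v <- e] => w [k].
have {}hS' : tower_upto G T k w -> tower_upto G T n w.
  elim: k w => [|k IH] w /=; first by move=> ->; exact: subspace0 hS.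
  by case=> g hg /IH hw; apply: (subspace_subr hS hw); exact: hall.
move=> /hS'; set L := [seq _ | _ <- _, _ <- _].
have hL i v : (i < n)%N -> G v -> addspan zero L (iter i T v).
  move=> hi /he; apply: (@addspan_min _ _ zero e (fun v => addspan zero L (iter i T v))).
  - have hA := addspan_subspace L zero_subsp; split; first by rewrite iter_lin0; exact: subspace0.
    + by move=> a b ha hb; rewrite iter_linD; exact: subspaceD.
    + by move=> a b hb; rewrite iter_linZ; exact: subspaceZ.
  - by move=> x ->; rewrite iter_lin0; exact: subspace0 (addspan_subspace L zero_subsp).
  - move=> x hx; apply: addspan_mem; first exact: zero_subsp.
    by apply/allpairsP; exists (i, x); rewrite /= mem_iota add0n.
have hA := addspan_subspace L zero_subsp.
have : (n <= n)%N by []; move: {1 3}n => j.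
elim: j w {hS'} => [|j IH] w hj /=; first by move=> ->; exact: subspace0 hA.
case=> g hg /(IH _ (ltnW hj)) hw; apply: (subspace_subr hA hw); exact: hL.
Qed.

Lemma algebraic_integral (p : {poly K}) g : p != 0 -> (forall m, pev T p m = 0) -> G g ->
  tower_upto G T (size p).-1 (iter (size p).-1 T g).
Proof.
move=> p0 hp hg; set n := (size p).-1.
have hS := tower_upto_subspace T Gs n.
apply: (subspace_scaleK hS (k := lead_coef p)); first by rewrite lead_coef_eq0.
have := hp g; rewrite /pev /polyact (_ : size p = n.+1); last by rewrite prednK // size_poly_gt0.
rewrite big_ord_recr /= => /eqP; rewrite addrC addr_eq0 => /eqP ->.
apply: (subspaceN hS); apply: subspace_sum => // i _; apply: (subspaceZ _ hS).
by apply: (tower_upto_mono Gs (ltn_ord i)); exact: tower_upto_iter.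
Qed.
End IntegralTower.

(** Powers of one operator at a time are applied to the list; commutativity keeps the span stable
    under the operators treated before. *)
Lemma algebraic_closure_list (K : fieldType) (M : lmodType K) (Zs : seq {linear M -> M}) (s : seq M) :
  (forall Z Z', List.In Z Zs -> List.In Z' Zs -> forall m, Z (Z' m) = Z' (Z m)) ->
  (forall Z, List.In Z Zs -> exists2 p : {poly K}, p != 0 & forall m, pev Z p m = 0) ->
  exists s', (forall m, m \in s -> addspan (fun m => m = 0) s' m) /\
    forall Z, List.In Z Zs -> forall m, addspan (fun m => m = 0) s' m -> addspan (fun m => m = 0) s' (Z m).
Proof.
have z := @zero_subsp K M.
elim: Zs => [|Z Zs IH] hcomm hp.
  by exists s; split=> // m hm; apply: addspan_mem.
have [|s' [hs hcl]] := IH _ (fun Z' hZ => hp Z' (or_intror hZ)).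
  by move=> Z1 Z2 h1 h2; apply: hcomm; right.
have [p p0 hpZ] := hp Z (or_introl erefl).
exists [seq iter i Z v | i <- iota 0 (size p), v <- s']; set L := [seq _ | _ <- _, _ <- _].
have hA := addspan_subspace L z.
have hL q v : addspan (fun m => m = 0) s' v -> addspan (fun m => m = 0) L (pev Z q v).
  apply: (@addspan_min _ _ (fun m => m = 0) s' (fun v => addspan (fun m => m = 0) L (pev Z q v))).
  - exact: preim_subspace hA.
  - by move=> x ->; rewrite linear0; exact: subspace0 hA.
  move=> x hx; rewrite (divp_eq q p) pevDl pevM hpZ linear0 add0r.
  apply: subspace_sum => // i _; apply: subspaceZ => //; apply: addspan_mem => //.
  apply/allpairsP; exists (nat_of_ord i, x); rewrite /= mem_iota add0n; split=> //.
  by apply: leq_trans (ltn_ord i) _; apply/ltnW; rewrite ltn_modp.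
split=> [m /hs hm|Z' hZ']; first by rewrite -(pev1 Z m); exact: hL.
apply: addspan_min; [exact: preim_subspace hA | by move=> x ->; rewrite linear0; exact: subspace0 hA |].
move=> _ /allpairsP [[i v] /= [hi hv ->]]; have hv' := addspan_mem z hv.
case: hZ' => [<-|hZ'].
  by rewrite -iterS -pevXn; exact: hL.
have -> : Z' (iter i Z v) = pev Z 'X^i (Z' v).
  rewrite -pevXn (pev_commute (B := Z')) // => m.
  by apply: hcomm; [right | left].
by apply: hL; exact: hcl.
Qed.

(** * Automorphisms of finite order: finite-dimensional modules *)

Section FiniteOrder.
Variables (K : fieldType) (alpha beta gamma : K).
Hypothesis beta0 : beta != 0.
Variable M : DUModule alpha beta gamma.
Local Notation d := (dum_d M).
Local Notation u := (dum_u M).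
Local Notation x := (dux M).
Local Notation y := (duy M).
Local Notation zero := (fun m : M => m = 0).
Hypothesis hfg : fin_generated M.
Hypothesis hmono : monolithic M.
Variable N : nat.
Hypothesis N0 : (0 < N)%N.
(** [s^N(x) = x] in operator form. As [d^(N-1) y = d^N u] and [x d^(N-1) = u d^N], it says that
    [d^N] is central. *)
Hypothesis d_per : forall m, iter N.-1 d (y m) = x (iter N.-1 d m).
Hypothesis u_per : forall m, iter N.-1 u (x m) = y (iter N.-1 u m).

Lemma iterop_subproof (T : {linear M -> M}) n : linear (iter n T).
Proof. by move=> k v w; rewrite iter_linear. Qed.
Definition iterop (T : {linear M -> M}) n := iter n T.
HB.instance Definition _ T n := GRing.isLinear.Build K M M _ (iterop T n) (iterop_subproof T n).

Lemma power_algebraic (T : {linear M -> M}) :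
  (forall m, iter N T (d m) = d (iter N T m)) -> (forall m, iter N T (u m) = u (iter N T m)) ->
  exists2 p : {poly K}, p != 0 & forall m, pev T p m = 0.
Proof.
move=> h1 h2; have [p p0 hp] := central_algebraic (Z := iterop T N : {linear M -> M}) beta0 hfg hmono h1 h2.
exists (p \Po 'X^N).
  by rewrite comp_poly_eq0 // size_polyXn ltnS.
move=> m; rewrite pev_comp -[RHS](hp m); apply: eq_pev => v /=.
by rewrite pevXn.
Qed.

Lemma d_algebraic : exists2 p : {poly K}, p != 0 & forall m, pev d p m = 0.
Proof.
apply: power_algebraic => m; first by rewrite -iterSr.
by rewrite -(prednK N0) iterSr -[d (u m)]/(y m) d_per.
Qed.

Lemma u_algebraic : exists2 p : {poly K}, p != 0 & forall m, pev u p m = 0.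
Proof.
apply: power_algebraic => m; last by rewrite -iterSr.
by rewrite -(prednK N0) iterSr -[u (d m)]/(x m) u_per.
Qed.

Variable Zs : seq {linear M -> M}.
Hypothesis Zs_comm : forall Z Z', List.In Z Zs -> List.In Z' Zs -> forall m, Z (Z' m) = Z' (Z m).
Hypothesis Zs_d : forall Z, List.In Z Zs -> forall m, Z (d m) = d (Z m).
Hypothesis Zs_u : forall Z, List.In Z Zs -> forall m, Z (u m) = u (Z m).
(* [x] and [y] are integral over the central operators in [Zs]. *)
Hypothesis x_int : forall G, closedby (ops Zs) G -> exists n, forall g, G g -> tower_upto G x n (iter n x g).
Hypothesis y_int : forall G, closedby (ops Zs) G -> exists n, forall g, G g -> tower_upto G y n (iter n y g).

(** The noetherian tower is reused with a finite-dimensional base stable under [Zs]. Integrality of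
    [x] and [y] and algebraicity of [d] and [u] bound the degrees in each layer, so [M] is
    finite-dimensional. *)
Theorem finite_order_artinian : artinian M.
Proof.
have [s hs] := hfg.
have [s' [hss' hcl]] := algebraic_closure_list s Zs_comm
  (fun Z hZ => central_algebraic beta0 hfg hmono (Zs_d hZ) (Zs_u hZ)).
have Id (m : M) : (idfun : {linear M -> M}) (d m) = d ((idfun : {linear M -> M}) m) by [].
have Iu (m : M) : (idfun : {linear M -> M}) (u m) = u ((idfun : {linear M -> M}) m) by [].
have z := zero_subspace M.
have G0s : subspace (layer0 s') by apply: addspan_subspace.
have G0c : closedby (ops Zs) (layer0 s').
  by split=> // _ [Z hZ ->]; exact: hcl.
have G1s : subspace (layerZ idfun s') by case: (layerZ_closed idfun s').
have G2s : subspace (layerx idfun s') by case: (layerx_closed Id Iu s').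
have G3s : subspace (layery idfun s') by case: (layery_closed Id Iu s').
have G4s : subspace (layerd idfun s') by case: (layerd_closed beta0 Id Iu s').
have comm_closed G (T : {linear M -> M}) : closedby (ops Zs) G ->
    (forall Z, List.In Z Zs -> forall m, Z (T m) = T (Z m)) -> closedby (ops Zs) (tower G T).
  move=> hG hT; have Gs : subspace G by case: hG.
  split; first exact: tower_subspace.
  move=> _ [Z hZ ->] g; apply: (tower_skew (Q := fun o => List.In o Zs)) => //.
    by move=> o ho v hv; apply: closedby_in ho hv.
  by move=> o ho; exists o => // m; exact: hT.
have G1c : closedby (ops Zs) (layerZ idfun s') by apply: comm_closed.
have G2c : closedby (ops Zs) (layerx idfun s').
  by apply: comm_closed => // Z hZ m; rewrite /= Zs_u // Zs_d.
have [e1 he1] : exists e1, forall w, layerZ idfun s' w -> addspan zero e1 w.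
  apply: (tower_fd G0s (n := 1) (e := s')) => // g hg.
  by exists g; rewrite //= subrr.
have [n2 hn2] := x_int G1c.
have [e2 he2] := tower_fd G1s hn2 he1.
have [n3 hn3] := y_int G2c.
have [e3 he3] := tower_fd G2s hn3 he2.
have [pd pd0 hpd] := d_algebraic.
have [e4 he4] := tower_fd G3s (fun g hg => algebraic_integral G3s pd0 hpd hg) he3.
have [pu pu0 hpu] := u_algebraic.
have [e5 he5] := tower_fd G4s (fun g hg => algebraic_integral G4s pu0 hpu hg) he4.
have hall m : addspan zero e5 m.
  apply: he5; apply: hs; first exact: (layeru_submodule beta0 Id Iu s').
  move=> v /hss'; apply: addspan_min.
  - by case: (layeru_closed beta0 Id Iu s').
  - by move=> w ->; apply: subspace0; case: (layeru_closed beta0 Id Iu s').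
  - by move=> w; exact: layeru_mem.
apply/(artinian_inT (W := fun=> True)) => // C hC _ hm.
apply: (bounded_codim_stable (i0 := 0%N) (e := e5) hC hm) => j _ m _.
apply: addspan_mono (hall m); first exact: submodule_subspace (hC j).
- by move=> w ->; exact: subspace0 (submodule_subspace (hC j)).
- by move=> w hw; apply: addspan_mem => //; exact: submodule_subspace (hC j).
Qed.
End FiniteOrder.

Lemma monic_integral (K : fieldType) (M : lmodType K) (G : M -> Prop) (T : {linear M -> M})
  (p : {poly K}) n g : subspace G -> p \is monic -> size p = n.+1 -> (0 < n)%N ->
  G g -> G (pev T p g) -> tower_upto G T n (iter n T g).
Proof.
move=> Gs pm sp n0 hg hpg; have hS := tower_upto_subspace T Gs n.
have e : pev T p g = \sum_(i < n) p`_i *: iter i T g + iter n T g.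
  rewrite /pev /polyact sp big_ord_recr /=; congr (_ + _).
  by have /monicP := pm; rewrite lead_coefE sp /= => ->; rewrite scale1r.
have -> : iter n T g = pev T p g - \sum_(i < n) p`_i *: iter i T g by rewrite e addrC addKr.
apply: (subspaceB hS).
  by apply: (tower_upto_mono Gs n0); exact: (tower_upto_iter T Gs 0).
apply: subspace_sum => // i _; apply: (subspaceZ _ hS).
by apply: (tower_upto_mono Gs (ltn_ord i)); exact: tower_upto_iter.
Qed.

Section DegenerateCase.
Variables (K : fieldType) (alpha beta gamma : K).
Hypothesis beta0 : beta != 0.
Variable M : DUModule alpha beta gamma.
Local Notation d := (dum_d M).
Local Notation u := (dum_u M).
Local Notation x := (dux M).
Local Notation y := (duy M).
Hypothesis hfg : fin_generated M.
Hypothesis hmono : monolithic M.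
Variables (N : nat) (a zeta : K) (xi : {linear M -> M}).
Hypothesis N0 : (0 < N)%N.
Hypothesis zetaN : zeta ^+ N = 1.
Hypothesis hx : forall m, x m = a *: m + xi m.
Hypothesis hy : forall m, y m = a *: m + zeta *: xi m.

Let zeta0 : zeta != 0.
Proof. by apply: contra_eq_neq zetaN => ->; rewrite expr0n eqn0Ngt N0 eq_sym oner_neq0. Qed.

Lemma d_xi m : d (xi m) = zeta *: xi (d m).
Proof.
have := d_x m; rewrite hx hy linearD linearZ /=; exact: addrI.
Qed.

Lemma xi_u m : xi (u m) = zeta *: u (xi m).
Proof.
by have := u_y m; rewrite hx hy linearD !linearZ /= => /addrI ->.
Qed.

Lemma d_iter_xi k m : d (iter k xi m) = zeta ^+ k *: iter k xi (d m).
Proof.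
elim: k m => [|k IH] m; first by rewrite scale1r.
by rewrite iterSr IH d_xi iter_linZ scalerA -exprSr -iterSr.
Qed.

Lemma iter_xi_u k m : iter k xi (u m) = zeta ^+ k *: u (iter k xi m).
Proof.
elim: k => [|k IH] //=; first by rewrite scale1r.
by rewrite IH linearZ /= xi_u scalerA -exprSr.
Qed.

Lemma iter_d_xi k m : iter k d (xi m) = zeta ^+ k *: xi (iter k d m).
Proof.
elim: k => [|k IH] /=; first by rewrite scale1r.
by rewrite IH linearZ /= d_xi scalerA -exprSr.
Qed.

Lemma xi_iter_u k m : xi (iter k u m) = zeta ^+ k *: iter k u (xi m).
Proof.
elim: k => [|k IH] /=; first by rewrite scale1r.
by rewrite xi_u IH linearZ /= scalerA -exprS.
Qed.

(** Here [d xi = zeta xi d], so [xi^N] is central, and it equals both [(x - a)^N] and [(y - a)^N]: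
    this is the integrality of [x] and [y]. *)
Lemma degenerate_artinian : artinian M.
Proof.
have zN1 : zeta ^+ N.-1 * zeta = 1 by rewrite -exprSr prednK.
pose Z : {linear M -> M} := iterop xi N.
have hZd m : Z (d m) = d (Z m) by rewrite d_iter_xi zetaN scale1r.
have hZu m : Z (u m) = u (Z m) by rewrite /= /iterop iter_xi_u zetaN scale1r.
have pow (T : {linear M -> M}) k m : (forall m, T m - a *: m = k *: xi m) ->
    k ^+ N = 1 -> pev T (('X - a%:P) ^+ N) m = Z m.
  move=> hT hk; have -> : Z m = k ^+ N *: iter N xi m by rewrite hk scale1r.
  elim: (N) {hk} m => [|n IH] m; first by rewrite pev1 scale1r.
  by rewrite exprSr pevM pevBl pevX pevC hT linearZ /= IH scalerA -iterSr -exprS.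
apply: (@finite_order_artinian _ _ _ _ beta0 M hfg hmono N N0 _ _ [:: Z]).
- by move=> m; rewrite hy hx iter_linD !iter_linZ iter_d_xi scalerA mulrC zN1 scale1r.
- by move=> m; rewrite hx hy iter_linD !iter_linZ xi_iter_u scalerA mulrC zN1 scale1r.
- by move=> Z1 Z2 [<-|//] [<-|//].
- by move=> Z1 [<-|//].
- by move=> Z1 [<-|//].
- move=> G hG; have Gs : subspace G by case: hG.
  exists N => g hg; apply: (monic_integral (p := ('X - a%:P) ^+ N)) => //.
  + by rewrite monic_exp // monicXsubC.
  + by rewrite size_exp_XsubC.
  rewrite (pow _ 1) ?expr1n //; first exact: (closedby_in (o := Z) hG (or_introl erefl) hg).
  by move=> m; rewrite hx scale1r addrC addKr.
- move=> G hG; have Gs : subspace G by case: hG.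
  exists N => g hg; apply: (monic_integral (p := ('X - a%:P) ^+ N)) => //.
  + by rewrite monic_exp // monicXsubC.
  + by rewrite size_exp_XsubC.
  rewrite (pow _ zeta) //; first exact: (closedby_in (o := Z) hG (or_introl erefl) hg).
  by move=> m; rewrite hy addrC addKr.
Qed.
End DegenerateCase.

(** * The action of K[x,y] and the orbit of x *)

Section Action.
Variables (K : fieldType) (alpha beta gamma : K).
Variable M : DUModule alpha beta gamma.
Local Notation d := (dum_d M).
Local Notation u := (dum_u M).
Local Notation x := (dux M).
Local Notation y := (duy M).
Local Notation R := {poly {poly K}}.
(** Polynomials in [y] over [K[x]]. Unlike an operator, a polynomial acts on all modules at once, as
    is needed when passing from a module to a submodule. *)
Definition ract (r : R) (m : M) : M := polyact (pev x) y r m.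

Let pevxy p m : y (pev x p m) = pev x p (y m).
Proof. by apply: pev_commute => v; rewrite xy_comm. Qed.

Lemma ractD r s m : ract (r + s) m = ract r m + ract s m.
Proof. by apply: polyactDl => *; rewrite ?pevDl ?linearD. Qed.
Lemma ractM r s m : ract (r * s) m = ract r (ract s m).
Proof.
by apply: polyactM => *; rewrite ?pevDl ?pevM ?pev1 ?linearD ?pevxy.
Qed.
Lemma ractC p m : ract p%:P m = pev x p m.
Proof. by apply: polyactC => *; rewrite ?pevDl. Qed.
Lemma ractX m : ract 'X m = y m.
Proof. by apply: (polyactX (A := pev x)) => *; rewrite ?pevDl ?pev1. Qed.
Lemma ractDr r v w : ract r (v + w) = ract r v + ract r w.
Proof. by apply: polyactDr => *; rewrite ?pevDl ?linearD. Qed.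
Lemma ractZ r k v : ract r (k *: v) = k *: ract r v.
Proof. by rewrite -[k *: v](pevC x) -[k *: ract _ _](pevC x) -!ractC -!ractM mulrC. Qed.
Lemma ract_linear r : linear (ract r).
Proof. by move=> k v w; rewrite ractDr ractZ. Qed.
HB.instance Definition _ r := GRing.isLinear.Build K M M _ (ract r) (ract_linear r).
Lemma ractN r m : ract (- r) m = - ract r m.
Proof. by apply/eqP; rewrite -addr_eq0 -ractD addNr /ract polyact0l. Qed.
Lemma ract0 m : ract 0 m = 0.
Proof. by rewrite /ract polyact0l. Qed.
Lemma ract1 m : ract 1 m = m.
Proof. by rewrite -[1]/(1%:P%:P) ractC pev1. Qed.
Lemma ract_comm r s m : ract r (ract s m) = ract s (ract r m).
Proof. by rewrite -!ractM mulrC. Qed.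

Definition lincomb a b e : R := (a *: 'X + e%:P)%:P + b%:P%:P * 'X.

Lemma lincombE a b e m : ract (lincomb a b e) m = a *: x m + b *: y m + e *: m.
Proof.
by rewrite ractD ractC pevDl pevZl pevX pevC ractM ractX ractC pevC addrAC.
Qed.

Lemma d_lincomb a b e m :
  d (ract (lincomb a b e) m) = ract (lincomb (b * beta) (a + b * alpha) (e + b * gamma)) (d m).
Proof.
rewrite !lincombE !linearD !linearZ_LR d_x d_y !scalerDl !scalerDr !scalerA !addrA.
by rewrite [LHS](ACl (3*1*2*5*4)).
Qed.

Lemma lincomb_u a b e m :
  ract (lincomb a b e) (u m) = u (ract (lincomb (b * beta) (a + b * alpha) (e + b * gamma)) m).
Proof.
rewrite !lincombE !linearD !linearZ_LR y_u u_y !scalerDl !scalerDr !scalerA !addrA.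
by rewrite [LHS](ACl (3*1*2*5*4)).
Qed.

(* [sigma^n(x) = A n * x + B n * y + C n] for the automorphism [sigma] with [d r = sigma(r) d]. *)
Fixpoint orbit_coef n : K * K * K :=
  if n is n'.+1 then
    let: (A, B, C) := orbit_coef n' in (B * beta, A + B * alpha, C + B * gamma)
  else (1, 0, 0).

Definition orbit n : R := let: (A, B, C) := orbit_coef n in lincomb A B C.

Lemma orbit0 m : ract (orbit 0) m = x m.
Proof. by rewrite lincombE !scale0r scale1r !addr0. Qed.
Lemma orbit1 m : ract (orbit 1) m = y m.
Proof. by rewrite lincombE !mul0r !addr0 !scale0r scale1r add0r addr0. Qed.

Lemma d_orbit n m : d (ract (orbit n) m) = ract (orbit n.+1) (d m).
Proof. by rewrite /orbit /=; case: (orbit_coef n) => [[A B] C]; exact: d_lincomb. Qed.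

Lemma u_orbit n m : u (ract (orbit n.+1) m) = ract (orbit n) (u m).
Proof. by rewrite /orbit /=; case: (orbit_coef n) => [[A B] C]; rewrite lincomb_u. Qed.

(** A polynomial in an auxiliary variable with roots [s^i(x)]; moving [d] or [u] across its
    coefficients translates the indices of the roots. *)
Definition orbit_poly (s : seq nat) : {poly R} := \prod_(i <- s) ('X - (orbit i)%:P).

Lemma d_orbit_poly s k m :
  d (ract (orbit_poly s)`_k m) = ract (orbit_poly (map S s))`_k (d m).
Proof.
elim: s k m => [|i s IH] k m.
  by rewrite /orbit_poly !big_nil coef1; case: k => [|k]; rewrite ?mulr1n ?mulr0n ?ract1 ?ract0 ?linear0.
rewrite /orbit_poly /= !big_cons -!/(orbit_poly _) !mulrBl !coefB !coefXM !coefCM.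
case: k => [|k] /=; first by rewrite !sub0r !ractN linearN !ractM d_orbit IH.
by rewrite !ractD !ractN linearB !ractM d_orbit !IH.
Qed.

Lemma u_orbit_poly s k m :
  u (ract (orbit_poly (map S s))`_k m) = ract (orbit_poly s)`_k (u m).
Proof.
elim: s k m => [|i s IH] k m.
  by rewrite /orbit_poly !big_nil coef1; case: k => [|k]; rewrite ?mulr1n ?mulr0n ?ract1 ?ract0 ?linear0.
rewrite /orbit_poly /= !big_cons -!/(orbit_poly _) !mulrBl !coefB !coefXM !coefCM.
case: k => [|k] /=; first by rewrite !sub0r !ractN linearN !ractM u_orbit IH.
by rewrite !ractD !ractN linearB !ractM u_orbit !IH.
Qed.

End Action.

Section PeriodicCase.
Variables (K : fieldType) (alpha beta gamma : K).
Hypothesis beta0 : beta != 0.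
Variable M : DUModule alpha beta gamma.
Local Notation d := (dum_d M).
Local Notation u := (dum_u M).
Local Notation x := (dux M).
Local Notation y := (duy M).
Hypothesis hfg : fin_generated M.
Hypothesis hmono : monolithic M.
Local Notation orbit_coef := (orbit_coef alpha beta gamma).
Local Notation orbit := (orbit alpha beta gamma).
Local Notation orbit_poly := (orbit_poly alpha beta gamma).
Variable N : nat.
Hypothesis N0 : (0 < N)%N.
Hypothesis orbitN : orbit_coef N = (1, 0, 0).

Let F := orbit_poly (iota 0 N).

Let orbit_N0 : orbit N = orbit 0.
Proof. by rewrite /orbit orbitN. Qed.

Let F_shift : orbit_poly (map S (iota 0 N)) = F.
Proof.
rewrite /F; case: (N) N0 orbit_N0 => // n _ h.
rewrite -{1}addn1 iotaD map_cat /orbit_poly big_cat /= [in RHS]big_cons big_cons big_nil mulr1.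
by rewrite -(eq_map add1n) -iotaDl h mulrC.
Qed.

Let rZ k : {linear M -> M} := ract F`_k.
Let Zs := [seq rZ k | k <- iota 0 N].

Let ZsP Z : List.In Z Zs -> exists k, Z = rZ k.
Proof. by rewrite /Zs; elim: (iota 0 N) => [|k s IH] //= [<-|/IH //]; exists k. Qed.

Let in_Zs k : (k < N)%N -> List.In (rZ k) Zs.
Proof.
move=> hk; have : k \in iota 0 N by rewrite mem_iota add0n.
rewrite /Zs; elim: (iota 0 N) => [|j s IH] //; rewrite in_cons => /orP [/eqP <-|/IH]; by [left|right].
Qed.

Lemma iter_d_orbit k n m : iter k d (ract (orbit n) m) = ract (orbit (k + n)) (iter k d m).
Proof. by elim: k => //= k ->; rewrite d_orbit. Qed.
Lemma iter_u_orbit k n m : iter k u (ract (orbit (k + n)) m) = ract (orbit n) (iter k u m).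
Proof. by elim: k n => //= k IH n; rewrite addSnnS IH u_orbit. Qed.

Lemma orbit_integral (T : {linear M -> M}) j : (forall m, T m = ract (orbit j) m) -> (j < N)%N ->
  forall G, closedby (ops Zs) G -> exists n, forall g, G g -> tower_upto G T n (iter n T g).
Proof.
move=> hT hj G hG; have Gs : subspace G by case: hG.
exists N => g hg.
have szF : size F = N.+1 by rewrite /F /orbit_poly size_prod_XsubC size_iota.
have /monicP : F \is monic by apply: monic_prod => i _; exact: monicXsubC.
rewrite lead_coefE szF /= => lcF.
have iterT k m : iter k T m = ract (orbit j ^+ k) m.
  elim: k => [|k IH] /=; first by rewrite ract1.
  by rewrite IH exprS ractM hT.
have /eqP : F.[orbit j] = 0.
  rewrite /F /orbit_poly -(big_map _ predT (fun c => 'X - c%:P)).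
  by apply/eqP; rewrite -[_ == 0]/(root _ _) root_prod_XsubC; apply: map_f; rewrite mem_iota add0n.
rewrite horner_coef szF big_ord_recr /= lcF mul1r addrC addr_eq0 => /eqP e.
rewrite iterT e ractN; have hS := tower_upto_subspace T Gs N; apply: (subspaceN hS).
have -> : ract (\sum_(i < N) F`_i * orbit j ^+ i) g = \sum_(i < N) iter i T (rZ i g).
  rewrite (big_morph (fun r => ract r g) (fun a b => ractD a b g) (_ : ract 0 g = 0)).
    by apply: eq_bigr => i _; rewrite ractM iterT ract_comm.
  exact: ract0.
apply: subspace_sum => // i _.
apply: (tower_upto_mono Gs (ltn_ord i)); apply: tower_upto_iter => //.
by apply: (closedby_in (o := rZ i) hG _ hg); exact: in_Zs.
Qed.

(** The coefficients of the product over a full orbit of [x] are invariant under [s], hence central,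
    and [x] and [y = s(x)] are roots of this monic polynomial. *)
Lemma periodic_artinian : artinian M.
Proof.
have N1 : (1 < N)%N.
  by case: (N) N0 orbitN => [|[|n]] //= _ [] /eqP; rewrite mul0r eq_sym oner_eq0.
apply: (@finite_order_artinian _ _ _ _ beta0 M hfg hmono N N0 _ _ Zs).
- by move=> m; rewrite -orbit1 iter_d_orbit addn1 prednK // orbit_N0 orbit0.
- by move=> m; have := iter_u_orbit N.-1 1 m; rewrite addn1 prednK // orbit_N0 orbit0 orbit1.
- by move=> Z Z' /ZsP [k ->] /ZsP [k' ->] m; exact: ract_comm.
- by move=> Z /ZsP [k ->] m; rewrite /rZ /= d_orbit_poly F_shift.
- by move=> Z /ZsP [k ->] m; rewrite /rZ /= -u_orbit_poly F_shift.
- by apply: (orbit_integral (j := 0)) => // m; rewrite orbit0.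
- by apply: (orbit_integral (j := 1)) => // m; rewrite orbit1.
Qed.
End PeriodicCase.

Section Separable.
Variable (F : fieldType).
Hypothesis char0 : [pchar F] =i pred0.

Lemma size_deriv_pchar0 (p : {poly F}) : size p^`() = (size p).-1.
Proof.
have [|] := leqP (size p) 1.
  move=> h; rewrite [p]size1_polyC // derivC size_poly0; case: (size _) (size_polyC_leq1 p`_0) => [|[]] //.
move=> h; rewrite /deriv size_poly_eq // -(mulr_natr p`_(_.+1)).
have e : (size p).-2.+2 = size p by case: (size p) h => [|[]].
have -> : (size p).-2.+1 = (size p).-1 by case: (size p) h => [|[]].
rewrite mulf_neq0 //; first by rewrite -lead_coefE lead_coef_eq0 -size_poly_gt0 ltnW.
have := pcharf0P F; case=> [h0 _]; rewrite (h0 char0).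
by case: (size p) h => [|[]].
Qed.

Lemma separable_comp_exp (p : {poly F}) N : (0 < N)%N -> coprimep p p^`() -> p.[0] != 0 ->
  separable_poly (p \Po 'X^N).
Proof.
move=> N0 sp p0; rewrite unlock deriv_comp derivXn coprimepMr coprimep_comp_poly //=.
rewrite -(mulr_natl 'X^_ N) -polyC_natr mul_polyC coprimepZr; last first.
  by have := pcharf0P F; case=> [h0 _]; rewrite (h0 char0) -lt0n.
case: N N0 => // -[|n] _; first by rewrite coprimep1.
rewrite -[n.+2.-1]/n.+1 coprimep_pexpr //; have := coprimep_XsubC (p \Po 'X^(n.+2)) 0; rewrite subr0 => ->.
by rewrite /root horner_comp hornerXn expr0n.
Qed.
End Separable.

(** * Reduction to a separable equation for c *)

Section CentralReduction.
Variables (K : fieldType) (alpha beta gamma : K).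
Hypothesis char0 : [pchar K] =i pred0.
Hypothesis beta0 : beta != 0.
Variables (rc : {poly {poly K}}) (zeta : K) (N : nat).
Hypothesis N0 : (0 < N)%N.
Hypothesis zetaN : zeta ^+ N = 1.
Local Notation DU := (DUModule alpha beta gamma).
Hypothesis dc : forall (M : DU) m, dum_d M (ract rc m) = zeta *: ract rc (dum_d M m).
Hypothesis cu : forall (M : DU) m, ract rc (dum_u M m) = zeta *: dum_u M (ract rc m).

Lemma sub_ract (M : DU) (W : M -> Prop) (hW : is_submodule W) r (w : subDU hW) :
  \val (ract r w : subDU hW) = ract r (\val w) :> M.
Proof.
elim/poly_ind: r w => [|r p IH] w; first by rewrite !ract0 raddf0.
rewrite !ractD !ractM !ractX !ractC sub_valD IH.
by rewrite (pev_semicommute (T' := dux M) (B := \val : {linear subDU hW -> M})).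
Qed.

Let zeta0 : zeta != 0.
Proof. by apply: contra_eq_neq zetaN => ->; rewrite expr0n eqn0Ngt N0 eq_sym oner_neq0. Qed.

Lemma normal_ract (M : DU) : normal_op (ract rc : {linear M -> M}).
Proof.
split; first by exists zeta; [exact: zeta0 | exact: dc].
by exists zeta^-1; rewrite ?invr_eq0 // => m; rewrite /= cu scalerA mulVf // scale1r.
Qed.

Lemma ract_pow_d (M : DU) (m : M) : iter N (ract rc) (dum_d M m) = dum_d M (iter N (ract rc) m).
Proof.
suff -> k : dum_d M (iter k (ract rc) m) = zeta ^+ k *: iter k (ract rc) (dum_d M m).
  by rewrite zetaN scale1r.
elim: k => [|k IH] /=; first by rewrite scale1r.
by rewrite dc IH linearZ scalerA exprS.
Qed.

Lemma ract_pow_u (M : DU) (m : M) : iter N (ract rc) (dum_u M m) = dum_u M (iter N (ract rc) m).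
Proof.
suff -> k : iter k (ract rc) (dum_u M m) = zeta ^+ k *: dum_u M (iter k (ract rc) m).
  by rewrite zetaN scale1r.
elim: k => [|k IH] /=; first by rewrite scale1r.
by rewrite IH linearZ /= cu scalerA exprSr.
Qed.

(** The alternative on [p0] says that [c] is either zero or invertible on [M]. *)
Hypothesis hcase : forall (M : DU) p0, fin_generated M -> monolithic M ->
  separable_poly p0 -> p0 = 'X \/ p0.[0] != 0 -> (forall m, pev (ract rc : M -> M) p0 m = 0) ->
  artinian M.

(** Let [P] be a polynomial of least degree with [P(c^N) s0 = 0]. The normal operator whose kernel
    is taken is [c] when [P(0) = 0], and [P(c^N)] otherwise; it kills [s0], hence is nilpotent. *)
Theorem central_reduction (M : DU) : fin_generated M -> monolithic M -> artinian M.
Proof.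
move=> hfg hmono; have hacc := fin_generated_acc beta0 hfg.
have [s0 s00 hmin] := hmono.
pose c : {linear M -> M} := ract rc; pose Z : {linear M -> M} := iterop c N.
have Zd m : Z (dum_d M m) = dum_d M (Z m) := ract_pow_d m.
have Zu m : Z (dum_u M m) = dum_u M (Z m) := ract_pow_u m.
have norm_pev P : normal_op (pev Z P : {linear M -> M}).
  split; exists 1; rewrite ?oner_neq0 // => m; rewrite scale1r.
    by rewrite (pev_commute (B := dum_d M)).
  by rewrite (pev_commute (B := dum_u M)).
have finish (phi : {linear M -> M}) p0 : normal_op phi -> phi s0 = 0 -> separable_poly p0 ->
    p0 = 'X \/ p0.[0] != 0 -> (forall m, phi m = pev c p0 m) -> artinian M.
  move=> hphi hs0 hsep hp0 e.
  have [n hn] := normal_nilpotent hmin s00 hacc hphi hs0.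
  have hW := normal_ker 1 hphi; apply: (normal_artinian hphi) hn.
  apply: (@sub_artinian _ _ _ _ M _ hW); apply: (hcase (p0 := p0)) => //.
  - exact: sub_fin_generated.
  - by apply: sub_monolithic => //; exists s0.
  move=> w; apply: val_inj; rewrite raddf0.
  have -> := pev_semicommute (T' := c) (B := \val : {linear subDU hW -> M}) p0 w (sub_ract rc).
  by rewrite -e; exact: (sub_valP w).
have [p1 p10 hp1] := central_algebraic beta0 hfg hmono Zd Zu.
have exP : exists n, `[< exists P : {poly K}, [/\ P != 0, pev Z P s0 = 0 & size P = n] >].
  by exists (size p1); apply/asboolP; exists p1.
case: (ex_minnP exP) => n /asboolP [P [P0 hP sP]] hPmin.
have small (h : {poly K}) : h != 0 -> (size h < size P)%N -> pev Z h s0 <> 0.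
  move=> h0 hs e; have := hPmin (size h); rewrite leqNgt -sP hs => H.
  by have := H (introT (asboolP _) (ex_intro _ h (And3 h0 e erefl))).
(* [h(Z) s0] would be a nonzero vector in the kernel of [g(Z)], a submodule, which would then
   contain [s0], against minimality. Applied to the gcd of [P] and its derivative, this yields
   separability. *)
have nofactor (g h : {poly K}) : P = g * h -> (size g < size P)%N -> (size h < size P)%N -> False.
  move=> e sg sh; have : pev Z g s0 <> 0.
    by apply: small sg; apply: contraNneq P0 => g0; rewrite e g0 mul0r.
  apply; have := hmin _ (normal_ker 1 (norm_pev g)); apply; exists (pev Z h s0).
    by rewrite /= -pevM -e.
  by apply: small sh; apply: contraNneq P0 => g0; rewrite e g0 mulr0.
have sP1 : (1 < size P)%N.
  rewrite ltnNge; apply/negP => hs; apply: s00; exact: (pev_eq0_size hs P0 hP).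
have [P00|P00] := eqVneq P.[0] 0.
  have /factor_theorem [h e] : root P 0 by rewrite /root P00.
  have h0 : h != 0 by apply: contraNneq P0 => h0; rewrite e h0 mul0r.
  have hh : pev Z h s0 <> 0.
    by apply: (small h h0); rewrite e subr0 size_mulX.
  (* [c^N] kills the nonzero vector [h(Z) s0]; its last nonzero image under powers of [c] shows that
     the kernel of [c] is nonzero, so it contains [s0]. *)
  have [k [hk1 hk2]] : exists k, iter k c (pev Z h s0) <> 0 /\ c (iter k c (pev Z h s0)) = 0.
    have : iter N c (pev Z h s0) = 0.
      by move: hP; rewrite e subr0 mulrC pevM pevX.
    elim: (N) => [|k IH] //= e1; have [e2|e2] := pselect (iter k c (pev Z h s0) = 0); first exact: IH.
    by exists k.
  apply: (finish c 'X (normal_ract M)); last by move=> m; rewrite pevX.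
  - by apply: (hmin _ (normal_ker 1 (normal_ract M))); exists (iter k c (pev Z h s0)).
  - by rewrite unlock derivX coprimep1.
  - by left.
apply: (finish (pev Z P) (P \Po 'X^N)) => //.
- apply: separable_comp_exp => //; rewrite coprimep_def; apply/eqP.
  have hd : P^`() != 0 by rewrite -size_poly_gt0 size_deriv_pchar0 // -ltnS prednK // ltnW.
  have /dvdpP [h e] := dvdp_gcdl P P^`().
  have sg : (size (gcdp P P^`()) < size P)%N.
    apply: leq_ltn_trans (dvdp_leq hd (dvdp_gcdr P P^`())) _.
    by rewrite size_deriv_pchar0 // prednK // ltnW.
  have h0 : h != 0 by apply: contraNneq P0 => h0; rewrite e h0 mul0r.
  have g0 : gcdp P P^`() != 0 by rewrite gcdp_eq0 negb_and P0.
  apply/eqP; rewrite eqn_leq size_poly_gt0 g0 andbT leqNgt; apply/negP => sg1.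
  apply: (nofactor h (gcdp P P^`()) e) => //.
  rewrite {1}e size_mul //; move: sg1; rewrite -(size_poly_gt0 h) in h0.
  by case: (size h) h0 => // a _; case: (size _) => [|[|b]] // _; rewrite addSn !addnS ltnS /= ltnS leq_addr.
- by right; rewrite horner_comp hornerXn expr0n; case: (N) N0.
move=> m; rewrite pev_comp; apply: eq_pev => v /=.
by rewrite pevXn.
Qed.
End CentralReduction.

(** * Eliminating c *)

Section Elimination.
Variables (K : fieldType) (M : lmodType K) (c t : {linear M -> M}) (Q : M -> Prop).
Hypothesis ct : forall m, c (t m) = t (c m).
Hypothesis hQ : ctclosed t c Q.
Let Qs : subspace Q. Proof. by case: hQ. Qed.
Let Qc m : Q m -> Q (c m). Proof. by case: hQ => _ h _; apply: h. Qed.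
Let Qt m : Q m -> Q (t m). Proof. by case: hQ => _ _; apply. Qed.

(** Modulo [Q], the operator [c] acts on [w] as [-phi(t)], and substituting this in [p(c) w = 0]
    leaves a polynomial in [t] alone. *)
Lemma eliminate_comp (p phi : {poly K}) w :
  Q (c w + pev t phi w) -> pev c p w = 0 -> Q (pev t (p \Po (- phi)) w).
Proof.
move=> hw hp; have hc q m : c (pev t q m) = pev t q (c m) by exact: pev_commute.
suff: Q (pev c p w - pev t (p \Po (- phi)) w).
  by rewrite hp sub0r => /(subspaceN Qs); rewrite opprK.
elim/poly_ind: p {hp} => [|p k IH]; first by rewrite comp_poly0 !pev0 subrr; exact: subspace0.
rewrite comp_polyD comp_polyM comp_polyX comp_polyC !pevDl !pevC opprD addrACA subrr addr0 !pevM pevX pevNl linearN opprK.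
rewrite -(pev_commute (B := c)) // -(subrK (c (pev t (p \Po (- phi)) w)) (c (pev c p w))).
rewrite -linearB /= -addrA hc -pevDr; apply: (subspaceD Qs); first exact: Qc.
exact: pev_stable.
Qed.

(** [t^n p(-k/t)] with [n] the degree of [p]: the result of eliminating [c] between [p(c) = 0] and
    [k + c t = 0]. *)
Definition rev_scale (k : K) (p : {poly K}) : {poly K} :=
  \poly_(j < size p) (p`_((size p).-1 - j) * (- k) ^+ ((size p).-1 - j)).

Lemma rev_scale_neq0 k (p : {poly K}) : p.[0] != 0 -> rev_scale k p != 0.
Proof.
move=> h; have p0 : (0 < size p)%N by rewrite size_poly_gt0; apply: contraNneq h => ->; rewrite horner0.
apply: contraNneq h => e; have := congr1 (fun q : {poly K} => q`_(size p).-1) e.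
by rewrite coef_poly prednK // leqnn subnn mulr1 coef0 -horner_coef0 => ->.
Qed.

(** Multiplying [p(c) w] by [t^n] pairs each [c] with a [t], and modulo [Q] the vector [(c t)^i w]
    is [(-k)^i w]. *)
Lemma eliminate_rev (p : {poly K}) k w :
  Q (k *: w + c (t w)) -> pev c p w = 0 -> Q (pev t (rev_scale k p) w).
Proof.
move=> hw hp; set n := (size p).-1.
have hct i : Q (iter i (c \o t) w - (- k) ^+ i *: w).
  elim: i => [|i IH] /=; first by rewrite scale1r subrr; exact: subspace0.
  rewrite -(subrK (c (t ((- k) ^+ i *: w))) (c _)) -!linearB /= -addrA; apply: (subspaceD Qs); first exact/Qc/Qt.
  by rewrite !linearZ /= exprSr -scalerA -scalerDr scaleNr scalerN opprK addrC; exact: subspaceZ.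
have it i m : iter i t (iter i c m) = iter i (c \o t) m.
  have hi j v : iter j t (c v) = c (iter j t v) by elim: j => //= j ->; rewrite ct.
  by elim: i m => [|i IH] m //=; rewrite hi IH ct.
have [->|p0] := eqVneq p 0; first by rewrite /rev_scale size_poly0 poly_def big_ord0 pev0; exact: subspace0.
have sp : size p = n.+1 by rewrite prednK // size_poly_gt0.
have e : pev t (rev_scale k p) w = \sum_(i < n.+1) p`_i *: ((- k) ^+ i *: iter (n - i) t w).
  rewrite /pev (@polyact_widen _ _ _ _ _ n.+1) //; try by move=> *; rewrite ?scaler0 ?scalerDl ?scale0r ?linearD.
    by rewrite (reindex_inj rev_ord_inj) /=; apply: eq_bigr => i _; rewrite coef_poly sp subSS -/n ltnS leq_subr /= subKn ?scalerA // -ltnS.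
  by rewrite -sp size_poly.
have {}hp : 0 = \sum_(i < n.+1) p`_i *: iter (n - i) t (iter i (c \o t) w).
  transitivity (pev t 'X^n (pev c p w)); first by rewrite hp linear0.
  rewrite [pev c p w]/pev /polyact sp linear_sum; apply: eq_bigr => i _.
  by rewrite linearZ /= pevXn -it -iterD subnK // -ltnS; exact: ltn_ord.
rewrite e -[X in Q X]opprK; apply: (subspaceN Qs); rewrite -[- _]sub0r [X in Q (X - _)]hp -sumrB.
apply: subspace_sum => // i _; rewrite -scalerBr; apply: (subspaceZ _ Qs).
rewrite -iter_linZ -iter_linB; elim: (n - i)%N => //= j; exact: Qt.
Qed.
End Elimination.

Section Skew.
Variables (K : fieldType) (alpha beta gamma : K).
Hypothesis char0 : [pchar K] =i pred0.
Hypothesis beta0 : beta != 0.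
Variables (rc : {poly {poly K}}) (zeta : K) (N : nat).
Hypothesis N0 : (0 < N)%N.
Hypothesis zetaN : zeta ^+ N = 1.
Local Notation DU := (DUModule alpha beta gamma).
Hypothesis dc : forall (M : DU) m, dum_d M (ract rc m) = zeta *: ract rc (dum_d M m).
Hypothesis cu : forall (M : DU) m, ract rc (dum_u M m) = zeta *: dum_u M (ract rc m).

Let zeta0 : zeta != 0.
Proof. by apply: contra_eq_neq zetaN => ->; rewrite expr0n eqn0Ngt N0 eq_sym oner_neq0. Qed.

Lemma ract_stable (M : DU) X r : is_submodule X -> forall m : M, X m -> X (ract r m).
Proof.
move=> hX; have Xs := submodule_subspace hX; elim/poly_ind: r => [|r p IH] m hm.
  by rewrite ract0; exact: subspace0.
rewrite ractD ractM ractX ractC; apply: (subspaceD Xs).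
  by apply: IH; apply: (submodule_d hX); apply: (submodule_u hX).
by apply: pev_stable => // v hv; apply: (submodule_u hX); apply: (submodule_d hX).
Qed.

Lemma ract_skew_artinian (M : DU) (rt : {poly {poly K}}) (x0 x1 x2 y0 y1 y2 Gx Gy p0 : {poly K}) :
  fin_generated M -> monolithic M ->
  (forall m, dum_d M (ract rt m) = ract rt (dum_d M m) + dum_d M m) ->
  (forall m, ract rt (dum_u M m) = dum_u M (ract rt m) + dum_u M m) ->
  let c : {linear M -> M} := ract rc in let t : {linear M -> M} := ract rt in
  (forall m, dux M m = pev c x0 m + pev c x1 (t m) + pev c x2 (t (t m))) ->
  (forall m, duy M m = pev c y0 m + pev c y1 (t m) + pev c y2 (t (t m))) ->
  Gx != 0 -> Gy != 0 ->
  (forall Q, ctclosed t c Q -> forall w, Q (dux M w) -> Q (pev t Gx w)) ->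
  (forall Q, ctclosed t c Q -> forall w, Q (duy M w) -> Q (pev t Gy w)) ->
  separable_poly p0 -> (forall m, pev c p0 m = 0) -> artinian M.
Proof.
move=> hfg [s0 s00 hmin] dt tu c t hx hy Gx0 Gy0 starx stary hsep hp0.
apply: (skew_artinian char0 (fin_generated_acc beta0 hfg) s00 hmin zeta0 (c := c) (t := t)
  _ dt _ (dc (M := M)) _ hx hy Gx0 Gy0 starx stary _ hsep hp0).
- by move=> m; exact: ract_comm.
- by move=> m; rewrite /t /= tu addrK.
- by move=> m; rewrite /c /= cu scalerA mulVf // scale1r.
move=> X hX; split; first exact: submodule_subspace.
- by move=> m; exact: ract_stable.
- by move=> m; exact: ract_stable.
Qed.

Definition quad (a0 a1 a2 : K) : {poly K} := a0%:P + a1 *: 'X + a2 *: 'X^2.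

Lemma pev_quad (M : lmodType K) (t : {linear M -> M}) a0 a1 a2 m :
  pev t (quad a0 a1 a2) m = a0 *: m + a1 *: t m + a2 *: t (t m).
Proof. by rewrite !pevDl !pevZl pevC pevX pevXn. Qed.

Lemma size_quad a0 a1 a2 : (a1 != 0) || (a2 != 0) -> (1 < size (quad a0 a1 a2))%N.
Proof.
move=> h; rewrite ltnNge; apply/negP => /leq_sizeP hs.
have := hs 1%N isT; have := hs 2%N isT.
rewrite /quad !coefD !coefZ !coefC !coefX !coefXn /= !mulr0 !mulr1 !add0r !addr0 => e2 e1.
by rewrite e1 e2 eqxx in h.
Qed.

Lemma scale_comp_neq0 (p phi : {poly K}) k : p != 0 -> k != 0 -> (1 < size phi)%N ->
  p \Po (- (k *: phi)) != 0.
Proof. by move=> p0 k0 h; rewrite comp_poly_eq0 // size_polyN size_scale. Qed.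

(** With [c] linear in [x] and [y] the eliminants are [p0] composed with a multiple of a quadratic
    in [t]; they are nonzero because the quadratics are not constant. *)
Theorem linear_skew_artinian (rt : {poly {poly K}}) (b a0 a1 a2 b' a0' a1' a2' : K) :
  b != 0 -> (a1 != 0) || (a2 != 0) -> b' != 0 -> (a1' != 0) || (a2' != 0) ->
  (forall (M : DU) m, dum_d M (ract rt m) = ract rt (dum_d M m) + dum_d M m) ->
  (forall (M : DU) m, ract rt (dum_u M m) = dum_u M (ract rt m) + dum_u M m) ->
  (forall (M : DU) m, dux M m = b *: ract rc m + pev (ract rt : M -> M) (quad a0 a1 a2) m) ->
  (forall (M : DU) m, duy M m = b' *: ract rc m + pev (ract rt : M -> M) (quad a0' a1' a2') m) ->
  forall M : DU, fin_generated M -> monolithic M -> artinian M.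
Proof.
move=> hb ha hb' ha' dt tu hx hy.
apply: (central_reduction char0 beta0 N0 zetaN dc cu) => M p0 hfg hmono hsep _ hp0.
have p00 := separable_poly_neq0 hsep.
have star k e0 e1 e2 (hk : k != 0) (T : M -> M) :
    (forall m, T m = k *: ract rc m + pev (ract rt : M -> M) (quad e0 e1 e2) m) ->
    forall Q, ctclosed (ract rt : M -> M) (ract rc) Q -> forall w, Q (T w) ->
    Q (pev (ract rt : M -> M) (p0 \Po (- (k^-1 *: quad e0 e1 e2))) w).
  move=> hT Q hQ w hw; apply: (eliminate_comp _ hQ _ (hp0 w)); first by move=> m; exact: ract_comm.
  case: hQ => Qs _ _; apply: (subspace_scaleK Qs hk).
  by rewrite scalerDr pevZl scalerA mulfV // scale1r -hT.
apply: (ract_skew_artinian (x0 := b *: 'X + a0%:P) (x1 := a1%:P) (x2 := a2%:P)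
  (y0 := b' *: 'X + a0'%:P) (y1 := a1'%:P) (y2 := a2'%:P)
  (Gx := p0 \Po (- (b^-1 *: quad a0 a1 a2))) (Gy := p0 \Po (- (b'^-1 *: quad a0' a1' a2')))
  hfg hmono (dt M) (tu M) _ _ _ _ _ _ hsep hp0).
- by move=> m; rewrite hx pev_quad !pevDl !pevC pevZl pevX !addrA.
- by move=> m; rewrite hy pev_quad !pevDl !pevC pevZl pevX !addrA.
- by apply: scale_comp_neq0 => //; rewrite ?invr_eq0 // size_quad.
- by apply: scale_comp_neq0 => //; rewrite ?invr_eq0 // size_quad.
- exact: (star _ _ _ _ hb _ (hx M)).
- exact: (star _ _ _ _ hb' _ (hy M)).
Qed.
End Skew.

(** * Explicit pairs c, t *)

Section Cases.
Variables (K : fieldType) (alpha beta gamma : K).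
Hypothesis char0 : [pchar K] =i pred0.
Hypothesis beta0 : beta != 0.
Variables (N : nat).
Hypothesis N0 : (0 < N)%N.
Local Notation DU := (DUModule alpha beta gamma).

Lemma ract_scale (M : DU) k (m : M) : ract k%:P%:P m = k *: m.
Proof. by rewrite ractC pevC. Qed.

Lemma ract_lincomb_eq (M : DU) a b e a' b' e' (m : M) : a = a' -> b = b' -> e = e' ->
  ract (lincomb a b e) m = ract (lincomb a' b' e') m.
Proof. by move=> -> -> ->. Qed.

Lemma ract_lincombZ (M : DU) k a b e (m : M) :
  k *: ract (lincomb a b e) m = ract (lincomb (k * a) (k * b) (k * e)) m.
Proof. by rewrite !lincombE !scalerDr !scalerA. Qed.

Lemma ract_lincombD (M : DU) a b e a' b' e' (m : M) :
  ract (lincomb a b e) m + ract (lincomb a' b' e') m = ract (lincomb (a + a') (b + b') (e + e')) m.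
Proof. by rewrite !lincombE !scalerDl !addrA [LHS](ACl (1*4*2*5*3*6)). Qed.

Lemma ract_lincomb1 (M : DU) (m : M) : ract (lincomb 0 0 1) m = m.
Proof. by rewrite lincombE !scale0r !add0r scale1r. Qed.

Lemma dux_lincomb (M : DU) (m : M) : dux M m = ract (lincomb 1 0 0) m.
Proof. by rewrite lincombE !scale0r scale1r !addr0. Qed.

Lemma duy_lincomb (M : DU) (m : M) : duy M m = ract (lincomb 0 1 0) m.
Proof. by rewrite lincombE !scale0r scale1r addr0 add0r. Qed.

(** The roots are 1 and [q = - beta]. With [g = gamma / (1 - q)], the element [c = y - x - g]
    satisfies [s(c) = q c], and [t = (x - c / (q - 1)) / g] satisfies [s(t) = t + 1]. Solving back,
    [x = c / (q - 1) + g t] and [y = q c / (q - 1) + g t + g]. *)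
Theorem artinian_root_one : 1 - alpha - beta = 0 -> beta != -1 -> gamma != 0 -> (- beta) ^+ N = 1 ->
  forall M : DU, fin_generated M -> monolithic M -> artinian M.
Proof.
move=> h1 hb g0.
have : beta = - - beta by rewrite opprK.
move: (- beta) => q hbeta hN.
have hal : alpha = 1 + q by apply/eqP; rewrite -subr_eq0 -oppr_eq0 -h1 hbeta; apply/eqP; ring.
have hq : q - 1 != 0 by rewrite subr_eq0; apply: contra_neq hb => h; rewrite hbeta h.
have q0 : q != 0 by rewrite -oppr_eq0 -hbeta.
have hq' : 1 - q != 0 by rewrite -opprB oppr_eq0.
have [g gg hgam] : exists2 g, g != 0 & gamma = g * (1 - q).
  by exists (gamma / (1 - q)); [rewrite mulf_neq0 ?invr_eq0 | rewrite divfK].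
pose rc : {poly {poly K}} := lincomb (-1) 1 (- g).
pose rt : {poly {poly K}} := lincomb (g^-1 * (1 + (q - 1)^-1)) (- g^-1 * (q - 1)^-1) ((q - 1)^-1).
apply: (@linear_skew_artinian _ alpha beta gamma char0 beta0 rc q N N0 hN _ _ rt
  (q - 1)^-1 0 g 0 (q * (q - 1)^-1) g g 0).
- move=> M m; rewrite d_lincomb ract_lincombZ; apply: ract_lincomb_eq; rewrite ?hal ?hgam ?hbeta; by ring.
- move=> M m; rewrite lincomb_u -linearZ ract_lincombZ; congr (dum_u M _); apply: ract_lincomb_eq; rewrite ?hal ?hgam ?hbeta; by ring.
- by rewrite invr_eq0.
- by rewrite gg.
- by rewrite mulf_neq0 // invr_eq0.
- by rewrite gg.
- move=> M m; rewrite d_lincomb -[X in _ = _ + X]ract_lincomb1 ract_lincombD.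
  by apply: ract_lincomb_eq; rewrite ?hal ?hgam ?hbeta; field; rewrite ?gg ?hq.
- move=> M m; rewrite lincomb_u -linearD -[X in _ = _ (_ + X)]ract_lincomb1 ract_lincombD.
  by congr (dum_u M _); apply: ract_lincomb_eq; rewrite ?hal ?hgam ?hbeta; field; rewrite ?gg ?hq.
- move=> M m; rewrite pev_quad !scale0r add0r addr0 dux_lincomb !ract_lincombZ ract_lincombD.
  by apply: ract_lincomb_eq; field; rewrite ?gg ?hq.
- move=> M m; rewrite pev_quad !scale0r addr0 duy_lincomb -[X in _ + (_ *: X + _)]ract_lincomb1 !ract_lincombZ !ract_lincombD.
  by apply: ract_lincomb_eq; field; rewrite ?gg ?hq.
Qed.

(* Both roots are 1: over [char = 0] the pair [t = (y - x) / gamma], [c = x - gamma t (t - 1) / 2]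
   satisfies [d t = (t + 1) d] and [d c = c d]. *)
Theorem artinian_double_one : alpha = 2%:R -> beta = -1 -> gamma != 0 ->
  forall M : DU, fin_generated M -> monolithic M -> artinian M.
Proof.
move=> hal hbeta g0.
have two0 : 2%:R != 0 :> K by have [h _] := pcharf0P K; rewrite (h char0).
pose rt : {poly {poly K}} := lincomb (- gamma^-1) gamma^-1 0.
pose k := gamma / 2%:R; have k0 : k != 0 by rewrite mulf_neq0 // invr_eq0.
pose rc : {poly {poly K}} := lincomb 1 0 0 - k%:P%:P * (rt * (rt - 1)).
have rcE (M : DU) (m : M) :
    ract rc m = ract (lincomb 1 0 0) m - k *: ract rt (ract rt m) + k *: ract rt m.
  by rewrite ractD ractN ractM ract_scale ractM ractD ractN ract1 linearB /= scalerBr opprB addrCA addrC.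
have dt (M : DU) (m : M) : dum_d M (ract rt m) = ract rt (dum_d M m) + dum_d M m.
  rewrite d_lincomb -[X in _ = _ + X]ract_lincomb1 ract_lincombD.
  by apply: ract_lincomb_eq; rewrite ?hal ?hbeta; field.
have tu (M : DU) (m : M) : ract rt (dum_u M m) = dum_u M (ract rt m) + dum_u M m.
  rewrite lincomb_u -linearD -[X in _ = _ (_ + X)]ract_lincomb1 ract_lincombD.
  by congr (dum_u M _); apply: ract_lincomb_eq; rewrite ?hal ?hbeta; field.
have yx (M : DU) (m : M) :
    ract (lincomb 0 1 0) m = ract (lincomb 1 0 0) m + k *: ract rt m + k *: ract rt m.
  rewrite -addrA -scalerDl ract_lincombZ ract_lincombD.
  by apply: ract_lincomb_eq; rewrite /k; field; rewrite ?two0 ?g0.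
apply: (@linear_skew_artinian _ alpha beta gamma char0 beta0 rc 1 1 isT (expr1n _ _) _ _ rt
  1 0 (- k) k 1 0 k k).
- move=> M m; rewrite scale1r !rcE linearD linearB !linearZ_LR /= (dt M m) (dt M (ract rt m)) (dt M m).
  rewrite d_lincomb (_ : ract _ _ = ract (lincomb 0 1 0) (dum_d M m)); last first.
    by apply: ract_lincomb_eq; ring.
  rewrite yx !scalerN ![ract rt (_ + _)]linearD !scalerDr !opprD !addrA.
  by rewrite [LHS](ACl (1*4*8*(2*5)*(3*6)*(7*9))) /= !subrr addNr !addr0.
- move=> M m; rewrite scale1r !rcE linearD linearB !linearZ_LR /= (tu M m) linearD /= (tu M (ract rt m)) (tu M m).
  rewrite lincomb_u (_ : ract _ m = ract (lincomb 0 1 0) m); last by apply: ract_lincomb_eq; ring.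
  rewrite yx ![dum_u M (_ + _)]linearD ![dum_u M (_ *: _)]linearZ_LR /= !scalerN !scalerDr !opprD !addrA.
  by rewrite [LHS](ACl (1*4*8*(2*5)*(3*6)*(7*9))) /= !subrr addNr !addr0.
- by rewrite oner_neq0.
- by rewrite k0 orbT.
- by rewrite oner_neq0.
- by rewrite k0 orbT.
- exact: dt.
- exact: tu.
- move=> M m; rewrite pev_quad scale0r add0r scale1r rcE scaleNr dux_lincomb.
  by rewrite !addrA [RHS](ACl (1*(2*5)*(3*4))) /= addNr addr0 subrr addr0.
- move=> M m; rewrite pev_quad scale0r add0r scale1r rcE duy_lincomb yx.
  by rewrite !addrA [RHS](ACl (1*3*4*(2*5))) /= addNr addr0.
Qed.
Lemma ract_horner (M : DU) (r : {poly {poly K}}) (p : {poly K}) (m : M) :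
  ract ((map_poly (polyC \o polyC) p).[r]) m = pev (ract r : M -> M) p m.
Proof.
elim/poly_ind: p m => [|p k IH] m; first by rewrite rmorph0 horner0 ract0 pev0.
by rewrite rmorphD rmorphM /= map_polyX map_polyC hornerMXaddC ractD ractM IH ract_scale pevDl pevC pevMX.
Qed.

(** [x0] is the fixed value of the recursion, and on [rx = x - x0] the map [s] is a Jordan block:
    [s(rx) = c + zeta rx], [s(c) = zeta c]. If [c = 0] this is the degenerate case; if [c] is
    invertible, [t = zeta rx / c] has [s(t) = t + 1], with [x = x0 + c t / zeta] and
    [y = x0 + c (t + 1)]. *)
Theorem artinian_double_root (zeta x0 : K) : alpha = zeta + zeta -> beta = - (zeta * zeta) ->
  gamma = x0 * (1 - zeta) * (1 - zeta) -> zeta ^+ N = 1 ->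
  forall M : DU, fin_generated M -> monolithic M -> artinian M.
Proof.
move=> hal hbeta hgam hN.
have z0 : zeta != 0 by apply: contra_neq beta0 => h; rewrite hbeta h mulr0 oppr0.
pose rc : {poly {poly K}} := lincomb (- zeta) 1 (- (x0 * (1 - zeta))).
pose rx : {poly {poly K}} := lincomb 1 0 (- x0).
have dc (M : DU) (m : M) : dum_d M (ract rc m) = zeta *: ract rc (dum_d M m).
  by rewrite d_lincomb ract_lincombZ; apply: ract_lincomb_eq; rewrite ?hal ?hgam ?hbeta; ring.
have cu (M : DU) (m : M) : ract rc (dum_u M m) = zeta *: dum_u M (ract rc m).
  rewrite lincomb_u -linearZ ract_lincombZ; congr (dum_u M _).
  by apply: ract_lincomb_eq; rewrite ?hal ?hgam ?hbeta; ring.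
have dx (M : DU) (m : M) : dum_d M (ract rx m) = ract rc (dum_d M m) + zeta *: ract rx (dum_d M m).
  by rewrite d_lincomb ract_lincombZ ract_lincombD; apply: ract_lincomb_eq; ring.
have xu (M : DU) (m : M) : ract rx (dum_u M m) = dum_u M (ract rc m + zeta *: ract rx m).
  by rewrite lincomb_u ract_lincombZ ract_lincombD; congr (dum_u M _); apply: ract_lincomb_eq; ring.
have hx (M : DU) (m : M) : dux M m = x0 *: m + ract rx m.
  rewrite dux_lincomb -[m in _ *: m]ract_lincomb1 ract_lincombZ ract_lincombD.
  by apply: ract_lincomb_eq; ring.
have hy (M : DU) (m : M) : duy M m = x0 *: m + ract rc m + zeta *: ract rx m.
  rewrite duy_lincomb -[m in _ *: m]ract_lincomb1 !ract_lincombZ !ract_lincombD.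
  by apply: ract_lincomb_eq; ring.
apply: (central_reduction char0 beta0 N0 hN dc cu) => M p0 hfg hmono hsep hp hp0.
have [hX|p00] := hp.
  have c0 (m : M) : ract rc m = 0 by have := hp0 m; rewrite hX pevX.
  apply: (degenerate_artinian beta0 hfg hmono N0 hN (a := x0) (xi := ract rx)) => m; first exact: hx.
  by rewrite hy c0 addr0.
have [r hr] : exists r : {poly K}, forall m : M, pev (ract rc : M -> M) r (ract rc m) = m.
  (* The inverse of [c] as a polynomial in [c], read off from [p0(c) = 0] with nonzero constant
     term. *)
  exists (- p0.[0]^-1 *: ((p0 - p0.[0]%:P) %/ 'X)) => m; rewrite -pevMX -scalerAl divpK; last first.
    by rewrite -['X]subr0 -polyC0 dvdp_XsubCl /root !hornerE subrr.
  by rewrite pevZl pevDl pevNl hp0 pevC sub0r scalerN scaleNr opprK scalerA mulVf // scale1r.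
pose ri : {poly {poly K}} := (map_poly (polyC \o polyC) r).[rc].
have ic (m : M) : ract ri (ract rc m) = m by rewrite ract_horner.
have ci (m : M) : ract rc (ract ri m) = m by rewrite ract_comm.
pose rt := zeta%:P%:P * (ri * rx).
have tE (m : M) : ract rt m = zeta *: ract ri (ract rx m) by rewrite ractM ract_scale ractM.
have ctE (m : M) : ract rc (ract rt m) = zeta *: ract rx m by rewrite tE linearZ /= ci.
have di (m : M) : zeta *: dum_d M (ract ri m) = ract ri (dum_d M m).
  by rewrite -{2}[m]ci dc linearZ /= ic.
have iu (m : M) : zeta *: ract ri (dum_u M m) = dum_u M (ract ri m).
  by rewrite -[RHS]ic cu ci linearZ.
have dt (m : M) : dum_d M (ract rt m) = ract rt (dum_d M m) + dum_d M m.
  by rewrite tE linearZ /= di dx linearD linearZ /= ic addrC tE.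
have tu (m : M) : ract rt (dum_u M m) = dum_u M (ract rt m) + dum_u M m.
  by rewrite tE xu iu -linearD; congr (dum_u M _); rewrite linearD linearZ /= ic addrC tE.
pose c : {linear M -> M} := ract rc; pose t : {linear M -> M} := ract rt.
have ct (m : M) : c (t m) = t (c m) by exact: ract_comm.
apply: (ract_skew_artinian char0 beta0 N0 hN dc cu (rt := rt)
  (x0 := x0%:P) (x1 := zeta^-1 *: 'X) (x2 := 0) (y0 := x0%:P + 'X) (y1 := 'X) (y2 := 0)
  (Gx := rev_scale (zeta * x0) p0) (Gy := rev_scale x0 p0 \Po ('X + 1)) (p0 := p0)
  hfg hmono dt tu _ _ _ _ _ _ hsep hp0).
- by move=> m; rewrite hx pev0 addr0 pevC pevZl pevX /= ctE scalerA mulVf // scale1r.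
- by move=> m; rewrite hy pev0 addr0 pevDl pevC !pevX /= ctE.
- exact: rev_scale_neq0.
- by rewrite comp_poly_eq0 ?rev_scale_neq0 // -[1]/(1%:P) -[1%:P]opprK -polyCN size_XsubC.
- move=> Q hQ w; rewrite hx => hw; apply: (eliminate_rev ct hQ) => //.
  have -> : (zeta * x0) *: w + c (t w) = zeta *: (x0 *: w + ract rx w).
    by rewrite scalerDr scalerA -ctE.
  by case: hQ => Qs _ _; exact: subspaceZ.
- move=> Q hQ w; rewrite hy => hw; rewrite pev_comp.
  apply: (@eliminate_rev _ _ c (pev t ('X + 1) : {linear M -> M})) => //.
  + by move=> m; apply: (pev_commute (B := c)).
  + case: hQ => Qs Qc Qt; split=> // m hm; exact: pev_stable.
  by rewrite /= pevDl pev1 pevX [ract rc (_ + _)]linearD /= ctE [X in _ + X]addrC addrA.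
Qed.
End Cases.

(** * Choosing the case from the roots *)

Section RootsOfUnity.
Variables (K : fieldType) (alpha beta gamma : K).
Hypothesis char0 : [pchar K] =i pred0.
Hypothesis beta0 : beta != 0.
Variables (L : fieldType) (f : {rmorphism K -> L}) (z1 z2 : L) (N : nat).
Hypothesis N0 : (0 < N)%N.
Hypothesis z1N : z1 ^+ N = 1.
Hypothesis z2N : z2 ^+ N = 1.
Hypothesis z_sum : z1 + z2 = f alpha.
Hypothesis z_mul : z1 * z2 = - f beta.

(** The functional sending [A x + B y + C] to [A + B z] is an eigenvector of [s], with eigenvalue
    [z]. *)
Lemma orbit_coef_root z n : z * z = f alpha * z + f beta ->
  let: (A, B, _) := orbit_coef alpha beta gamma n in f A + f B * z = z ^+ n.
Proof.
move=> hz; elim: n => [|n] /=; first by rewrite rmorph1 rmorph0 mul0r addr0.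
case: (orbit_coef _ _ _ n) => [[A B] C] e.
by rewrite exprSr -e rmorphM rmorphD rmorphM [in RHS]mulrDl -[f B * z * z]mulrA hz; ring.
Qed.

Lemma orbit_coef_fix p n : p = alpha * p + beta * p + gamma ->
  let: (A, B, C) := orbit_coef alpha beta gamma n in A * p + B * p + C = p.
Proof.
move=> hp; elim: n => [|n] /=; first by rewrite mul1r mul0r !addr0.
case: (orbit_coef _ _ _ n) => [[A B] C] e.
by transitivity (A * p + B * (alpha * p + beta * p + gamma) + C); [ring | rewrite -hp].
Qed.

Let root1 : z1 * z1 = f alpha * z1 + f beta.
Proof. by rewrite -z_sum -[f beta]opprK -z_mul; ring. Qed.
Let root2 : z2 * z2 = f alpha * z2 + f beta.
Proof. by rewrite -z_sum -[f beta]opprK -z_mul; ring. Qed.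

(** On the span of [1], [x], [y] the eigenvalues of [s] are the two roots and 1. Distinct roots
    together with a fixed value make [s] diagonalisable, hence of finite order. A missing fixed
    value means that 1 is a root and [gamma] is nonzero; equal roots give Jordan blocks. *)
Theorem roots_of_unity_artinian (M : DUModule alpha beta gamma) :
  fin_generated M -> monolithic M -> artinian M.
Proof.
have two0 : 2%:R != 0 :> K by have [h _] := pcharf0P K; rewrite (h char0).
have disc : (z1 - z2) * (z1 - z2) = f (alpha * alpha + beta *+ 4).
  by rewrite rmorphD rmorphM rmorphMn /= -z_sum -[f beta]opprK -z_mul; ring.
have [e12|n12] := eqVneq z1 z2.
  (* In characteristic 0 a double root already lies in [K]. *)
  pose zeta := alpha / 2%:R.
  have fz : f zeta = z1.
    apply: (mulIf (x := f 2%:R)); first by rewrite fmorph_eq0.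
    by rewrite -rmorphM divfK // -z_sum -e12 rmorph_nat mulr_natr.
  have hal : alpha = zeta + zeta.
    by rewrite -mulr2n -mulr_natr divfK.
  have hbeta : beta = - (zeta * zeta).
    by apply: (fmorph_inj f); rewrite rmorphN rmorphM fz {2}e12 z_mul opprK.
  have hN : zeta ^+ N = 1 by apply: (fmorph_inj f); rewrite rmorphXn fz rmorph1.
  have [e1|n1] := eqVneq zeta 1; last first.
    apply: (artinian_double_root char0 beta0 N0 (x0 := gamma / (1 - zeta) / (1 - zeta)) hal hbeta _ hN).
    have h : 1 - zeta != 0 by rewrite subr_eq0 eq_sym.
    by rewrite !divfK.
  have [g0|g0] := eqVneq gamma 0.
    by apply: (artinian_double_root char0 beta0 N0 (x0 := 0) hal hbeta _ hN); rewrite g0 !mul0r.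
  by apply: (artinian_double_one char0 beta0) => //; [rewrite hal e1 | rewrite hbeta e1 mulr1].
have [[p hp]|hnp] := pselect (exists p, p = alpha * p + beta * p + gamma).
  move=> hfg hmono; apply: (periodic_artinian beta0 hfg hmono N0).
  have := orbit_coef_fix N hp; have := orbit_coef_root N root1; have := orbit_coef_root N root2.
  case: (orbit_coef _ _ _ N) => [[A B] C]; rewrite z1N z2N => h2 h1 h3.
  have B0 : B = 0.
    apply/eqP; rewrite -(fmorph_eq0 f); apply: contraNT n12 => hB; apply/eqP.
    by apply: (mulfI hB); apply: (addrI (f A)); rewrite h1.
  have A1 : A = 1.
    by apply: (fmorph_inj f); rewrite rmorph1 -h1 B0 rmorph0 mul0r addr0.
  by move: h3; rewrite B0 A1 mul1r mul0r addr0 -[RHS]addr0 => /addrI ->.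
have h1 : 1 - alpha - beta = 0.
  apply/eqP; apply: contraT => h; case: hnp; exists (gamma / (1 - alpha - beta)).
  by field.
have g0 : gamma != 0.
  by apply/negP => /eqP g0; case: hnp; exists 0; rewrite g0 !mulr0 !addr0.
have hbN : (- beta) ^+ N = 1.
  apply: (fmorph_inj f); rewrite rmorphXn rmorphN rmorph1 -z_mul exprMn z1N z2N mulr1 //.
apply: (artinian_root_one char0 beta0 N0) => //.
apply: contra_neq n12 => hb; apply/eqP; rewrite -subr_eq0 -sqrf_eq0 expr2 disc fmorph_eq0.
have -> : alpha = 1 - beta by apply/eqP; rewrite -subr_eq0 -oppr_eq0 -h1; apply/eqP; ring.
by rewrite hb; apply/eqP; ring.
Qed.
End RootsOfUnity.

(** * Algebraically closed extensions *)

Section Ultraproduct.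
Variables (I : Type) (i0 : I) (L : I -> fieldType).

(* The base point makes [1 != 0] an instance. *)
Definition field_product of I := forall i, L i.
Local Notation A := (field_product i0).
HB.instance Definition _ := Choice.copy A (forall i, L i).

Let addA (a b : A) : A := fun i => a i + b i.
Let oppA (a : A) : A := fun i => - a i.
Let mulA (a b : A) : A := fun i => a i * b i.
Let oneA : A := fun i => 1.

Fact field_product_addA : associative addA.
Proof. by move=> a b c; apply: functional_extensionality_dep => i; exact: addrA. Qed.
Fact field_product_addC : commutative addA.
Proof. by move=> a b; apply: functional_extensionality_dep => i; exact: addrC. Qed.
Fact field_product_add0 : left_id (fun i => 0 : L i) addA.
Proof. by move=> a; apply: functional_extensionality_dep => i; exact: add0r. Qed.
Fact field_product_addN : left_inverse (fun i => 0 : L i) oppA addA.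
Proof. by move=> a; apply: functional_extensionality_dep => i; exact: addNr. Qed.
HB.instance Definition _ := GRing.isZmodule.Build A
  field_product_addA field_product_addC field_product_add0 field_product_addN.

Fact field_product_mulA : associative mulA.
Proof. by move=> a b c; apply: functional_extensionality_dep => i; exact: mulrA. Qed.
Fact field_product_mulC : commutative mulA.
Proof. by move=> a b; apply: functional_extensionality_dep => i; exact: mulrC. Qed.
Fact field_product_mul1 : left_id oneA mulA.
Proof. by move=> a; apply: functional_extensionality_dep => i; exact: mul1r. Qed.
Fact field_product_mulD : left_distributive mulA +%R.
Proof. by move=> a b c; apply: functional_extensionality_dep => i; exact: mulrDl. Qed.
Fact field_product_neq0 : oneA != 0.
Proof. by apply/eqP => /(congr1 (@^~ i0)) /eqP; rewrite oner_eq0. Qed.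
HB.instance Definition _ := GRing.Zmodule_isComNzRing.Build A
  field_product_mulA field_product_mulC field_product_mul1 field_product_mulD field_product_neq0.

Definition coordinate i (a : A) : L i := a i.
Fact coordinate_zmod i : zmod_morphism (@coordinate i). Proof. by []. Qed.
Fact coordinate_monoid i : monoid_morphism (@coordinate i). Proof. by []. Qed.
HB.instance Definition _ i := GRing.isZmodMorphism.Build A (L i) (@coordinate i) (coordinate_zmod i).
HB.instance Definition _ i := GRing.isMonoidMorphism.Build A (L i) (@coordinate i) (coordinate_monoid i).
Variable U : (I -> Prop) -> Prop.
Hypothesis U_mono : forall P Q : I -> Prop, (forall i, P i -> Q i) -> U P -> U Q.
Hypothesis U_and : forall P Q, U P -> U Q -> U (fun i => P i /\ Q i).
Hypothesis U_false : ~ U (fun=> False).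
Hypothesis U_or : forall P, U P \/ U (fun i => ~ P i).

(** A family that is not almost everywhere zero is almost everywhere nonzero, so its coordinatewise
    inverse is an inverse modulo the null families. *)
Lemma ultraproduct_field : exists (E : fieldType) (pi : {rmorphism A -> E}),
  forall a, pi a = 0 <-> U (fun i => a i = 0).
Proof.
have U_true P : (forall i, P i) -> U P.
  move=> hP; have [//|] := U_or P; move/U_mono => h; case: U_false; apply: h => i; exact.
pose J : {pred A} := fun a => `[< U (fun i => a i = 0) >].
have J_ideal : idealr_closed J.
  split.
  - by apply/asboolP; exact: U_true.
  - apply/asboolP => /U_mono h; case: U_false; apply: h => i /eqP.
    by rewrite oner_eq0.
  - move=> a b c /asboolP hb /asboolP hc; apply/asboolP; apply: U_mono (U_and hb hc) => i [eb ec].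
    by rewrite -[LHS]/(a i * b i + c i) eb ec mulr0 addr0.
pose IaM := GRing.isZmodClosed.Build _ J (idealr_closedB J_ideal).
pose IpM := isProperIdeal.Build _ J (idealr_closed_nontrivial J_ideal).
pose Jid : idealr _ := HB.pack J IaM IpM.
pose E : comNzRingType := {ideal_quot Jid}.
pose pi : {rmorphism A -> E} := \pi_E%qT.
have pi0 a : pi a = 0 <-> U (fun i => a i = 0).
  have e : (a \in Jid) = (pi a == pi 0) by rewrite -{1}[a]subr0 Quotient.idealrBE.
  rewrite rmorph0 in e; split=> [/eqP h|h]; first by move: h; rewrite -e => /asboolP.
  by apply/eqP; rewrite -e; apply/asboolP.
have piP z : exists a, z = pi a by exists (repr z); rewrite /pi /= reprK.
have inv (z : E) : exists w, (z != 0 -> w * z = 1) /\ (z = 0 -> w = 0).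
  have [a ->] := piP z; exists (pi (fun i => (a i)^-1)); split=> [/eqP h|/pi0 h].
    apply/eqP; rewrite -rmorphM -(rmorph1 pi) -subr_eq0 -rmorphB; apply/eqP/pi0.
    have [/pi0 //|] := U_or (fun i => a i = 0); apply: U_mono => i /eqP hi.
    by rewrite -[LHS]/((a i)^-1 * a i - 1) mulVf // subrr.
  by apply/pi0; apply: U_mono h => i ->; rewrite invr0.
pose Einv z := sval (cid (inv z)).
have EmulV z : z != 0 -> Einv z * z = 1 by rewrite /Einv; case: cid => w /= [].
have Einv0 : Einv 0 = 0 by rewrite /Einv; case: cid => w /= [_]; apply.
pose EfieldMixin := GRing.ComNzRing_isField.Build _ EmulV Einv0.
pose Efield : fieldType := HB.pack E EfieldMixin.
by exists Efield, (pi : {rmorphism A -> Efield}).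
Qed.
End Ultraproduct.

Section SplittingAll.
Variable K : fieldType.

(** One splitting field is taken for each nonzero polynomial, and the ultrafilter concentrates on
    the multiples of any given [p]. Over all of these [p] splits with the same number of roots, so
    it splits in the ultraproduct. *)
Lemma split_all_polys : exists (E : fieldType) (f : {rmorphism K -> E}),
  forall p, p != 0 -> exists rs, map_poly f p %= \prod_(r <- rs) ('X - r%:P).
Proof.
pose I := {p : {poly K} | p != 0}.
pose i1 : I := exist _ 1 (oner_neq0 _).
pose L (i : I) : fieldType := sval (cid (splitting_field (svalP i))).
pose f i : {rmorphism K -> L i} := sval (cid (svalP (cid (splitting_field (svalP i))))).
have fP i : exists rs, map_poly (f i) (sval i) %= \prod_(r <- rs) ('X - r%:P).
  exact: svalP (cid (svalP (cid (splitting_field (svalP i))))).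
pose F (S : classical_sets.set I) := exists2 p : {poly K}, p != 0 & forall i, p %| sval i -> S i.
have FF : filter.ProperFilter F.
  split; first by case=> p p0 /(_ (exist _ p p0)); apply; exact: dvdpp.
  split.
  - by exists 1; rewrite ?oner_neq0.
  - move=> P Q [p p0 hp] [q q0 hq]; exists (p * q); rewrite ?mulf_neq0 // => i hi.
    by split; [apply: hp | apply: hq]; apply: dvdp_trans hi; rewrite ?dvdp_mulIl ?dvdp_mulIr.
  - by move=> P Q hPQ [p p0 hp]; exists p => // i /hp /hPQ.
have [U [UU FU]] := filter.ultraFilterLemma FF.
have UPF := @filter.ultra_proper _ _ UU.
have UF := @filter.filter_filter _ _ UPF.
pose Umono := @filter.filterS _ U UF; pose Uand := @filter.filterI _ U UF.
have Ufalse : ~ U (fun=> False) := @filter.filter_not_empty _ U UPF.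
have Uor (P : I -> Prop) : U P \/ U (fun i => ~ P i) := filter.in_ultra_setVsetC P UU.
have [E [pi pi0]] := ultraproduct_field i1 L (fun P Q => Umono P Q) (fun P Q => Uand P Q) Ufalse Uor.
pose A := field_product L i1.
pose iota (k : K) : A := fun i => f i k.
have iotaZ : zmod_morphism iota.
  by move=> a b; apply: functional_extensionality_dep => i; exact: rmorphB.
have iotaM : monoid_morphism iota.
  by split=> [|a b]; apply: functional_extensionality_dep => i; [exact: rmorph1 | exact: rmorphM].
pose g : {rmorphism K -> A} := HB.pack iota (GRing.isZmodMorphism.Build K A iota iotaZ)
  (GRing.isMonoidMorphism.Build K A iota iotaM).
exists E, (GRing.RMorphism.clone _ _ (pi \o g) _) => p p0.
pose n := (size p).-1.
have split i : exists rs : seq (L i), p %| sval i ->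
    size rs = n /\ map_poly (f i) p = f i (lead_coef p) *: \prod_(r <- rs) ('X - r%:P).
  have [hp|hp] := boolP (p %| sval i); last by exists [::].
  have [rs hrs] := fP i.
  have : map_poly (f i) p %| \prod_(r <- rs) ('X - r%:P).
    by rewrite -(eqp_dvdr _ hrs) dvdp_map.
  move=> /dvdp_prod_XsubC [m hm]; exists (mask m rs) => _; split.
    have := eqp_size hm; rewrite size_map_poly size_prod_XsubC => e.
    by rewrite /n e.
  by rewrite [LHS](eqpfP hm) (monicP (monic_prod_XsubC _ _ _)) divr1 lead_coef_map.
pose R i := sval (cid (split i)).
have RP i : p %| sval i -> size (R i) = n /\
    map_poly (f i) p = f i (lead_coef p) *: \prod_(r <- R i) ('X - r%:P).
  by rewrite /R; case: cid => rs /=.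
(* The [k]-th root of [p] in each factor; whatever is taken at indices not divisible by [p]
   disappears in the quotient. *)
pose e k : A := fun i => nth 0 (R i) k.
exists [seq pi (e k) | k <- seq.iota 0 n]; rewrite big_map.
suff -> : map_poly (pi \o g) p = pi (g (lead_coef p)) *: \prod_(k <- seq.iota 0 n) ('X - (pi (e k))%:P).
  by rewrite eqp_scale // (fmorph_eq0 (GRing.RMorphism.clone _ _ (pi \o g) _)) lead_coef_eq0.
have -> : \prod_(k <- seq.iota 0 n) ('X - (pi (e k))%:P)
    = map_poly pi (\prod_(k <- seq.iota 0 n) ('X - (e k)%:P)).
  by rewrite rmorph_prod; apply: eq_bigr => k _; rewrite /= map_polyXsubC.
rewrite -map_polyZ map_poly_comp; apply/polyP => j; rewrite !(coef_map pi); apply/eqP.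
rewrite -subr_eq0 -rmorphB; apply/eqP/pi0; apply: FU; exists p => // i /RP [sR eR].
have hc (a b : A) : coordinate i a = coordinate i b -> (a - b) i = 0.
  move=> h; have e1 := rmorphB (coordinate i : {rmorphism A -> L i}) a b.
  by apply: etrans e1 _; apply/eqP; rewrite subr_eq0; apply/eqP.
have hcoef (q : {poly A}) : coordinate i q`_j = (map_poly (coordinate i) q)`_j by rewrite coef_map.
apply: hc; apply: etrans (hcoef _) _; apply: etrans _ (esym (hcoef _)).
congr (nth 0 _ j); congr polyseq; rewrite map_polyZ -map_poly_comp rmorph_prod.
apply: etrans eR _; congr (_ *: _); rewrite (big_nth 0) sR /index_iota subn0.
by apply: eq_bigr => k _; rewrite /= map_polyXsubC.
Qed.
End SplittingAll.

Section AlgebraicPart.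
Variables (K E : fieldType) (f : {rmorphism K -> E}).

Definition algebraic_pred : {pred E} := fun z => `[< algebraicOver f z >].
Fact algebraic_pred_divring : divring_closed algebraic_pred.
Proof.
split=> [|a b /asboolP ha /asboolP hb|a b /asboolP ha /asboolP hb]; apply/asboolP.
- exact: algebraic1.
- exact: algebraic_sub.
- exact: algebraic_div.
Qed.
HB.instance Definition _ := GRing.isDivringClosed.Build E algebraic_pred algebraic_pred_divring.

Record algebraic_part := AlgebraicPart { algebraic_val : E; _ : algebraic_val \in algebraic_pred }.
HB.instance Definition _ := [isSub for algebraic_val].
HB.instance Definition _ := [Choice of algebraic_part by <:].
HB.instance Definition _ := [SubChoice_isSubIntegralDomain of algebraic_part by <:].
HB.instance Definition _ := [SubIntegralDomain_isSubField of algebraic_part by <:].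

Hypothesis f_split : forall p, p != 0 -> exists rs, map_poly f p %= \prod_(r <- rs) ('X - r%:P).

(** A root, in some extension of [E], of a polynomial with algebraic coefficients is algebraic over
    [K], hence a root of a polynomial over [K]; as that polynomial splits in [E], the root was in
    [E] already. *)
Lemma algebraic_part_closed : GRing.closed_field_axiom algebraic_part.
Proof.
move=> n P n0; pose q : {poly E} := 'X^n - \poly_(i < n) \val (P i).
have sq : size q = n.+1.
  by rewrite size_polyDl ?size_polyXn // size_polyN ltnS size_poly.
have q0 : q != 0 by rewrite -size_poly_eq0 sq.
have [S [h [rs hrs]]] := splitting_field q0.
have [z zrs] : exists z, z \in rs.
  have := eqp_size hrs; rewrite size_map_poly sq size_prod_XsubC; case: (rs) => [|z s] //; last by exists z; rewrite inE eqxx.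
  by case: (n) n0.
have zq : root (map_poly h q) z by rewrite (eqp_root hrs) root_prod_XsubC.
pose g : {rmorphism K -> S} := GRing.RMorphism.clone _ _ (h \o f) _.
have : algebraicOver g z.
  apply/integral_algebraic; apply: (integral_root _ zq); first by rewrite map_poly_eq0.
  apply/integral_poly => i; apply/integral_algebraic.
  have : algebraicOver f q`_i.
    rewrite coefB coefXn coef_poly; apply: algebraic_sub.
      by case: (i == n); [exact: algebraic1 | exact: algebraic0].
    by case: (i < n)%N; [apply/asboolP; exact: (valP (P i)) | exact: algebraic0].
  case=> p p0 hp; exists p => //; rewrite coef_map map_poly_comp /root.
  by rewrite horner_map fmorph_eq0.
case=> p p0; rewrite map_poly_comp => hp.
have [rs' hrs'] := f_split p0.
have : map_poly h (map_poly f p) %= map_poly h (\prod_(r <- rs') ('X - r%:P)) by rewrite eqp_map.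
move=> /eqp_root e; move: hp; rewrite e rmorph_prod.
rewrite (eq_bigr (fun r => 'X - (h r)%:P)); last by move=> r _; rewrite /= map_polyXsubC.
rewrite -(big_map h predT (fun c => 'X - c%:P)) root_prod_XsubC => /mapP [r hr zr].
have rq : root q r by rewrite -(fmorph_root h) -zr.
have ralg : r \in algebraic_pred.
  by apply/asboolP; exists p => //; rewrite (eqp_root hrs') root_prod_XsubC.
have er : r ^+ n = \sum_(i < n) \val (P i) * r ^+ i.
  by apply/eqP; rewrite -subr_eq0; move: rq; rewrite /root /q hornerD hornerN hornerXn horner_poly.
exists (AlgebraicPart ralg); apply: val_inj; rewrite rmorphXn rmorph_sum; apply: etrans er _.
by apply: eq_bigr => i _; rewrite rmorphM rmorphXn.
Qed.
End AlgebraicPart.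

Theorem algebraically_closed_extension (K : fieldType) :
  exists (C : closedFieldType), inhabited {rmorphism K -> C}.
Proof.
have [E [f hf]] := split_all_polys K.
pose T := algebraic_part f.
pose C : closedFieldType := HB.pack T (Field_isAlgClosed.Build T (algebraic_part_closed hf)).
have fT k : f k \in algebraic_pred f by apply/asboolP; exact: algebraic_id.
pose g k : T := AlgebraicPart (fT k).
have gZ : zmod_morphism g by move=> a b; apply: val_inj; rewrite /= !rmorphB.
have gM : monoid_morphism g by split=> [|a b]; apply: val_inj; rewrite /= ?rmorph1 ?rmorphM.
exists C; constructor; exact: (HB.pack g (GRing.isZmodMorphism.Build K T g gZ)
  (GRing.isMonoidMorphism.Build K T g gM)).
Qed.

(** * Weight modules on bilateral sequences *)

Import Order.TTheory Num.Theory.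

Section Sequences.
Variable L : fieldType.

Definition biseq := int -> L.
HB.instance Definition _ := gen_eqMixin biseq.
HB.instance Definition _ := gen_choiceMixin biseq.

Fact biseq_addA : associative (fun F G : biseq => (fun n => F n + G n) : biseq).
Proof. by move=> F G H; apply/funext => n; exact: addrA. Qed.
Fact biseq_addC : commutative (fun F G : biseq => (fun n => F n + G n) : biseq).
Proof. by move=> F G; apply/funext => n; exact: addrC. Qed.
Fact biseq_add0 : left_id (fun=> 0 : L) (fun F G : biseq => (fun n => F n + G n) : biseq).
Proof. by move=> F; apply/funext => n; exact: add0r. Qed.
Fact biseq_addN : left_inverse (fun=> 0 : L) (fun F : biseq => (fun n => - F n) : biseq)
  (fun F G : biseq => (fun n => F n + G n) : biseq).
Proof. by move=> F; apply/funext => n; exact: addNr. Qed.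
HB.instance Definition _ := GRing.isZmodule.Build biseq biseq_addA biseq_addC biseq_add0 biseq_addN.

Definition biseq_scale (k : L) (F : biseq) : biseq := fun n => k * F n.
Fact biseq_scaleA (a b : L) F : biseq_scale a (biseq_scale b F) = biseq_scale (a * b) F.
Proof. by apply/funext => n; exact: mulrA. Qed.
Fact biseq_scale1 : left_id 1 biseq_scale.
Proof. by move=> F; apply/funext => n; exact: mul1r. Qed.
Fact biseq_scaleDr : right_distributive biseq_scale +%R.
Proof. by move=> a F G; apply/funext => n; exact: mulrDr. Qed.
Fact biseq_scaleDl F : {morph biseq_scale^~ F : a b / a + b}.
Proof. by move=> a b; apply/funext => n; exact: mulrDl. Qed.
HB.instance Definition _ := GRing.Zmodule_isLmodule.Build L biseq
  biseq_scaleA biseq_scale1 biseq_scaleDr biseq_scaleDl.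

Lemma biseqD (F G : biseq) n : (F + G) n = F n + G n. Proof. by []. Qed.
Lemma biseqN (F : biseq) n : (- F) n = - F n. Proof. by []. Qed.
Lemma biseq0 n : (0 : biseq) n = 0. Proof. by []. Qed.
Lemma biseqZ k (F : biseq) n : (k *: F) n = k * F n. Proof. by []. Qed.

Definition shift (F : biseq) : biseq := fun n => F (n - 1).
Definition unshift (F : biseq) : biseq := fun n => F (n + 1).
Definition mulseq (a F : biseq) : biseq := fun n => a n * F n.
Lemma shiftE F n : shift F n = F (n - 1). Proof. by []. Qed.
Fact shift_linear : linear shift. Proof. by []. Qed.
Fact unshift_linear : linear unshift. Proof. by []. Qed.
Fact mulseq_linear a : linear (mulseq a).
Proof. by move=> k F G; apply/funext => n; rewrite /mulseq biseqD biseqZ mulrDr mulrCA. Qed.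
HB.instance Definition _ := GRing.isLinear.Build L biseq biseq _ shift shift_linear.
HB.instance Definition _ := GRing.isLinear.Build L biseq biseq _ unshift unshift_linear.
HB.instance Definition _ a := GRing.isLinear.Build L biseq biseq _ (mulseq a) (mulseq_linear a).

Definition finsupp (F : biseq) : Prop := exists s : seq int, forall n, n \notin s -> F n = 0.
Definition left_bounded (F : biseq) : Prop := exists a : int, forall n, n < a -> F n = 0.

Lemma finsupp_subspace : subspace finsupp.
Proof.
split; first by exists [::].
- move=> F G [s hs] [t ht]; exists (s ++ t) => n; rewrite mem_cat negb_or => /andP [h1 h2].
  by rewrite biseqD hs // ht // addr0.
- by move=> k F [s hs]; exists s => n /hs e; rewrite biseqZ e mulr0.
Qed.

Lemma finsupp_mul a F : finsupp F -> finsupp (mulseq a F).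
Proof. by case=> s hs; exists s => n /hs e; rewrite /mulseq e mulr0. Qed.

Lemma finsupp_shift F : finsupp F -> finsupp (shift F).
Proof.
case=> s hs; exists [seq n + 1 | n <- s] => n hn; apply: hs; apply: contra hn => hn.
by apply/mapP; exists (n - 1) => //; rewrite subrK.
Qed.

Lemma finsupp_unshift F : finsupp F -> finsupp (unshift F).
Proof.
case=> s hs; exists [seq n - 1 | n <- s] => n hn; apply: hs; apply: contra hn => hn.
by apply/mapP; exists (n + 1) => //; rewrite addrK.
Qed.

Lemma left_bounded_subspace : subspace left_bounded.
Proof.
split; first by exists 0.
- move=> F G [a ha] [b hb]; exists (Num.min a b) => n; rewrite lt_min => /andP [h1 h2].
  by rewrite biseqD ha // hb // addr0.
- by move=> k F [s hs]; exists s => n /hs e; rewrite biseqZ e mulr0.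
Qed.

Lemma left_bounded_mul a F : left_bounded F -> left_bounded (mulseq a F).
Proof. by case=> s hs; exists s => n /hs e; rewrite /mulseq e mulr0. Qed.

Lemma left_bounded_shift F : left_bounded F -> left_bounded (shift F).
Proof. by case=> a ha; exists a => n hn; apply: ha; apply: lt_trans hn; rewrite ltrBlDr ltrDl. Qed.

Lemma left_bounded_unshift F : left_bounded F -> left_bounded (unshift F).
Proof. by case=> a ha; exists (a - 1) => n hn; apply: ha; rewrite -ltrBrDr. Qed.

(** The first nonzero coordinate of [F] is simply multiplied by [P(0)]. *)
Lemma pev_shift_neq0 (P : {poly L}) F : P.[0] != 0 -> left_bounded F -> F <> 0 ->
  pev shift P F <> 0.
Proof.
move=> P0 [a ha] hF; have [n hn] : exists n, F n != 0.
  apply: contrapT => h; apply: hF; apply/funext => n; apply: contrapT => hn.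
  by apply: h; exists n; apply/eqP.
have hex : exists k : nat, F (a + k%:Z) != 0.
  exists `|n - a|%N; have h : a <= n by rewrite leNgt; apply: contra hn => /ha ->.
  by rewrite gez0_abs ?subr_ge0 // [a + _]addrC subrK.
case: (ex_minnP hex) => k hk kmin.
have low j : j < a + k%:Z -> F j = 0.
  move=> hj; have [/ha //|haj] := ltP j a.
  apply/eqP; apply: contraT => hFj; have := kmin `|j - a|%N.
  by rewrite gez0_abs ?subr_ge0 // [a + _]addrC subrK => /(_ hFj); lia.
move=> /(congr1 (fun G : biseq => G (a + k%:Z))); rewrite biseq0.
suff h : forall (Q : {poly L}) j, j <= a + k%:Z -> pev shift Q F j = Q.[0] * F j.
  by apply/eqP; rewrite h // mulf_neq0.
elim/poly_ind => [|Q b IH] j hj; first by rewrite pev0 horner0 mul0r.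
rewrite pevDl pevC biseqD biseqZ hornerD hornerM hornerX hornerC mulr0 add0r.
rewrite pevMX -(pev_commute (B := shift)) // [X in X + _ = _]shiftE IH; last by lia.
by rewrite low ?mulr0 ?add0r //; lia.
Qed.
End Sequences.

Section RestrictedScalars.
Variables (K L : fieldType) (iota : {rmorphism K -> L}).

(** Sequences tagged with the embedding, from which the [K]-structure by restriction of scalars is
    inferred. *)
Definition kseq of {rmorphism K -> L} := biseq L.
Local Notation S := (kseq iota).
HB.instance Definition _ := GRing.Zmodule.copy S (biseq L).

Definition kscale (k : K) (F : S) : S := iota k *: (F : biseq L).
Fact kscaleA (a b : K) F : kscale a (kscale b F) = kscale (a * b) F.
Proof. by rewrite /kscale scalerA rmorphM. Qed.
Fact kscale1 : left_id 1 kscale.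
Proof. by move=> F; rewrite /kscale rmorph1 scale1r. Qed.
Fact kscaleDr : right_distributive kscale +%R.
Proof. by move=> a F G; exact: scalerDr. Qed.
Fact kscaleDl F : {morph kscale^~ F : a b / a + b}.
Proof. by move=> a b; rewrite /kscale rmorphD scalerDl. Qed.
HB.instance Definition _ := GRing.Zmodule_isLmodule.Build K S kscaleA kscale1 kscaleDr kscaleDl.

Lemma kseqZ (k : K) (F : S) : k *: F = iota k *: (F : biseq L) :> biseq L. Proof. by []. Qed.

Definition kop (T : biseq L -> biseq L) (F : S) : S := T F.
Fact kop_linear (T : {linear biseq L -> biseq L}) : linear (kop T).
Proof. by move=> k F G; rewrite /kop !kseqZ linearP. Qed.
HB.instance Definition _ (T : {linear biseq L -> biseq L}) :=
  GRing.isLinear.Build K S S _ (kop T) (kop_linear T).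
End RestrictedScalars.

(** * The weight module *)

Section WeightModule.
Variables (K : fieldType) (alpha beta gamma : K).
Hypothesis beta0 : beta != 0.
Variables (L : fieldType) (iota : {rmorphism K -> L}) (q : L).
Hypothesis hq : q * q = iota alpha * q + iota beta.
Variables (c g lam : K).
Hypothesis hg : g = alpha * g + beta * g.
Hypothesis hc : c + g = alpha * c + beta * c - beta * g + gamma.

Lemma q_neq0 : q != 0.
Proof.
apply: contraNneq beta0 => h; move/eqP: hq; rewrite h !mulr0 add0r eq_sym.
by rewrite fmorph_eq0.
Qed.

(** An affine solution plus an eigenvector for [q], solving the recurrence that the relations impose
    when [y] acts on coordinate [n] by [weight n] and [x] by [weight (n + 1)]. A nonzero slope [g]
    requires 1 to be a root. *)
Definition weight : biseq L := fun n => iota c - iota g * n%:~R + iota lam * q ^ (- n).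

Lemma weight_rec n : weight (n - 1) = iota alpha * weight n + iota beta * weight (n + 1) + iota gamma.
Proof.
have q0 := q_neq0.
have h1 : q ^ (- (n - 1)) = q * q * q ^ (- (n + 1)).
  by rewrite -[q * q]/(q ^ 2) -expfzDr //; congr (_ ^ _); lia.
have h2 : q ^ (- n) = q * q ^ (- (n + 1)).
  by rewrite -[X in X * _]/(q ^ 1) -expfzDr //; congr (_ ^ _); lia.
have eg : iota g - (iota alpha * iota g + iota beta * iota g) = 0.
  by rewrite -!rmorphM -rmorphD -hg subrr.
have ec : iota c + iota g
    - (iota alpha * iota c + iota beta * iota c - iota beta * iota g + iota gamma) = 0.
  by rewrite -!rmorphM -!rmorphD -rmorphB -rmorphD -hc subrr.
apply/eqP; rewrite -subr_eq0 /weight h1 h2 hq intrB intrD; apply/eqP.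
transitivity (iota c + iota g
    - (iota alpha * iota c + iota beta * iota c - iota beta * iota g + iota gamma)
    - n%:~R * (iota g - (iota alpha * iota g + iota beta * iota g))); first by ring.
by rewrite ec eg mulr0 subrr.
Qed.

Definition weight_d : {linear kseq iota -> kseq iota} := kop (@shift L).
Definition weight_u : {linear kseq iota -> kseq iota} := kop (@unshift L \o mulseq weight).

Lemma weight_uE F n : weight_u F n = weight (n + 1) * F (n + 1). Proof. by []. Qed.
Lemma weight_dE F n : weight_d F n = F (n - 1). Proof. by []. Qed.

Fact weight_rel1 m : weight_d (weight_d (weight_u m)) =
  alpha *: weight_d (weight_u (weight_d m)) + beta *: weight_u (weight_d (weight_d m)) + gamma *: weight_d m.
Proof.
apply/funext => n; rewrite !biseqD !kseqZ !biseqZ !(weight_dE, weight_uE).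
have -> : n - 1 - 1 + 1 = n - 1 by lia.
have -> : n - 1 + 1 = n by lia.
have -> : n + 1 - 1 = n by lia.
by rewrite weight_rec; ring.
Qed.
Fact weight_rel2 m : weight_d (weight_u (weight_u m)) =
  alpha *: weight_u (weight_d (weight_u m)) + beta *: weight_u (weight_u (weight_d m)) + gamma *: weight_u m.
Proof.
apply/funext => n; rewrite !biseqD !kseqZ !biseqZ !(weight_dE, weight_uE).
have -> : n - 1 + 1 + 1 = n + 1 by lia.
have -> : n - 1 + 1 = n by lia.
have -> : n + 1 + 1 - 1 = n + 1 by lia.
have -> : n + 1 - 1 = n by lia.
have := weight_rec (n + 1); have -> : n + 1 - 1 = n by lia.
by move=> ->; ring.
Qed.
Definition weight_module : DUModule alpha beta gamma := Build_DUModule weight_rel1 weight_rel2.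
End WeightModule.

(** Multiplication by [a - a(n)] kills coordinate [n] and, [a] being injective, no other one;
    repeating this shrinks the support to a single point. *)
Lemma finsupp_single (L : fieldType) (Y : biseq L -> Prop) (a F : biseq L) :
  injective a -> subspace Y -> (forall G, Y G -> Y (mulseq a G)) ->
  Y F -> F <> 0 -> finsupp F -> exists n, Y (fun m => (m == n)%:R).
Proof.
move=> ainj Ys Ya hF F0 [s]; have [k] := ubnP (size s); elim: k => // k IH in F s hF F0 *.
case: s => [|n s] /= hk hs; first by case: F0; apply/funext => n; exact: hs.
have [e|hn] := eqVneq (F n) 0.
  apply: (IH F s) => // m hm; have [->//|hmn] := eqVneq m n.
  by apply: hs; rewrite inE negb_or hmn.
have [h|/asboolPn /existsp_asboolPn [m hm]] := pselect (forall m, m <> n -> F m = 0).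
  exists n; have -> : (fun m => (m == n)%:R) = (F n)^-1 *: F :> biseq L.
    apply/funext => m; rewrite biseqZ; have [->|/eqP/h ->] := eqVneq m n; first by rewrite mulVf.
    by rewrite mulr0.
  exact: subspaceZ.
have [hmn Fm] : m <> n /\ F m <> 0.
  by split=> [e|e]; apply: hm.
apply: (IH (mulseq a F - a n *: F) s) => //.
- by apply: (subspaceB Ys); [exact: Ya | exact: subspaceZ].
- move=> /(congr1 (fun G : biseq L => G m)); rewrite biseqD biseqN biseqZ biseq0 /mulseq -mulrBl.
  by move/eqP; rewrite mulf_eq0 subr_eq0 => /orP [/eqP/ainj|/eqP].
- move=> j hj; rewrite biseqD biseqN biseqZ /mulseq -mulrBl.
  have [->|hjn] := eqVneq j n; first by rewrite subrr mul0r.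
  by rewrite hs ?mulr0 // inE negb_or hjn.
Qed.

(** * The monolithic, non-artinian submodule *)

Section WeightModuleTheory.
Variables (K : fieldType) (alpha beta gamma : K).
Hypothesis beta0 : beta != 0.
Variables (L : fieldType) (iota : {rmorphism K -> L}) (q : L).
Hypothesis hq : q * q = iota alpha * q + iota beta.
Hypothesis hLK : forall l, exists s t, l = iota s + iota t * q.
Hypothesis hq1 : forall n, (0 < n)%N -> q ^+ n != 1.
Variables (c g lam : K).
Hypothesis lam0 : lam != 0.
Hypothesis hg : g = alpha * g + beta * g.
Hypothesis hc : c + g = alpha * c + beta * c - beta * g + gamma.
Local Notation wt := (weight iota q c g lam).
Variable n1 : int.
Hypothesis weight_neq0 : forall n, n1 < n -> wt n != 0.
Local Notation M := (weight_module beta0 hq lam hg hc).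
Local Notation d := (dum_d M).
Local Notation u := (dum_u M).

Let q0 : q != 0. Proof. exact: (q_neq0 beta0 hq). Qed.

Lemma expz_neq1 n : n != 0 -> q ^ n != 1.
Proof.
case: n => [[|n]|n] // _; first exact: hq1.
by rewrite NegzE -exprz_inv -exprnP exprVn invr_eq1 hq1.
Qed.

Lemma expz_inj : injective (fun n : int => q ^ n).
Proof.
move=> i j e; apply/eqP; rewrite -subr_eq0; apply: contraT => /expz_neq1.
by rewrite expfzDr // e -expfzDr // subrr expr0z eqxx.
Qed.

Definition geom : biseq L := fun n => q ^ (- n).
Definition gcoef : L := iota lam * (1 - q^-1).

Lemma gcoef_neq0 : gcoef != 0.
Proof.
rewrite mulf_neq0 ?fmorph_eq0 // subr_eq0 eq_sym invr_eq1.
by have := hq1 (n := 1) isT; rewrite expr1.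
Qed.

Lemma geom_prev n : geom (n - 1) = q * geom n.
Proof. by rewrite /geom opprB -[q in RHS]/(q ^ 1) -expfzDr. Qed.
Lemma geom_next n : geom (n + 1) = q^-1 * geom n.
Proof. by apply: (mulfI q0); rewrite -geom_prev addrK mulrA mulfV // mul1r. Qed.

Lemma geom_inj : injective geom.
Proof. by move=> i j /expz_inj /oppr_inj. Qed.

Definition wop (F : M) : M := duy M F - dux M F - g *: F.

Definition coef (F : M) (n : int) : L := (F : biseq L) n.
Lemma coefD F G n : coef (F + G) n = coef F n + coef G n. Proof. by []. Qed.
Lemma coefN F n : coef (- F) n = - coef F n. Proof. by []. Qed.
Lemma coefZ k F n : coef (k *: F) n = iota k * coef F n. Proof. by []. Qed.
Lemma coef_d F n : coef (d F) n = coef F (n - 1). Proof. by []. Qed.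
Lemma coef_u F n : coef (u F) n = wt (n + 1) * coef F (n + 1). Proof. by []. Qed.
Lemma coef_x F n : coef (dux M F) n = wt (n + 1) * coef F n.
Proof. by rewrite coef_u coef_d addrK. Qed.
Lemma coef_y F n : coef (duy M F) n = wt n * coef F n.
Proof. by rewrite coef_d coef_u subrK. Qed.
Definition coefE := (coefD, coefN, coefZ, coef_x, coef_y).

Lemma wt_next n : wt (n + 1) = iota c - iota g * n%:~R - iota g + iota lam * (q^-1 * geom n).
Proof. by rewrite /weight -/(geom _) geom_next intrD mulrDr mulr1 opprD addrA. Qed.

Lemma coef_wop F n : coef (wop F) n = gcoef * (geom n * coef F n).
Proof.
rewrite /wop !coefE wt_next /weight -/(geom n) /gcoef; ring.
Qed.

Lemma wop_submodule X : is_submodule X -> forall F, X F -> X (wop F).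
Proof.
move=> hX F hF; have Xs := submodule_subspace hX.
apply: (subspaceB Xs); last exact: subspaceZ.
apply: (subspaceB Xs); first by apply: (submodule_d hX); apply: (submodule_u hX).
by apply: (submodule_u hX); apply: (submodule_d hX).
Qed.

(** Besides [y - x - g], the operator [s(y) - y - g] with [s(y) = alpha y + beta x + gamma] also
    acts by a multiple of [q^(-n)], the factor being [q] times larger. As [L = K + K q], these two
    produce every [L]-multiple. *)
Lemma wop_scaled X : is_submodule X -> forall (F : M) l, X F -> X (l *: mulseq geom F : biseq L).
Proof.
move=> hX F l hF; have Xs := submodule_subspace hX.
have Xx : X (dux M F) by apply: (submodule_u hX); apply: (submodule_d hX).
have Xy : X (duy M F) by apply: (submodule_d hX); apply: (submodule_u hX).
have [s [t e]] := hLK (l / gcoef).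
have -> : l *: mulseq geom F = s *: wop F + t *: (alpha *: duy M F + beta *: dux M F + gamma *: F
    - duy M F - g *: F) :> M.
  apply/funext => n; rewrite -[RHS]/(coef _ n) coefD [coef (s *: _) n]coefZ coef_wop !coefE biseqZ.
  rewrite -[l](divfK gcoef_neq0) e -[mulseq geom F n]/(geom n * coef F n).
  have := weight_rec beta0 hq lam hg hc n.
  have -> : wt (n - 1) = wt n + iota g + q * (gcoef * geom n).
    rewrite /weight -!/(geom _) geom_prev intrB /gcoef.
    have eq1 : q * (1 - q^-1) = q - 1 by rewrite mulrBr mulr1 mulfV.
    rewrite (_ : q * (iota lam * (1 - q^-1) * geom n) = q * (1 - q^-1) * iota lam * geom n); last by ring.
    by rewrite eq1; ring.
  move=> h; have {}h : q * (gcoef * geom n) = iota alpha * wt n + iota beta * wt (n + 1) + iota gamma - wt n - iota g.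
    by rewrite -h; ring.
  transitivity (iota s * (gcoef * geom n) * coef F n + iota t * (q * (gcoef * geom n)) * coef F n).
    by ring.
  by rewrite h; ring.
apply: (subspaceD Xs); first by apply: (subspaceZ _ Xs); exact: wop_submodule.
apply: (subspaceZ _ Xs); apply: (subspaceB Xs); last exact: subspaceZ.
by apply: (subspaceB Xs) => //; do 2?[apply: (subspaceD Xs)]; exact: subspaceZ.
Qed.

(** [d] moves unit vectors to the right and [u] moves them back up to the weight, which does not
    vanish beyond [n1]; so the unit vector at [n1] is reached from any other. *)
Lemma socle_shift (X : M -> Prop) n : is_submodule X -> (forall (F : biseq L) l, X F -> X (l *: F)) ->
  X ((fun m => (m == n)%:R) : biseq L) -> X ((fun m => (m == n1)%:R) : biseq L).
Proof.
move=> hX hL; pose delta k : M := ((fun m => (m == k)%:R) : biseq L).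
have up k (j : nat) : X (delta k) -> X (delta (k + j%:Z)).
  move=> h; elim: j => [|j IH]; first by rewrite addr0.
  have -> : delta (k + j.+1%:Z) = d (delta (k + j%:Z)); last exact: (submodule_d hX).
  apply/funext => m; rewrite -[RHS]/(((m - 1) == _)%:R) /delta; congr (_%:R).
  by congr nat_of_bool; apply/eqP/eqP; lia.
have down (j : nat) : X (delta (n1 + j%:Z)) -> X (delta n1).
  elim: j => [|j IH]; first by rewrite addr0.
  move=> /(submodule_u hX) /(hL _ (wt (n1 + j.+1%:Z))^-1) h; apply: IH.
  have w0 : wt (n1 + j.+1%:Z) != 0 by apply: weight_neq0; lia.
  have -> : delta (n1 + j%:Z) = (wt (n1 + j.+1%:Z))^-1 *: (u (delta (n1 + j.+1%:Z)) : biseq L) => //.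
  apply/funext => m; rewrite biseqZ -[X in _ * X]/(wt (m + 1) * (m + 1 == _)%:R) /delta.
  have [->|hm] := eqVneq m (n1 + j%:Z).
    by rewrite (_ : n1 + j%:Z + 1 = n1 + j.+1%:Z) ?eqxx ?mulr1 ?mulVf //; lia.
  by rewrite (_ : (m + 1 == n1 + j.+1%:Z) = false) ?mulr0 //; apply/eqP => e; move/eqP: hm; apply; lia.
rewrite -/(delta n) -/(delta n1) => h; case: (leP n n1) => hn.
  by have := up n `|n1 - n|%N h; rewrite gez0_abs ?subr_ge0 // [n + _]addrC subrK.
by apply: (down `|n - n1|%N); rewrite gez0_abs ?subr_ge0 ?ltW // [n1 + _]addrC subrK.
Qed.

(* Annihilators modulo finite support which avoid the eigenvalues [q ^ i], [i < k]: these cut out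
   the members of a strictly decreasing chain of submodules. *)
Definition avoids (k : int) (P : {poly L}) : Prop := P.[0] != 0 /\ forall i, i < k -> P.[q ^ i] != 0.
Definition tail (k : int) (F : biseq L) : Prop := exists2 P, avoids k P & finsupp (pev (@shift L) P F).

Lemma avoidsM k P Q : avoids k P -> avoids k Q -> avoids k (P * Q).
Proof.
by case=> [P0 hP] [Q0 hQ]; split=> [|i hi]; rewrite hornerM mulf_neq0 ?hP ?hQ.
Qed.

Lemma finsupp_pev (P : {poly L}) F : finsupp F -> finsupp (pev (@shift L) P F).
Proof. by apply: pev_stable; [exact: finsupp_subspace | exact: finsupp_shift]. Qed.

Lemma tail_subspace k : subspace (tail k).
Proof.
have fs := finsupp_subspace L; split.
- by exists 1; [split=> *; rewrite hornerC oner_neq0 | rewrite linear0; exact: subspace0].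
- move=> F G [P hP hF] [Q hQ hG]; exists (P * Q); first exact: avoidsM.
  rewrite pevDr {1}mulrC !pevM; apply: (subspaceD fs); exact: finsupp_pev.
- by move=> l F [P hP hF]; exists P => //; rewrite linearZ; exact: subspaceZ.
Qed.

Lemma tail_shift k F : tail k F -> tail k (shift F).
Proof.
case=> P hP hF; exists P => //; rewrite -(pev_commute (B := @shift L)) //; exact: finsupp_shift.
Qed.

Lemma tail_unshift k F : tail k F -> tail k (unshift F).
Proof.
case=> P hP hF; exists P => //; rewrite -(pev_commute (B := @unshift L)); first exact: finsupp_unshift.
by move=> G; apply/funext => n; rewrite /unshift /shift; congr (G _); lia.
Qed.

(** Conjugation by [q^(-n)] rescales the shift, replacing [P(X)] by [P(X/q)], whose value at [q^i]
    is [P(q^(i-1))]. Hence the condition in [avoids] concerns all exponents below [k], negative ones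
    included. *)
Lemma tail_geom k F : tail k F -> tail k (mulseq geom F).
Proof.
case=> P [P0 hP] hF; exists (P \Po (q^-1 *: 'X)).
  split=> [|i hi]; first by rewrite horner_comp hornerZ hornerX mulr0.
  rewrite horner_comp hornerZ hornerX -[q^-1]/(q ^ (-1)) -expfzDr //; apply: hP; lia.
rewrite pev_comp -(pev_semicommute (T := @shift L) (B := mulseq geom)); first exact: finsupp_mul.
move=> G; rewrite /= pevZl pevX; apply/funext => n; rewrite -[LHS]/(geom n * G (n - 1)) -[RHS]/(q^-1 * (geom (n - 1) * G (n - 1))) geom_prev.
by rewrite !mulrA mulVf // mul1r.
Qed.

(** With [S] the shift and [T] multiplication by [n], [P(S) T = T P(S) - S P'(S)]; squaring [P]
    absorbs the derivative term. *)
Lemma tail_index k F : tail k F -> tail k (mulseq (fun n => n%:~R) F).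
Proof.
case=> P hP hF; exists (P * P); first exact: avoidsM.
have fs := finsupp_subspace L; pose T : {linear biseq L -> biseq L} := mulseq (fun n : int => n%:~R).
pose S : {linear biseq L -> biseq L} := @shift L.
have ST G : S (T G) = T (S G) - S G.
  apply/funext => n; rewrite -[LHS]/((n - 1)%:~R * G (n - 1)).
  by rewrite -[RHS]/(n%:~R * G (n - 1) - G (n - 1)) intrB mulrBl mul1r.
have comm (Q : {poly L}) G : pev S Q (T G) = T (pev S Q G) - pev S ('X * Q^`()) G.
  elim/poly_ind: Q G => [|Q b IH] G; first by rewrite deriv0 mulr0 !pev0 linear0 subr0.
  have -> : 'X * (Q * 'X + b%:P)^`() = 'X * Q^`() * 'X + Q * 'X.
    by rewrite derivD derivM derivX derivC addr0 mulr1 mulrDr -mulrA ['X * Q]mulrC.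
  rewrite !pevDl !pevC !pevMX ST [pev S Q (_ - _)]linearB /= IH [T (_ + _)]linearD [T (b *: _)]linearZ /= opprD !addrA.
  by rewrite [LHS](ACl (1*4*2*3)).
rewrite -/T -/S pevM comm linearB; apply: (subspaceB fs).
  rewrite /= comm; apply: (subspaceB fs); first by apply: finsupp_mul; exact: finsupp_pev.
  exact: finsupp_pev.
by rewrite /= -pevM mulrC pevM; exact: finsupp_pev.
Qed.

Lemma tail_submodule k : @is_submodule _ _ _ _ M (tail k).
Proof.
have ts := tail_subspace k; have [t0 tD tZ] := ts; split=> //.
- by move=> b F hF; exact: tZ.
- by move=> F hF; exact: tail_shift.
move=> F hF; apply: (@tail_unshift k (mulseq wt F)).
have -> : mulseq wt F = iota c *: (F : biseq L) - iota g *: mulseq (fun n : int => n%:~R) F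
    + iota lam *: mulseq geom F.
  apply/funext => n; rewrite !biseqD biseqN !biseqZ /mulseq /weight -/(geom n); ring.
apply: (subspaceD ts); last by apply: (subspaceZ _ ts); exact: tail_geom.
apply: (subspaceB ts); first exact: subspaceZ.
by apply: (subspaceZ _ ts); exact: tail_index.
Qed.

Lemma left_bounded_submodule : @is_submodule _ _ _ _ M (@left_bounded L).
Proof.
have [t0 tD tZ] := left_bounded_subspace L; split=> //.
- by move=> b F hF; exact: tZ.
- by move=> F hF; exact: left_bounded_shift.
- by move=> F hF; apply: left_bounded_unshift; exact: left_bounded_mul.
Qed.

Definition step : M := ((fun n => (0 < n)%R%:R) : biseq L).
Definition step_sub : M -> Prop := generated (fun F => F = step).

Lemma step_submodule : is_submodule step_sub.
Proof. exact: generated_submodule. Qed.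

Lemma coef_iter_wop k n : coef (iter k wop step) n = gcoef ^+ k * geom n ^+ k * (0 < n)%R%:R.
Proof.
elim: k => [|k IH]; first by rewrite !expr0 !mul1r.
by rewrite iterS coef_wop IH !exprS; ring.
Qed.

Lemma iter_wop_in k : step_sub (iter k wop step).
Proof.
elim: k => [|k IH]; first exact: generated_in.
exact: (wop_submodule step_submodule IH).
Qed.

Lemma iter_wop_tail (k : nat) : tail k (iter k wop step).
Proof.
exists ('X - (q ^+ k)%:P).
  split=> [|i hi]; first by rewrite !hornerE oppr_eq0 expf_neq0.
  rewrite !hornerE subr_eq0 -[q ^+ k]/(q ^ k%:Z); apply/eqP => /expz_inj e.
  by rewrite e ltxx in hi.
(* On the support the sequence is geometric, so [S - q^k] leaves only the jump at [n = 1]. *)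
exists [:: 1] => n; rewrite inE => /eqP hn; rewrite pevBl pevX pevC.
rewrite -[LHS]/(coef (iter k wop step) (n - 1) - q ^+ k * coef (iter k wop step) n).
rewrite !coef_iter_wop geom_prev [(q * _) ^+ k]exprMn.
case: (ltP 0 n) => h0; last by rewrite (_ : (0 < n - 1)%R = false) ?mulr0 ?subrr //; lia.
rewrite (_ : (0 < n - 1)%R = true); last by lia.
by rewrite !mulr1 [X in _ - X]mulrCA subrr.
Qed.

(** Far to the right [P(S)] acts on [w^k step] as the scalar [P(q^k)], which is nonzero for every
    [P] allowed at level [k + 1]. *)
Lemma iter_wop_not_tail (k : nat) : ~ tail k.+1 (iter k wop step).
Proof.
case=> P [_ hP] [s hs]; set e := iter k wop step in hs.
have hPk : P.[q ^+ k] != 0 by apply: (hP k); lia.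
have h (Q : {poly L}) : exists N : nat, forall n : int, N%:Z < n ->
    pev (@shift L) Q e n = Q.[q ^+ k] * coef e n.
  elim/poly_ind: Q => [|Q b [N hN]]; first by exists 0%N => n _; rewrite pev0 horner0 mul0r.
  exists N.+1 => n hn; rewrite pevDl pevC pevMX -(pev_commute (B := @shift L)) // biseqD biseqZ.
  rewrite [X in X + _](hN (n - 1)); last by lia.
  rewrite hornerD hornerM hornerX hornerC mulrDl; congr (_ + _); rewrite -mulrA; congr (_ * _).
  rewrite !coef_iter_wop geom_prev [(q * _) ^+ k]exprMn.
  rewrite (_ : (0 < n - 1)%R = true); last by lia.
  by rewrite (_ : (0 < n)%R = true) ?mulr1 1?mulrCA //; lia.
have [N hN] := h P.
have [b hb] : exists b : nat, forall n, n \in s -> n <= b%:Z.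
  elim: (s) => [|m t [b hb]]; first by exists 0%N.
  exists (b + `|m|)%N => n; rewrite inE => /orP [/eqP ->|/hb]; lia.
pose n : int := (N + b).+1%:Z.
have : pev (@shift L) P e n = 0.
  by apply: hs; apply/negP => /hb; rewrite /n; lia.
rewrite hN; last by rewrite /n; lia.
rewrite coef_iter_wop (_ : (0 < n) = true); last by rewrite /n; lia.
by apply/eqP; rewrite !mulf_neq0 // ?oner_neq0 // expf_neq0 // ?gcoef_neq0 // /geom expfz_neq0.
Qed.

Lemma step_sub_tail F : step_sub F -> tail 0 F /\ left_bounded F.
Proof.
move=> h; split.
  apply: (h _ (tail_submodule 0)) => _ ->; exact: (iter_wop_tail 0).
apply: (h _ left_bounded_submodule) => _ ->; exists 0 => n hn.
by rewrite /step (_ : (0 < n) = false) //; lia.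
Qed.

Lemma step_sub_essential (X : M -> Prop) : is_submodule X -> (forall F, X F -> step_sub F) ->
  nonzero_sub X -> X ((fun m => (m == n1)%:R) : biseq L).
Proof.
move=> hX hXW [F hF F0]; have Xs := submodule_subspace hX.
(* The largest [L]-stable part of [X]. It is a submodule, and it is nonzero because it contains
   [q^(-n) F]. *)
pose Y (G : M) := forall l, X (l *: (G : biseq L) : biseq L).
have hY : is_submodule Y.
  split.
  - by move=> l; rewrite scaler0; exact: (subspace0 Xs).
  - by move=> G H hG hH l; rewrite scalerDr; exact: (subspaceD Xs (hG l) (hH l)).
  - move=> b G hG l; have -> : l *: (b *: G : biseq L) = (l * iota b) *: (G : biseq L) by exact: scalerA.
    exact: hG.
  - by move=> G hG l; exact: (submodule_d hX (hG l)).
  - move=> G hG l; have -> : l *: (u G : biseq L) = u (l *: (G : biseq L) : biseq L) :> biseq L.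
      apply/funext => n; rewrite biseqZ -[X in _ * X]/(wt (n + 1) * G (n + 1)).
      by rewrite -[RHS]/(wt (n + 1) * (l * G (n + 1))); ring.
    by apply: (submodule_u hX).
have YL (G : biseq L) l : Y G -> Y (l *: G) by move=> hG k; rewrite scalerA; exact: hG.
have Ys : subspace (Y : biseq L -> Prop).
  by case: hY => h0 hD _ _ _; split=> // l G; exact: YL.
have Yg G : Y G -> Y (mulseq geom G).
  move=> hG l; have XG : X G by have := hG 1; rewrite scale1r.
  exact: (wop_scaled hX l XG).
pose H : biseq L := mulseq geom F.
have YH : Y H by move=> l; exact: (wop_scaled hX l hF).
have H0 : H <> 0.
  move=> h; apply: F0; apply/funext => n; have := congr1 (fun G : biseq L => G n) h.
  by move/eqP; rewrite /H /mulseq biseq0 mulf_eq0 /geom expfz_eq0 (negbTE q0) andbF => /eqP.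
have [[P [P0 _] hP] hb] : tail 0 H /\ left_bounded H.
  by apply: step_sub_tail; apply: hXW; have := YH 1; rewrite scale1r.
have YP : Y (pev (@shift L) P H).
  by apply: (@pev_stable _ _ (@shift L) Y) => // G hG; exact: (submodule_d hY).
have [n hn] := finsupp_single geom_inj Ys Yg YP (pev_shift_neq0 P0 hb H0) hP.
by have := socle_shift hY YL hn 1; rewrite scale1r.
Qed.

Theorem step_module_counterexample : exists M' : DUModule alpha beta gamma,
  [/\ fin_generated M', monolithic M' & ~ artinian M'].
Proof.
exists (subDU step_submodule); split.
- exists [:: sub_mk step_submodule (iter_wop_in 0)] => Y hY hs w.
  have [|w' hw' e] := sub_valP w _ (sub_im_submodule hY).
    by move=> _ ->; exists (sub_mk step_submodule (iter_wop_in 0)) => //; apply: hs; rewrite inE.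
  by have -> : w = w' by apply: val_inj.
- have hne : nonzero_sub step_sub.
    exists step; first exact: (iter_wop_in 0).
    by move=> /(congr1 (fun F => coef F 1)) /eqP; rewrite oner_eq0.
  have hd := step_sub_essential step_submodule (fun F h => h) hne.
  exists (sub_mk step_submodule hd).
    move=> /(congr1 \val) /(congr1 (fun F => coef F n1)) /eqP.
    by rewrite raddf0 /= /coef eqxx oner_eq0.
  move=> Y hY [w hw w0].
  have hYW F : (exists2 v : subDU step_submodule, Y v & F = \val v) -> step_sub F.
    by case=> v _ ->; exact: sub_valP.
  have hY0 : nonzero_sub (fun F => exists2 v : subDU step_submodule, Y v & F = \val v).
    by exists (\val w); [exists w | move=> h; apply: w0; apply: val_inj; rewrite h raddf0].
  have [w' hw' e] := step_sub_essential (sub_im_submodule hY) hYW hY0.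
  by have -> : sub_mk step_submodule hd = w' by apply: val_inj.
move=> /(_ (fun k w => tail k (\val w))) [k|k w|k hk].
- exact: (sub_preim_submodule _ (tail_submodule k)).
- by case=> P [P0 hP] h; exists P => //; split=> // i hi; apply: hP; lia.
have := hk k.+1 (leqnSn k) (sub_mk step_submodule (iter_wop_in k)) => /= h.
by apply: (@iter_wop_not_tail k); apply/h; exact: iter_wop_tail.
Qed.
End WeightModuleTheory.

(** * Choice of the field and of the weights *)

Lemma quadratic_generator (K L0 : fieldType) (f : {rmorphism K -> L0}) (z : L0) (alpha beta : K) :
  z * z = f alpha * z + f beta -> ~ is_root_of_unity z ->
  exists (L : fieldType) (iota : {rmorphism K -> L}) (q : L),
    [/\ q * q = iota alpha * q + iota beta, forall l, exists s t, l = iota s + iota t * q &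
        forall n, (0 < n)%N -> q ^+ n != 1].
Proof.
(* If the quadratic has a root in [K] then [z] comes from [K] and [L = K]. Otherwise it is
   irreducible, a root [q] is adjoined, and [q^n = 1] would make the quadratic divide [X^n - 1],
   forcing [z^n = 1]. *)
move=> hz nz; have [[k hk]|nk] := pselect (exists k, k * k = alpha * k + beta).
  have [q [hq zq]] : exists q, q * q = alpha * q + beta /\ z = f q.
    have : (z - f k) * (z - f (alpha - k)) = 0.
      rewrite rmorphB; transitivity (z * z - (f alpha * z + f k * f k - f alpha * f k)); first by ring.
      by rewrite hz -rmorphM hk rmorphD rmorphM; ring.
    move/eqP; rewrite mulf_eq0 !subr_eq0 => /orP [/eqP e|/eqP e]; first by exists k.
    exists (alpha - k); split=> //.
    transitivity (alpha * alpha - alpha * k *+ 2 + k * k); first by ring.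
    by rewrite hk; ring.
  exists K, idfun, q; split=> //= [l|n n0]; first by exists l, 0; rewrite mul0r addr0.
  by apply/eqP => e; apply: nz; exists n => //; rewrite zq -rmorphXn e rmorph1.
pose p := 'X^2 - alpha *: 'X - beta%:P.
have sp : size p = 3.
  by rewrite /p -addrA -opprD size_polyDl ?size_polyXn // size_polyN
    (leq_ltn_trans (size_polyD _ _)) // gtn_max (leq_ltn_trans (size_scale_leq _ _)) ?size_polyX //
    (leq_ltn_trans (size_polyC_leq1 _)).
have pE (E : fieldType) (h : {rmorphism K -> E}) w :
    root (map_poly h p) w -> w * w = h alpha * w + h beta.
  rewrite /p !rmorphB /= map_polyXn map_polyZ map_polyX map_polyC /root !hornerE /=.
  by rewrite -addrA -opprD subr_eq0 -expr2 => /eqP ->.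
have pE' (E : fieldType) (h : {rmorphism K -> E}) w :
    w * w = h alpha * w + h beta -> root (map_poly h p) w.
  move=> e; rewrite /p !rmorphB /= map_polyXn map_polyZ map_polyX map_polyC /root !hornerE /=.
  by rewrite -addrA -opprD subr_eq0 expr2 e.
have pirr : irreducible_poly p.
  apply: cubic_irreducible; first by rewrite sp.
  move=> k; apply/negP => hk; apply: nk; exists k; apply: (pE K idfun).
  by rewrite map_poly_id.
have [L _ [q rq Lq]] := irredp_FAdjoin pirr.
pose iota : {rmorphism K -> L} := in_alg L.
have hq : q * q = iota alpha * q + iota beta by apply: pE.
exists L, iota, q; split=> // [l|n n0].
  have /Fadjoin1_polyP [r ->] : l \in <<1; q>>%VS by rewrite Lq memvf.
  elim/poly_ind: r => [|r k [s [t IH]]].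
    by exists 0, 0; rewrite !rmorph0 horner0 mul0r addr0.
  exists (t * beta + k), (s + t * alpha).
  have -> : (map_poly iota (r * 'X + k%:P)).[q] = (map_poly iota r).[q] * q + iota k.
    by rewrite rmorphD rmorphM /= map_polyX map_polyC hornerMXaddC.
  rewrite IH mulrDl -[_ * q * q]mulrA hq.
  by rewrite !rmorphD !rmorphM /=; ring.
apply/eqP => e; apply: nz; exists n => //.
have : ~~ coprimep p ('X^n - 1).
  rewrite -(coprimep_map iota); apply/negP => /coprimep_root /(_ (pE' _ _ _ hq)).
  by rewrite rmorphB rmorph1 /= map_polyXn !hornerE e subrr eqxx.
rewrite irreducible_poly_coprime // negbK -(dvdp_map f) => /root_dvdp /(_ (pE' _ _ _ hz)).
by rewrite rmorphB rmorph1 /= map_polyXn /root !hornerE subr_eq0 => /eqP.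
Qed.

(** Equality makes [n] divide [m], say [m = k n] with [k > 2], and reduces to [n^(k-1) = k], where
    the left side is too large. It bounds the zeros of the weight below. *)
Lemma expn_comm_bound n m : (1 < n)%N -> (2 * n < m)%N -> (n ^ m)%N <> (m ^ n)%N.
Proof.
move=> n1 hm e.
have : (n ^ n %| m ^ n)%N by rewrite -e dvdn_exp2l //; lia.
rewrite dvdn_pexp2r; last by lia.
case/dvdnP => k ek; rewrite ek in hm e.
have k3 : (2 < k)%N by have := hm; rewrite ltn_mul2r => /andP [].
have {}e : (n ^ k = k * n)%N.
  by move: e; rewrite expnM => /eqP; rewrite eqn_exp2r => [/eqP //|]; lia.
case: k k3 e {hm ek} => [|[|[|k]]] // _; rewrite expnSr => /eqP; rewrite eqn_pmul2r; last by lia.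
apply/negP; rewrite neq_ltn; apply/orP; right; rewrite expnS.
by apply: (@leq_trans (2 * n ^ k.+1)); [have := ltn_expl k.+1 n1; lia | rewrite leq_mul2r n1 orbT].
Qed.

(** With a fixed value [p] the weight is [p + q^(-n)], which vanishes at most once. Without one,
    [q = - beta] and the weight is [g (q^(-n) - n)] with [g = gamma / (1 + beta)]. *)
Theorem non_artinian_module (K : fieldType) (alpha beta gamma : K) (L0 : fieldType)
  (f : {rmorphism K -> L0}) (z : L0) : [pchar K] =i pred0 -> beta != 0 ->
  z * z = f alpha * z + f beta -> ~ is_root_of_unity z ->
  exists M : DUModule alpha beta gamma, [/\ fin_generated M, monolithic M & ~ artinian M].
Proof.
move=> char0 beta0 hz nz.
have [L [iota [q [hq hLK hq1]]]] := quadratic_generator hz nz.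
have q1 : q != 1 by have := hq1 1%N isT.
have q0 : q != 0 := q_neq0 beta0 hq.
have [[p hp]|np] := pselect (exists p, p = alpha * p + beta * p + gamma).
  have hg : 0 = alpha * 0 + beta * 0 by rewrite !mulr0 addr0.
  have hc : p + 0 = alpha * p + beta * p - beta * 0 + gamma by rewrite mulr0 subr0 addr0.
  have wE n : weight iota q p 0 1 n = iota p + q ^ (- n).
    by rewrite /weight rmorph0 mul0r subr0 rmorph1 mul1r.
  have [n1 hn1] : exists n1, forall n, n1 < n -> weight iota q p 0 1 n != 0.
    have [[n1 e1]|h] := pselect (exists n, weight iota q p 0 1 n = 0); last first.
      by exists 0 => n _; apply/eqP => e; apply: h; exists n.
    exists n1 => n hn; apply/eqP => e; have : q ^ (- n) = q ^ (- n1).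
      by apply: (addrI (iota p)); rewrite -!wE e.
    by move/(expz_inj beta0 hq hq1)/oppr_inj => e'; rewrite e' ltxx in hn.
  exact: (step_module_counterexample beta0 hq hLK hq1 (oner_neq0 K) hg hc hn1).
have h1 : 1 - alpha - beta = 0.
  apply/eqP; apply: contraT => h; case: np; exists (gamma / (1 - alpha - beta)).
  by field.
have hal : alpha = 1 - beta by apply/eqP; rewrite -subr_eq0 -oppr_eq0 -h1; apply/eqP; ring.
have g0 : gamma != 0.
  by apply/negP => /eqP e; case: np; exists 0; rewrite e !mulr0 !addr0.
have qb : q = - iota beta.
  have : (q - 1) * (q + iota beta) = 0.
    transitivity (q * q - (1 - iota beta) * q - iota beta); first by ring.
    by rewrite hq hal rmorphB rmorph1; ring.
  by move/eqP; rewrite mulf_eq0 subr_eq0 (negbTE q1) addr_eq0 => /eqP.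
have b1 : 1 + beta != 0.
  apply: contraNneq q1 => e; rewrite qb -rmorphN; apply/eqP; rewrite -(rmorph1 iota); congr (iota _).
  by apply/eqP; rewrite eq_sym -subr_eq0 opprK e.
pose g := gamma / (1 + beta); have gg : g != 0 by rewrite mulf_neq0 ?invr_eq0.
have hg : g = alpha * g + beta * g by rewrite -mulrDl hal subrK mul1r.
have hc : 0 + g = alpha * 0 + beta * 0 - beta * g + gamma.
  by rewrite /g; field.
have wE n : weight iota q 0 g g n = iota g * (q ^ (- n) - n%:~R).
  by rewrite /weight rmorph0 add0r mulrBr addrC.
have charL := pchar0_rmorph iota char0.
have zE (n : nat) : weight iota q 0 g g n%:Z = 0 -> n%:R * q ^+ n = 1.
  move/eqP; rewrite wE mulf_eq0 fmorph_eq0 (negbTE gg) subr_eq0 /= -exprnN => /eqP e.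
  by rewrite -[n%:R]/(n%:Z%:~R) -e mulVf // expf_neq0.
have [n1 hn1] : exists n1, forall n, n1 < n -> weight iota q 0 g g n != 0.
  have [[n [n0 e1]]|h] := pselect (exists n : nat, (0 < n)%N /\ weight iota q 0 g g n%:Z = 0); last first.
    exists 0 => -[n|n] // n0; apply/eqP => e; apply: h; exists n; split=> //.
  (* Zeros at [n] and [m] give [n q^n = 1 = m q^m]; raising to the powers [m] and [n] yields
     [n^m = m^n], impossible for [m > 2 n]. *)
  exists (2 * n)%:Z => -[m|m] // hm; apply/eqP => e2.
  have n1 : (1 < n)%N.
    by case: n n0 e1 {hm} => [|[|n]] // _ /zE /eqP; rewrite mul1r (negbTE q1).
  apply: (@expn_comm_bound n m n1 hm); apply: (natr_inj_pchar0 charL).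
  have /(congr1 (fun w => w ^+ m)) := zE _ e1; have /(congr1 (fun w => w ^+ n)) := zE _ e2.
  rewrite !exprMn !expr1n -!exprM [(m * n)%N]mulnC => e3 e4.
  by apply: (mulIf (x := q ^+ (n * m))); rewrite ?expf_neq0 // !natrX e3 e4.
exact: (step_module_counterexample beta0 hq hLK hq1 gg hg hc hn1).
Qed.

Theorem theorem4p1 (K : fieldType) (alpha beta gamma : K) :
  [pchar K] =i pred0 -> beta != 0 ->
  ((forall M : DUModule alpha beta gamma,
      fin_generated M -> monolithic M -> artinian M)
   <->
   (forall (L : closedFieldType) (f : {rmorphism K -> L}) (z : L),
      root ('X^2 - (f alpha)%:P * 'X - (f beta)%:P) z -> is_root_of_unity z)).
Proof.
move=> char0 beta0.
have rootE (L : fieldType) (a b z : L) :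
    root ('X^2 - a%:P * 'X - b%:P) z = (z * z == a * z + b).
  by rewrite /root !hornerE -addrA -opprD subr_eq0 expr2.
split=> [h L f z|h M].
  rewrite rootE => /eqP hz; apply: contrapT => nz.
  have [M [hfg hmono]] := non_artinian_module gamma char0 beta0 hz nz.
  by apply; apply: h.
(* The assumption speaks of all algebraically closed extensions, so one has to be produced before it
   yields anything. *)
have [L [f]] := algebraically_closed_extension K.
have [z1 hz1] : exists z, z ^+ 2 = f alpha * z + f beta.
  have [z hz] := solve_monicpoly (fun i => if i == 0%N then f beta else f alpha) (isT : (0 < 2)%N).
  by exists z; rewrite hz !big_ord_recl big_ord0 /= expr0 mulr1 expr1 addr0 addrC.
pose z2 := f alpha - z1.
have [n1 n10 e1] : is_root_of_unity z1 by apply: (h L f); rewrite rootE -expr2 hz1.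
have [n2 n20 e2] : is_root_of_unity z2.
  apply: (h L f); rewrite rootE /z2; apply/eqP.
  transitivity (f alpha * f alpha - f alpha * z1 *+ 2 + z1 ^+ 2); first by ring.
  by rewrite hz1; ring.
apply: (roots_of_unity_artinian char0 beta0 (f := f) (z1 := z1) (z2 := z2) (N := (n1 * n2)%N)).
- by rewrite muln_gt0 n10.
- by rewrite exprM e1 expr1n.
- by rewrite mulnC exprM e2 expr1n.
- by rewrite /z2 addrC subrK.
- by rewrite /z2 mulrBr -expr2 hz1; ring.
Qed.
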